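(* There exist suitably large constants $\Theta>0$ and $c>1$ such that the following holds. Let $Q$ be large and let $\{\mathbb Y(n)\}_{q_n\leq Q}$ be independent random variables satisfying CRVH$(\mathbb Y)$. Let $V$ satisfy $c\leq V\leq R$, where \[ R:=\begin{cases}\frac{\alpha}{A}(\log Q)^A+C_{\mathcal A}-(\alpha\log\log Q+\Theta)(\log Q)^{A-1} & \text{if } A>0,\\ \alpha\log\log Q+C_{\mathcal A}-(\alpha\log\log Q+\Theta)/\log Q & \text{if } A=0,\end{cases} \] and let $Z=Z(V)$ be the smallest number $z$ for which $H(z)\geq V$. Then \[ \Phi_Q(\mathbb Y,V)=\exp\left(-\alpha e^{-\eta_{\mathbb Y}-1}Z(\log Z)^{A-1}\left(1+O\left(\sqrt{\mathcal E(Z)}\right)\right)\right), \] where $\mathcal E(Z):=\frac{\log\log Z}{\log Z}+\frac{1}{(\log Z)^{B-1}}$.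
   Context: Let $\mathcal A=\{1\leq q_1\leq q_2\leq \dots\}$ be an infinite sequence of real numbers such that for $x\geq 2\beta'$, $\mathcal A(x):=\#\{n: q_n\leq x\} = \alpha \int_{\beta'}^x (\log (t/\beta))^{A-1}(1+O(1/(\log t)^B))\,dt$, where $\alpha,\beta>0$, $A\geq 0$, $B>\max\{A,1\}$ are constants and $\beta'=(2+\beta)^2$. Let $H(x)=\sum_{q_n\leq x}1/q_n$. Let $C_{\mathcal A}$ be the constant such that $H(y)=\frac{\alpha}{A}(\log (y/\beta))^A+C_{\mathcal A}+o(1)$ as $y\to\infty$ if $A>0$, and $H(y)=\alpha\log\log(y/\beta)+C_{\mathcal A}+o(1)$ if $A=0$. Put $H_{\mathbb Y}(Q)=\sum_{q_n\leq Q}\mathbb Y(n)/q_n$ and $\Phi_Q(\mathbb Y,V)=\mathbb P(H_{\mathbb Y}(Q)>V)$. CRVH$(\mathbb{Y})$: the independent random variables $\mathbb Y(n)$ satisfy: (i) each $\mathbb Y(n)$ is supported on $[-1,1]$ with $\mathbb E(\mathbb Y(n))=0$; (ii) there is an absolute constant $c_0>0$ with $\mathbb P(\mathbb Y(n)>1-1/t)\gg \exp(-c_0e^{\sqrt t})$ for all $t\geq 1$, with absolute implied constant; (iii) there exist independent random variables $\{\mathbb Y_n\}_{n\geq1}$, each distributed identically to a random variable $\mathbb Y$, such that $\mathbb Y(n)$ depends on $\mathbb Y_n$ and $\mathbb Y(n)=\mathbb Y_n+O(1/(\log n)^2)$. Define $f_{\mathbb Y}(t)=\log\mathbb E(e^{t\mathbb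 Y})$ for $0\leq t<1$, $f_{\mathbb Y}(t)=\log\mathbb E(e^{t\mathbb Y})-t$ for $t\geq1$, and $\eta_{\mathbb Y}=\int_0^\infty f_{\mathbb Y}(u)u^{-2}\,du$. *)

(* Defs.v *)
From HB Require Import structures.
From mathcomp Require Import all_boot all_order all_algebra finmap.
From mathcomp Require Import all_classical all_reals all_analysis.
Import Order.TTheory GRing.Theory Num.Theory.
Import numFieldNormedType.Exports.

Set Implicit Arguments.
Unset Strict Implicit.
Unset Printing Implicit Defensive.

Local Open Scope classical_set_scope.
Local Open Scope ring_scope.

(* Sequences are 0-based: [q n] is q_(n+1), and likewise [Y n] is Y(n+1). *)

Section Sequence.
Context {R : realType}.
Implicit Types (q : nat -> R) (alpha beta A B : R).

Definition beta' beta : R := (2 + beta) ^+ 2.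

(* The O-term sits under an integral whose value is a step function of x, so the
   function [e] it stands for depends on x; only its bound is uniform in x. *)
Definition counting_hypothesis alpha beta A B q : Prop :=
  exists C : R, forall x, 2 * beta' beta <= x ->
    exists e : R -> R,
      [/\ measurable_fun `[beta' beta, x] e,
          (forall t, t \in `[beta' beta, x] -> `|e t| <= C / (ln t `^ B))
        & counting [set n | q n <= x] =
          (alpha * \int[lebesgue_measure]_(t in `[beta' beta, x])
             (ln (t / beta) `^ (A - 1) * (1 + e t)))%:E].

Definition Hsum q (x : R) : R := \sum_(n \in [set n | q n <= x]) (q n)^-1.

Definition Hmain alpha beta A (y : R) : R :=
  if A == 0 then alpha * ln (ln (y / beta))
  else alpha / A * ln (y / beta) `^ A.

Definition is_CA alpha beta A q (CA : R) : Prop :=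
  Hsum q y - Hmain alpha beta A y @[y --> +oo] --> CA.

Definition Rbound alpha A (CA Theta Q : R) : R :=
  if A == 0 then
    alpha * ln (ln Q) + CA - (alpha * ln (ln Q) + Theta) / ln Q
  else
    alpha / A * ln Q `^ A + CA
      - (alpha * ln (ln Q) + Theta) * ln Q `^ (A - 1).

Definition is_smallest (S : set R) (z : R) : Prop :=
  S z /\ forall z', S z' -> z <= z'.

Definition Eterm B (z : R) : R := ln (ln z) / ln z + (ln z `^ (B - 1))^-1.

End Sequence.

Section Random.
Context {R : realType}.

Definition mutually_independent d (T : measurableType d) (P : probability T R)
    d' (U : measurableType d') (X : nat -> T -> U) : Prop :=
  forall (J : {fset nat}) (D : nat -> set U),
    (forall n, measurable (D n)) ->
    P (\bigcap_(n in [set` J]) (X n @^-1` D n)) =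
    (\prod_(n <- J) P (X n @^-1` D n))%E.

(* The absolute constants are explicit: c0 and c1 are the exponent and the
   implied constant of the lower tail bound, c2 is the implied constant in
   Y(n) = Y_n + O(1/(log n)^2).  Only the law of [Y] matters, so it may live on
   its own probability space.
   "Y(n) depends on Y_n" is read as: Y(n) is coupled with Y_n and with no other
   Y_m, i.e. the pairs (Y(n), Y_n) are mutually independent; this covers in
   particular the case where Y(n) is a measurable function of Y_n.
   The approximation is void for the first term, where log 1 = 0. *)
Definition CRVH (c0 c1 c2 : R)
    d (T : measurableType d) (P : probability T R) (Yn : nat -> {RV P >-> R})
    d' (T' : measurableType d') (P' : probability T' R) (Y : {RV P' >-> R})
    : Prop :=
  [/\ mutually_independent P (fun n => Yn n : T -> R),
      (forall n, {ae P, forall w, `|Yn n w| <= 1} /\ ('E_P[Yn n] = 0)%E),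
      (forall n (t : R), 1 <= t ->
         ((c1 * expR (- c0 * expR (Num.sqrt t)))%:E
           <= P [set w | (1 - t^-1 < Yn n w)%R])%E)
    & exists Yt : nat -> {RV P >-> R},
      [/\ mutually_independent P (fun n => Yt n : T -> R),
          (forall n (D : set R), measurable D ->
             distribution P (Yt n) D = distribution P' Y D),
          mutually_independent P (fun n w => (Yn n w, Yt n w))
        & forall n, (0 < n)%N ->
            {ae P, forall w, `|Yn n w - Yt n w| <= c2 / ln n.+1%:R ^+ 2}]].

Definition fY d (T : measurableType d) (P : probability T R)
    (Y : {RV P >-> R}) (t : R) : R :=
  let L := ln (fine ('M_P Y t)%E) in
  if t < 1 then L else L - t.

Definition etaY d (T : measurableType d) (P : probability T R)
    (Y : {RV P >-> R}) : R :=
  \int[lebesgue_measure]_(u in `]0, +oo[) (fY Y u / u ^+ 2).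

Definition HY (q : nat -> R) d (T : measurableType d) (P : probability T R)
    (Yn : nat -> {RV P >-> R}) (Q : R) (w : T) : R :=
  \sum_(n \in [set n | q n <= Q]) (Yn n w / q n).

Definition PhiQ (q : nat -> R) d (T : measurableType d) (P : probability T R)
    (Yn : nat -> {RV P >-> R}) (Q V : R) : \bar R :=
  P [set w | V < HY q Yn Q w].

End Random.

(* Main.v *)
(* By independence, log E exp(s H_Y) is the sum over n of the cumulant generating functions of
   Y(n) at s / q_n.  Write s = Z e^lambda.  After subtraction of s H(Z), Abel summation with
   A(x) ~ alpha x (log x)^(A-1) turns this sum into alpha s (log Z)^(A-1) (lambda + eta), up
   to a relative error of order eps = loglog Z / log Z; here V <= R gives Z <= Q / log Q, so
   that the sum is hardly affected by the cutoff at Q.  Hence, with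
   m = alpha e^(-eta-1) Z (log Z)^(A-1) and u = lambda + 1 + eta, the Chernoff exponent
   log E exp(s H_Y) - s V is m e^u (u - 1) up to O(m eps), minimal at u = 0 with value - m.
   Comparing the tilts u = 0, mu, 2 mu with mu of order sqrt eps shows that the tilted mass
   lies just above V, so Chernoff's bound is attained up to a factor exp(O(m sqrt eps)). *)

Require Import Defs.
From HB Require Import structures.
From mathcomp Require Import all_boot all_order all_algebra finmap.
From mathcomp Require Import all_classical all_reals all_analysis.
From mathcomp Require Import measurable_realfun ring lra.
Import Order.TTheory GRing.Theory Num.Theory.
Import numFieldNormedType.Exports.

Local Open Scope classical_set_scope.
Local Open Scope ring_scope.

Set Implicit Arguments.
Unset Strict Implicit.
Unset Printing Implicit Defensive.

(** * Integration on compact intervals and Abel summation *)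

(** With y = log q, sums over q_n become integrals of the density n(y) = N(e^y) e^(-y) against
    weights built from g', g being a cumulant generating function: 1 - g'(e^(s-y)) to the left of L
    = log Z, and g'(e^(s-y)) to the right. The lower tail hypothesis (ii) makes the left weight
    O((1+L-y)^-2). Hence eta converges, and the drift of the density, of size (1+L-y) L^(A-2), costs
    only the integral of 1/(1+L-y): this is the source of loglog Z. On the right, E Y = 0 makes the
    weight O(e^(L-y)). Three points shape the details. The constants must be uniform in the laws, so
    these enter only through bounds governed by c0, c1, c2. The o(1) defining C_A has no rate, while
    V <= R calls for H(Q / log Q) up to O((log Q)^(A-1)); for A < 1 the rate is recovered from the
    counting hypothesis. Finally H jumps at Z, so that V and H(Z) must be shown to differ by O((log
    Z)^(A-2)) only. The square root is the price of the lower bound: a tilt by mu moves the rate by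
    about m mu^2, which has to beat the error m eps, while the window then needed above V costs
    about m mu. *)

Section RealIntegrable.
Context d (T : measurableType d) {R : realType} (m : {measure set T -> \bar R}).
Variables (D : set T) (mD : measurable D).
Implicit Types f g : T -> R.

Lemma integrable_addR f g : m.-integrable D (EFin \o f) ->
  m.-integrable D (EFin \o g) -> m.-integrable D (EFin \o (fun y => f y + g y)).
Proof.
move=> fi gi; have -> : EFin \o (fun y => f y + g y) =
    ((EFin \o f) \+ (EFin \o g))%E by apply/funext => y /=; rewrite EFinD.
exact: integrableD.
Qed.

Lemma integrable_subR f g : m.-integrable D (EFin \o f) ->
  m.-integrable D (EFin \o g) -> m.-integrable D (EFin \o (fun y => f y - g y)).
Proof.
move=> fi gi; have -> : EFin \o (fun y => f y - g y) =
    ((EFin \o f) \- (EFin \o g))%E by apply/funext => y /=; rewrite EFinB.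
exact: integrableB.
Qed.

Lemma integrable_scaleR (c : R) f : m.-integrable D (EFin \o f) ->
  m.-integrable D (EFin \o (fun y => c * f y)).
Proof.
move=> fi; have -> : EFin \o (fun y => c * f y) =
    (fun y => c%:E * (EFin \o f) y)%E by apply/funext => y /=; rewrite EFinM.
exact: integrableZl.
Qed.

Lemma integrable_normR f : m.-integrable D (EFin \o f) ->
  m.-integrable D (EFin \o (fun y => `|f y|)).
Proof. exact: integrable_abse. Qed.

End RealIntegrable.

Section IntervalIntegral.
Context {R : realType}.
Implicit Types (a b c : R) (f g F : R -> R).
Notation mu := (@lebesgue_measure R).
Notation int a b f := (\int[mu]_(y in `[a, b]) (f y)).

Lemma bounded_integrable_itv a b f M :
  measurable_fun `[a, b] f -> (forall y, a <= y <= b -> `|f y| <= M) ->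
  mu.-integrable `[a, b] (EFin \o f).
Proof.
move=> mf fM; apply: (@le_integrable _ _ _ mu `[a, b] _ _ (cst M%:E)) => //.
- exact/measurable_EFinP.
- move=> y /=; rewrite in_itv/= => yab; rewrite lee_fin (le_trans (fM _ yab))//.
  exact: ler_norm.
- apply/integrableP; split; first exact: measurable_cst.
  under eq_integral do rewrite /=.
  rewrite integral_cst//= lebesgue_measure_itv/=.
  by case: ifP => _; rewrite ?mule0 ?ltry// -EFinD -EFinM ltry.
Qed.

Lemma continuous_integrable_itv a b f :
  {within `[a, b], continuous f} -> mu.-integrable `[a, b] (EFin \o f).
Proof. by move=> cf; exact/continuous_compact_integrable/cf/segment_compact. Qed.

Lemma continuous_bounded_itv a b f : {within `[a, b], continuous f} ->
  exists M, forall y, a <= y <= b -> `|f y| <= M.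
Proof.
move=> cf; have /compact_bounded[M [_ /(_ (M+1)) fM]] :=
  continuous_compact cf (@segment_compact R a b).
exists (M + 1) => y yX; apply: (fM _ (f y)); first by lra.
by exists y => //=; rewrite in_itv.
Qed.

Lemma continuous_mul_integrable_itv a b f g M :
  {within `[a, b], continuous f} -> measurable_fun `[a, b] g ->
  (forall y, a <= y <= b -> `|g y| <= M) ->
  mu.-integrable `[a, b] (EFin \o (fun y => f y * g y)).
Proof.
move=> cf mg gM; have [K fK] := continuous_bounded_itv cf.
apply: (@bounded_integrable_itv _ _ _ (K * M)).
  by apply: measurable_funM => //; exact: subspace_continuous_measurable_fun.
by move=> y yab; rewrite normrM ler_pM ?fK ?gM.
Qed.

Lemma integrable_itvS a b c d f : c <= a -> b <= d ->
  mu.-integrable `[c, d] (EFin \o f) -> mu.-integrable `[a, b] (EFin \o f).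
Proof.
move=> ca bd; apply: integrableS => //.
by move=> x /=; rewrite !in_itv/= => /andP[? ?]; apply/andP; split; lra.
Qed.

Lemma int_chasles a b c f : a <= b -> b <= c ->
  mu.-integrable `[a, c] (EFin \o f) -> int a c f = int a b f + int b c f.
Proof.
move=> ab bc fi.
have := @Rintegral_itvB R f (BLeft a) (BRight c) b fi.
rewrite !bnd_simp => /(_ ab bc).
rewrite Rintegral_itv_obnd_cbnd; first by move=> <-; rewrite addrC subrK.
apply: integrableS fi => //.
by move=> x /=; rewrite !in_itv/= => /andP[? ?]; apply/andP; split; lra.
Qed.

Lemma int_FTC F f a b : a <= b ->
  (forall y, a <= y <= b -> is_derive y 1 F (f y)) ->
  (forall y, a <= y <= b -> {for y, continuous f}) ->
  int a b f = F b - F a.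
Proof.
rewrite le_eqVlt => /predU1P[<- _ _|ab dF cf].
  by rewrite set_itv1 Rintegral_set1 subrr.
have cF y : a <= y <= b -> {for y, continuous F}.
  by move=> /dF[dFy _]; apply/differentiable_continuous/derivable1_diffP.
rewrite /Rintegral (@continuous_FTC2 _ f F)//.
- apply/continuous_within_itvP => //; split.
  + by move=> y; rewrite in_itv/= => /andP[? ?]; apply: cf; apply/andP; split; lra.
  + by apply/cvg_at_right_filter/cf; apply/andP; split; lra.
  + by apply/cvg_at_left_filter/cf; apply/andP; split; lra.
- split.
  + move=> y; rewrite in_itv/= => /andP[? ?].
    by have [] : is_derive y 1 F (f y) by apply: dF; apply/andP; split; lra.
  + by apply/cvg_at_right_filter/cF; apply/andP; split; lra.
  + by apply/cvg_at_left_filter/cF; apply/andP; split; lra.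
- move=> y; rewrite in_itv/= => /andP[? ?]; rewrite derive1E.
  by apply: derive_val; apply: dF; apply/andP; split; lra.
Qed.

Lemma cts_within a b f : (forall y, a <= y <= b -> {for y, continuous f}) ->
  {within `[a, b], continuous f}.
Proof.
move=> cf; apply: continuous_in_subspaceT => y.
by rewrite inE/= in_itv/= => /cf.
Qed.

Lemma int_le a b f g :
  mu.-integrable `[a, b] (EFin \o f) -> mu.-integrable `[a, b] (EFin \o g) ->
  (forall y, a <= y <= b -> f y <= g y) -> int a b f <= int a b g.
Proof.
by move=> fi gi fg; apply: le_Rintegral => // y /=; rewrite in_itv/=; exact: fg.
Qed.

Lemma int_norm_le a b f g :
  mu.-integrable `[a, b] (EFin \o f) -> mu.-integrable `[a, b] (EFin \o g) ->
  (forall y, a <= y <= b -> `|f y| <= g y) -> `|int a b f| <= int a b g.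
Proof.
move=> fi gi fg; apply: le_trans (le_normr_Rintegral _ fi) _ => //.
by apply: int_le => //; exact: integrable_normR.
Qed.

(** The form in which error integrals are estimated below: a pointwise majorant whose primitive is
    explicit. *)
Lemma int_norm_le_FTC a b f G g : a <= b ->
  mu.-integrable `[a, b] (EFin \o f) ->
  (forall y, a <= y <= b -> is_derive y 1 G (g y)) ->
  (forall y, a <= y <= b -> {for y, continuous g}) ->
  (forall y, a <= y <= b -> `|f y| <= g y) -> `|int a b f| <= G b - G a.
Proof.
move=> ab fi dG cg fg; rewrite -(int_FTC _ dG)//; apply: int_norm_le => //.
exact/continuous_integrable_itv/cts_within.
Qed.

Section Abel.
Variables (x : nat -> R) (k : R -> nat).
Hypothesis x_ge0 : forall n, 0 <= x n.
Hypothesis kP : forall n y, (x n <= y) = (n < k y)%N.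

Lemma k_ndecr y z : y <= z -> (k y <= k z)%N.
Proof.
move=> yz; rewrite leqNgt; apply/negP => kzy.
have : x (k z) <= y by rewrite kP.
by move=> /le_trans /(_ yz); rewrite kP ltnn.
Qed.

Lemma kR_ndecr : {homo (fun y => (k y)%:R : R) : y z / y <= z}.
Proof. by move=> y z /k_ndecr; rewrite ler_nat. Qed.

Lemma k_integrable (X : R) (G : R -> R) : {within `[0, X], continuous G} ->
  mu.-integrable `[0, X] (EFin \o (fun y => (k y)%:R * G y)).
Proof.
move=> cG.
have [M GM] := continuous_bounded_itv cG.
apply: (@bounded_integrable_itv _ _ _ ((k X)%:R * M)).
  apply: measurable_funM; last exact: subspace_continuous_measurable_fun.
  by apply: nondecreasing_measurable => //; exact: kR_ndecr.
move=> y yX; rewrite normrM ler_pM// ?GM//.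
by rewrite ger0_norm ?ler0n// kR_ndecr//; case/andP: yX.
Qed.

(** Each [G (x i)] is [G X] minus the integral of [g] over [[x i, X]]. Exchanging the finite sum
    with the integral counts, at each y, the [x i] below y, which is [k y]. *)
Lemma abel_summation (X : R) (G g : R -> R) : 0 <= X ->
  (forall y, 0 <= y <= X -> is_derive y 1 G (g y)) ->
  (forall y, 0 <= y <= X -> {for y, continuous g}) ->
  \sum_(i < k X) G (x i) =
  (k X)%:R * G X - int 0 X (fun y => (k y)%:R * g y).
Proof.
move=> X0 dG cg.
have gi : mu.-integrable `[0, X] (EFin \o g).
  exact/continuous_integrable_itv/cts_within.
pose u (i : nat) (y : R) : R := if x i <= y then g y else 0.
have ui i : mu.-integrable `[0, X] (EFin \o u i).
  have -> : EFin \o u i = (fun y => (\1_(`[x i, +oo[) y)%:E * (EFin \o g) y)%E.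
    apply/funext => y; rewrite /u/= indicE mem_setE/= in_itv/= andbT.
    by case: ifPn => _; rewrite ?mul1e ?mul0e.
  apply: (le_integrable _ _ _ gi) => //.
  - apply: emeasurable_funM; first by apply/measurable_EFinP; exact: measurable_indic.
    exact: (measurable_int mu).
  - move=> y _ /=; rewrite indicE lee_fin normrM; case: (_ \in _).
      by rewrite normr1 mul1r.
    by rewrite normr0 mul0r.
have eqG i : (i < k X)%N -> G X - G (x i) = int 0 X (u i).
  rewrite -kP => xX; have x0 := x_ge0 i.
  have <- : int (x i) X g = G X - G (x i).
    apply: int_FTC => // y /andP[? ?].
      by apply: dG; apply/andP; split; lra.
    by apply: cg; apply/andP; split; lra.
  rewrite Rintegral_mkcond [RHS]Rintegral_mkcond; apply: eq_Rintegral => y _.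
  rewrite /patch/= !mem_setE !in_itv/= /u.
  by case: (leP (x i) y) => xy //=; case: (leP y X) => yX; case: (leP 0 y) => //=; lra.
(* Integrability of the partial sum is carried along, because additivity of the integral requires it
   at the next step. *)
have key m : (m <= k X)%N ->
    int 0 X (fun y => \sum_(i < m) u i y) = \sum_(i < m) (G X - G (x i)) /\
    mu.-integrable `[0, X] (EFin \o (fun y => \sum_(i < m) u i y)).
  elim: m => [_|m IH mk].
    rewrite big_ord0; split.
      under eq_Rintegral do rewrite big_ord0.
      by rewrite Rintegral_cst// mul0r.
    under [X in integrable _ _ X]eq_fun do rewrite /= big_ord0.
    exact: integrable0.
  have [IH1 IH2] := IH (ltnW mk).
  have -> : (fun y => \sum_(i < m.+1) u i y) =
            (fun y => \sum_(i < m) u i y + u m y).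
    by apply/funext => y; rewrite big_ord_recr.
  rewrite big_ord_recr/= RintegralD//; split; first by rewrite IH1 -eqG.
  exact: integrable_addR.
have [E _] := key _ (leqnn _).
have -> : int 0 X (fun y => (k y)%:R * g y) =
    int 0 X (fun y => \sum_(i < k X) u i y).
  apply: eq_Rintegral => y; rewrite inE/= in_itv/= => /andP[y0 yX].
  rewrite /u -big_mkcond/= (eq_bigl (fun i : 'I_(k X) => (i < k y)%N)).
    by rewrite -(big_ord_widen _ (fun=> g y)) ?k_ndecr// sumr_const card_ord mulr_natl.
  by move=> i; rewrite kP.
rewrite E big_split/= sumr_const card_ord sumrN mulr_natl.
by rewrite opprD opprK addrA subrr add0r.
Qed.

End Abel.
End IntervalIntegral.

(** * Derivatives of explicit functions and elementary inequalities for powers and logarithms *)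

Section DerivativeRules.
Context {R : realType}.
Implicit Types (f g : R -> R) (x b df dg : R).

Lemma is_derive_continuous f x df : is_derive x 1 f df -> {for x, continuous f}.
Proof. by case=> d _; apply/differentiable_continuous/derivable1_diffP. Qed.

Lemma is_derive_add f g x df dg : is_derive x 1 f df -> is_derive x 1 g dg ->
  is_derive x 1 (fun t => f t + g t) (df + dg).
Proof. by move=> Hf Hg; exact: is_deriveD. Qed.

Lemma is_derive_sub f g x df dg : is_derive x 1 f df -> is_derive x 1 g dg ->
  is_derive x 1 (fun t => f t - g t) (df - dg).
Proof. by move=> Hf Hg; exact: is_deriveB. Qed.

Lemma is_derive_neg f x df : is_derive x 1 f df ->
  is_derive x 1 (fun t => - f t) (- df).
Proof. by move=> Hf; exact: is_deriveN. Qed.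

Lemma is_derive_mul f g x df dg : is_derive x 1 f df -> is_derive x 1 g dg ->
  is_derive x 1 (fun t => f t * g t) (f x * dg + df * g x).
Proof.
move=> Hf Hg; have := is_deriveM Hf Hg.
by rewrite /GRing.scale/= [g x * df]mulrC.
Qed.

Lemma is_derive_const x b : is_derive x 1 (fun=> b) 0.
Proof. exact: is_derive_cst. Qed.

Lemma is_derive_var x : is_derive x 1 (fun t : R => t) 1.
Proof. exact: is_derive_id. Qed.

Lemma is_derive_scale f x b df : is_derive x 1 f df ->
  is_derive x 1 (fun t => b * f t) (b * df).
Proof. by move=> Hf; exact: is_deriveZ. Qed.

Lemma is_derive_subl f x b df : is_derive x 1 f df ->
  is_derive x 1 (fun t => b - f t) (- df).
Proof.
move=> Hf; rewrite -[- df]add0r; exact: is_derive_sub (is_derive_const _ _) Hf.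
Qed.

Lemma is_derive_subr f x b df : is_derive x 1 f df ->
  is_derive x 1 (fun t => f t - b) df.
Proof.
move=> Hf; rewrite -[df]subr0; exact: is_derive_sub Hf (is_derive_const _ _).
Qed.

Lemma is_derive_addr f x b df : is_derive x 1 f df ->
  is_derive x 1 (fun t => f t + b) df.
Proof.
move=> Hf; rewrite -[df]addr0; exact: is_derive_add Hf (is_derive_const _ _).
Qed.

Lemma is_derive_comp (h f : R -> R) x df dh : is_derive x 1 f df ->
  is_derive (f x) 1 h dh -> is_derive x 1 (fun t => h (f t)) (dh * df).
Proof. by move=> Hf Hh; exact: is_derive1_comp. Qed.

Lemma is_derive_expRf f x df : is_derive x 1 f df ->
  is_derive x 1 (fun t => expR (f t)) (expR (f x) * df).
Proof. by move=> /is_derive_comp; apply; exact: is_derive_expR. Qed.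

Lemma is_derive_lnf f x df : 0 < f x -> is_derive x 1 f df ->
  is_derive x 1 (fun t => ln (f t)) ((f x)^-1 * df).
Proof. by move=> fx /is_derive_comp; apply; exact: is_derive1_ln. Qed.

Lemma is_derive_powRf f x b df : 0 < f x -> is_derive x 1 f df ->
  is_derive x 1 (fun t => f t `^ b) (b * f x `^ (b - 1) * df).
Proof.
by move=> fx /is_derive_comp H; apply: (H (fun y => y `^ b)); exact: is_derive1_powR.
Qed.

Lemma is_derive_val_eq f x df dg : is_derive x 1 f df -> df = dg ->
  is_derive x 1 f dg.
Proof. by move=> H <-. Qed.

End DerivativeRules.

Section RealInequalities.
Context {R : realType}.
Implicit Types (a b c x y z L M : R).

Lemma norm_expR_sub1_le z : `|expR z - 1| <= `|z| * expR `|z|.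
Proof.
have [z0|z0] := leP 0 z.
  rewrite ger0_norm ?subr_ge0 -?expR0 ?ler_expR// expR0.
  have := expR_ge1Dx (- z); rewrite expRN => H.
  have := expR_gt0 z => ez.
  have : (1 - z) * expR z <= 1 by rewrite -ler_pdivlMr// mul1r; lra.
  rewrite (ger0_norm z0); lra.
rewrite ler0_norm; last by rewrite subr_le0 expR_le1 ltW.
rewrite ltr0_norm//; have := expR_ge1Dx z => H.
have : 1 <= expR (- z) by rewrite -expR0 ler_expR; lra.
nra.
Qed.

Lemma powR_split y a : 0 < y -> y `^ a = y * y `^ (a - 1).
Proof.
move=> y0; rewrite -{2}(powRr1 (ltW y0)) -powRD; last first.
  by rewrite (gt_eqF y0) implybT.
by congr (_ `^ _); ring.
Qed.

Lemma powR_lipschitz a y L : 0 < L -> L / 2 <= y ->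
  `|y `^ a - L `^ a| <=
  2 * `|a| * `|y - L| * L `^ (a - 1) * expR (2 * `|a| * `|y - L| / L).
Proof.
move=> L0 Ly; have y0 : 0 < y by lra.
have tau : `|ln y - ln L| <= 2 * `|y - L| / L.
  rewrite -ln_div//; have yL : 0 < y / L by rewrite divr_gt0.
  rewrite ler_norml; apply/andP; split.
    rewrite lerNl -lnV ?posrE// invf_div.
    have -> : L / y = 1 + (L / y - 1) by ring.
    apply: le_trans (le_ln1Dx _) _.
      by have := divr_gt0 L0 y0; lra.
    rewrite -subr_ge0.
    have -> : 2 * `|y - L| / L - (L / y - 1) =
      (2 * `|y - L| * y - (L - y) * L) / (L * y).
      by field; rewrite !gt_eqF.
    apply: divr_ge0; last by rewrite mulr_ge0// ltW.
    have := normr_ge0 (y - L); have := ler_norm (y - L).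
    have := ler_norm (L - y); rewrite distrC; nra.
  have -> : y / L = 1 + (y / L - 1) by ring.
  apply: le_trans (le_ln1Dx _) _; first by lra.
  rewrite -subr_ge0.
  have -> : 2 * `|y - L| / L - (y / L - 1) = (2 * `|y - L| - (y - L)) / L.
    by field; rewrite gt_eqF.
  apply: divr_ge0; last exact: ltW.
  by have := ler_norm (y - L); have := normr_ge0 (y - L); lra.
have -> : y `^ a - L `^ a = L `^ a * (expR (a * (ln y - ln L)) - 1).
  rewrite /powR !gt_eqF// mulrBr mulr1 -expRD; congr (expR _ - _); ring.
rewrite normrM ger0_norm ?powR_ge0// (powR_split a L0).
have atau : `|a * (ln y - ln L)| <= 2 * `|a| * `|y - L| / L.
  rewrite normrM; have := normr_ge0 a; nra.
have p0 := powR_ge0 L (a - 1).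
apply: (@le_trans _ _ (L * L `^ (a - 1) *
  ((2 * `|a| * `|y - L| / L) * expR (2 * `|a| * `|y - L| / L)))).
  apply: ler_wpM2l; first by rewrite mulr_ge0// ltW.
  apply: le_trans (norm_expR_sub1_le _) _.
  by apply: ler_pM => //; rewrite ?expR_ge0// ler_expR.
rewrite le_eqVlt; apply/orP; left; apply/eqP.
by field; rewrite gt_eqF.
Qed.

(** The exponent [|b|] on [M] serves both signs of [b]: a negative power reverses the roles of [u]
    and [v]. *)
Lemma powR_comparable b u v M : 1 <= M -> 0 < u -> u <= M * v -> v <= M * u ->
  v `^ b <= M `^ `|b| * u `^ b.
Proof.
move=> M1 u0 uv vu; have M0 : 0 < M by lra.
have v0 : 0 < v by nra.
have [b0|b0] := leP 0 b.
  rewrite ger0_norm// -powRM ?(ltW M0) ?(ltW u0)//.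
  by apply: ge0_ler_powR; rewrite // nnegrE ?(ltW v0) ?mulr_ge0 ?(ltW M0) ?(ltW u0).
rewrite ltr0_norm//; set c := - b.
have -> : b = - c by rewrite opprK.
have c0 : 0 <= c by rewrite /c; lra.
rewrite !(powRN _ c) ler_pdivlMr ?powR_gt0// mulrC ler_pdivrMr ?powR_gt0//.
rewrite -powRM ?(ltW M0) ?(ltW v0)//.
by apply: ge0_ler_powR; rewrite // nnegrE ?(ltW v0) ?mulr_ge0 ?(ltW M0) ?(ltW u0) ?(ltW v0).
Qed.

End RealInequalities.

(** The logarithm lies below its tangent at 1/delta; the slope delta is free, so ln y is at most any
    small multiple of y plus a constant. *)
Lemma ln_le_linear {R : realType} (delta y : R) : 0 < delta -> 0 < y ->
  ln y <= delta * y - 1 - ln delta.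
Proof.
move=> d0 y0; have -> : ln y = ln (1 + (delta * y - 1)) - ln delta.
  have -> : 1 + (delta * y - 1) = delta * y by ring.
  by rewrite lnM ?posrE//; ring.
by rewrite lerB// le_ln1Dx//; have := mulr_gt0 d0 y0; lra.
Qed.

(** * The counting function *)

Section Counting.
Context {R : realType}.
Implicit Types (x y z t : R).
Variables (alpha beta A B : R) (q : nat -> R).
Hypotheses (q_ndecr : nondecreasing_seq q)
  (q_count : counting_hypothesis alpha beta A B q).

(** The counting hypothesis equates the count with a real number, so the sets are finite;
    monotonicity of [q] makes them initial segments. Sums over q_n <= x thereby become sums over
    ordinals. *)
Lemma exists_count : exists N : R -> nat, forall n x, (q n <= x) = (n < N x)%N.
Proof.
suff H x : exists m, forall n, (q n <= x) = (n < m)%N.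
  by have [N HN] := choice H; exists N => n x; exact: HN.
have [C qC] := q_count.
(* The hypothesis speaks only of arguments above 2 beta', hence the enlargement of [x]. *)
have [e [_ _ cnt]] := qC (Num.max x (2 * beta' beta)) ltac:(by rewrite le_max lexx orbT).
have fin : finite_set [set n | q n <= x].
  have : finite_set [set n | q n <= Num.max x (2 * beta' beta)].
    by move: cnt; rewrite /counting; case: asboolP.
  by apply: sub_finite_set => n /=; rewrite le_max => ->.
have ex : exists n, ~~ (q n <= x).
  apply/not_existsP => all; apply: infinite_nat.
  apply: sub_finite_set fin => n _ /=.
  by have /negP := all n; rewrite negbK.
exists (ex_minn ex) => n; case: ex_minnP => m qm mmin.
apply/idP/idP => [qn|nm].
  rewrite ltnNge; apply/negP => mn; move/negP: qm; apply.
  by apply: le_trans qn; exact: q_ndecr.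
by rewrite leNgt; apply/negP => xq; have := mmin n; rewrite -ltNge => /(_ xq); rewrite leqNgt nm.
Qed.

Variable N : R -> nat.
Hypothesis NP : forall n x, (q n <= x) = (n < N x)%N.

Lemma le_setE x : [set n | q n <= x] = `I_(N x).
Proof. by apply/seteqP; split=> n /=; rewrite NP. Qed.

Lemma counting_le x : counting [set n | q n <= x] = (N x)%:R%:E :> \bar R.
Proof.
rewrite le_setE /counting; case: asboolP => [_|]; last by case; exact: finite_II.
by rewrite (card_fset_set (card_eqxx _)).
Qed.

Lemma fsum_le (V : nmodType) (F : nat -> V) x :
  \sum_(n \in [set n | q n <= x]) F n = \sum_(i < N x) F i.
Proof. by rewrite le_setE fsbig_ord. Qed.

Lemma Hsum_count x : Hsum q x = \sum_(i < N x) (q i)^-1.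
Proof. exact: fsum_le. Qed.

Lemma is_smallest_Hsum V Z : is_smallest [set z | V <= Hsum q z] Z ->
  V <= Hsum q Z /\ forall z, z < Z -> Hsum q z < V.
Proof.
case=> VZ minZ; split=> // z zZ; rewrite ltNge; apply/negP => Vz.
by have := minZ z Vz; rewrite leNgt zZ.
Qed.

End Counting.

Lemma shift_bounds {R : realType} (l D y : R) : 1 <= D -> 1 + 2 * (`|l| + D) <= y ->
  [/\ 1 <= y, y / 2 <= y - l, y - l + D <= 2 * y & y <= 2 * (y - l + D)].
Proof.
move=> D1 y2; have l0 := normr_ge0 l; have := ler_norm l.
have : - l <= `|l| by rewrite -normrN ler_norm.
by split; lra.
Qed.

Section CountAsymptotics.
Context {R : realType}.
Variables (alpha beta A B : R) (q : nat -> R).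
Hypotheses (alpha_gt0 : 0 < alpha) (beta_gt0 : 0 < beta) (B_gt1 : 1 < B)
  (q_count : counting_hypothesis alpha beta A B q).
Variable N : R -> nat.
Hypothesis NP : forall n x, (q n <= x) = (n < N x)%N.
Notation a := (A - 1).
Notation lb := (ln beta).

(** This shift makes l = ln t - lb + D at least 2 |a - 1|, so that the derivative of t l^(a-1) is at
    least half of l^(a-1) even when a - 1 is negative ([primitive_error_ge]). *)
Let D := 1 + 2 * `|a - 1|.

Lemma beta'_ge4 : 4 <= beta' beta.
Proof. by have := beta_gt0; rewrite /beta' expr2; nra. Qed.

Lemma expR1_le4 : expR 1 <= 4 :> R.
Proof.
have -> : expR 1 = expR (- (1/2)) ^- 2 :> R.
  by rewrite -expRM_natl -expRN; congr expR; field.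
have h := expR_ge1Dx (- (1/2) : R).
rewrite -[4]invrK lef_pV2 ?posrE ?exprn_gt0 ?expR_gt0//; nra.
Qed.

(** The choice of beta' enters here: (2 + beta)^2 is at least 4 and at least 4 beta, and e <= 4. *)
Lemma ln_beta'_ge t : beta' beta <= t -> 1 <= ln t /\ 1 <= ln t - lb.
Proof.
move=> bt; have b0 := beta_gt0; have b4 := beta'_ge4; have e4 := expR1_le4.
split; first by rewrite -[1 in X in X <= _]expRK ler_ln ?posrE ?expR_gt0; lra.
rewrite -ln_div ?posrE//; last lra.
rewrite -[1 in X in X <= _]expRK ler_ln ?posrE ?expR_gt0 ?divr_gt0//; try lra.
rewrite ler_pdivlMr//; move: bt; rewrite /beta' expr2.
by have := expR_gt0 1 (R := R); nra.
Qed.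

(** With l = ln t - lb, the function t l^a is a primitive of the main integrand up to a l^(a-1).
    That term is smaller by one logarithm and joins the error. *)
Lemma primitive_main t : beta' beta <= t ->
  is_derive t 1 (fun t => t * (ln t - lb) `^ a)
    ((ln t - lb) `^ a + a * (ln t - lb) `^ (a - 1)).
Proof.
move=> bt; have [l1 l2] := ln_beta'_ge bt; have b4 := beta'_ge4.
apply: is_derive_val_eq.
  apply: (is_derive_mul (is_derive_var t)).
  apply: is_derive_powRf; first by lra.
  by apply: is_derive_subr; apply: is_derive1_ln; lra.
by rewrite /=; field; rewrite gt_eqF//; lra.
Qed.

Lemma primitive_error t : beta' beta <= t ->
  is_derive t 1 (fun t => t * (ln t - lb + D) `^ (a - 1))
    ((ln t - lb + D) `^ (a - 1) + (a - 1) * (ln t - lb + D) `^ (a - 1 - 1)).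
Proof.
move=> bt; have [l1 l2] := ln_beta'_ge bt; have b4 := beta'_ge4.
have D1 : 1 <= D by rewrite /D lerDl mulr_ge0.
apply: is_derive_val_eq.
  apply: (is_derive_mul (is_derive_var t)).
  apply: is_derive_powRf; first by lra.
  by apply: is_derive_addr; apply: is_derive_subr; apply: is_derive1_ln; lra.
by rewrite /=; field; rewrite gt_eqF//; lra.
Qed.

Lemma primitive_error_ge t : beta' beta <= t ->
  (ln t - lb + D) `^ (a - 1) <=
  2 * ((ln t - lb + D) `^ (a - 1) + (a - 1) * (ln t - lb + D) `^ (a - 1 - 1)).
Proof.
move=> bt; have [l1 l2] := ln_beta'_ge bt.
have D1 : 1 <= D by rewrite /D lerDl mulr_ge0.
have u0 : 0 < ln t - lb + D by lra.
rewrite (powR_split (a - 1) u0).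
have := powR_gt0 (a - 1 - 1) u0.
have : - `|a - 1| <= a - 1 by rewrite lerNl -normrN ler_norm.
move: (_ `^ _) => p; rewrite /D in u0 *; set m := `|a - 1| in u0 *.
nra.
Qed.

(** Since B > 1 and ln t >= 1, the relative error [e] is at most |C| / ln t. It therefore saves one
    logarithm, as does the correction term of [primitive_main], and one majorant serves both. *)
Lemma integrand_error C t e : beta' beta <= t -> `|e| <= C / (ln t `^ B) ->
  `|(ln t - lb) `^ a * (1 + e) -
    ((ln t - lb) `^ a + a * (ln t - lb) `^ (a - 1))| <=
  (`|C| * (1 + `|lb|) + `|a| + 1) * (1 + D) `^ `|a - 1| *
    (ln t - lb + D) `^ (a - 1).
Proof.
move=> bt eC; have [l1 l2] := ln_beta'_ge bt.
have D1 : 1 <= D by rewrite /D lerDl mulr_ge0.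
set l := ln t - lb in l2 *.
have -> : l `^ a * (1 + e) - (l `^ a + a * l `^ (a - 1)) =
  l `^ (a - 1) * (l * e - a) by rewrite (powR_split a (_ : 0 < l)); [ring|lra].
have lp : l `^ (a - 1) <= (1 + D) `^ `|a - 1| * (l + D) `^ (a - 1).
  by apply: powR_comparable; nra.
rewrite normrM ger0_norm ?powR_ge0// mulrC -mulrA; apply: ler_pM => //.
  exact: powR_ge0.
have lt0 : 0 < ln t by lra.
have e1 : `|e| <= `|C| / ln t.
  apply: le_trans eC _; apply: (@le_trans _ _ (`|C| / ln t `^ B)).
    by rewrite ler_wpM2r ?invr_ge0 ?powR_ge0// ler_norm.
  rewrite ler_wpM2l// lef_pV2 ?posrE ?powR_gt0// le1r_powR//.
  by have := B_gt1; lra.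
have le : l * `|e| <= `|C| * (1 + `|lb|).
  apply: (@le_trans _ _ (l * (`|C| / ln t))); first by rewrite ler_wpM2l//; lra.
  rewrite mulrCA ler_wpM2l// ler_pdivrMr// /l.
  by have := ler_norm (- lb); rewrite normrN; have := normr_ge0 lb; nra.
apply: le_trans (ler_normB _ _) _; rewrite normrM (ger0_norm (_ : 0 <= l)); lra.
Qed.

(** The closing arithmetic of [count_asymptotics]. There [I] is the integral, [FX] and [Fb] are the
    values of the main primitive at e^y and beta', [pX] and [pb] those of the error primitive, [E]
    is e^y, [ya] is y^a and [p] is y^(a-1). *)
Lemma combine_errors (I FX Fb K pX pb E ya K0 T2 p K1 : R) :
  0 <= K -> 0 <= K0 -> 0 <= pb ->
  `|I - (FX - Fb)| <= 2 * K * pX - 2 * K * pb -> pX <= E * (T2 * p) ->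
  `|FX - E * ya| <= E * (K1 * p) -> 0 <= Fb -> Fb <= K0 * pX ->
  `|I - E * ya| <= ((2 * K + K0) * T2 + K1) * p * E.
Proof.
move=> K_ge0 K0_ge0 pb0 h1 h2 h3 h4 h5.
have -> : I - E * ya = (I - (FX - Fb)) + ((FX - E * ya) - Fb) by ring.
apply: le_trans (ler_normD _ _) _.
have := ler_normB (FX - E * ya) Fb; rewrite (ger0_norm h4) => h6.
have KK0 : 0 <= 2 * K + K0 by lra.
have := ler_wpM2l KK0 h2; have := mulr_ge0 K_ge0 pb0.
have -> : ((2 * K + K0) * T2 + K1) * p * E =
  (2 * K + K0) * (E * (T2 * p)) + E * (K1 * p) by ring.
lra.
Qed.

Lemma count_asymptotics : exists C y0, 1 <= y0 /\ forall y, y0 <= y ->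
  `|(N (expR y))%:R * expR (- y) - alpha * y `^ a| <= C * y `^ (a - 1).
Proof.
have [C qC] := q_count; have b4 := beta'_ge4.
have D1 : 1 <= D by rewrite /D lerDl mulr_ge0.
have b0 := beta_gt0.
pose K := (`|C| * (1 + `|lb|) + `|a| + 1) * (1 + D) `^ `|a - 1|.
pose phi t := t * (ln t - lb + D) `^ (a - 1).
pose F t := t * (ln t - lb) `^ a.
(* The fixed endpoint value [F (beta' beta)] is thereby at most [K0 * phi (expR y)], [phi] being
   larger at the upper end of the interval. *)
pose K0 := F (beta' beta) / phi (beta' beta).
pose K1 := 2 * `|a| * `|lb| * expR (2 * `|a| * `|lb|).
have [lnb1 lnb2] := ln_beta'_ge (lexx _).
have phib0 : 0 < phi (beta' beta) by rewrite mulr_gt0 ?powR_gt0//; lra.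
have K0ge : 0 <= K0 by rewrite divr_ge0 ?(ltW phib0)// mulr_ge0 ?powR_ge0//; lra.
have Kgt0 : 0 < K.
  apply: mulr_gt0; last by apply: powR_gt0; lra.
  by rewrite ltr_wpDl// addr_ge0// mulr_ge0// addr_ge0.
exists (alpha * ((2 * K + K0) * 2 `^ `|a - 1| + K1)).
exists (1 + 2 * (`|lb| + D) + ln (2 * beta' beta)).
have nlb := normr_ge0 lb.
have ln2 : 0 <= ln (2 * beta' beta) by rewrite ln_ge0//; lra.
split=> [|y yge]; first by lra.
have y2 : 1 + 2 * (`|lb| + D) <= y by apply: le_trans yge; rewrite lerDl.
have [y1 yh yu yl] := shift_bounds D1 y2.
have X2 : 2 * beta' beta <= expR y.
  rewrite -[X in X <= _]lnK ?posrE ?ler_expR; lra.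
have Xb : beta' beta <= expR y by lra.
have [e [me eC cnt]] := qC _ X2.
have {}cnt : (N (expR y))%:R =
    alpha * \int[lebesgue_measure]_(t in `[beta' beta, expR y])
      ((ln t - lb) `^ a * (1 + e t)).
  apply: EFin_inj; apply: (etrans (esym (counting_le NP _))); apply: (etrans cnt).
  apply: (congr1 (fun z => (alpha * z)%:E)).
  apply: eq_Rintegral => t; rewrite inE/= in_itv/= => /andP[bt _].
  by rewrite ln_div ?posrE//; lra.
have eC' t : beta' beta <= t <= expR y -> `|e t| <= C / ln t `^ B.
  by move=> bty; apply: eC; rewrite ?inE/= ?in_itv/=.
have cla t b : beta' beta <= t -> {for t, continuous (fun t => (ln t - lb) `^ b)}.
  move=> bt; have [l1 l2] := ln_beta'_ge bt; apply: is_derive_continuous.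
  apply: is_derive_powRf; first by lra.
  by apply: is_derive_subr; apply: is_derive1_ln; lra.
have claD t b : beta' beta <= t -> {for t, continuous (fun t => (ln t - lb + D) `^ b)}.
  move=> bt; have [l1 l2] := ln_beta'_ge bt; apply: is_derive_continuous.
  apply: is_derive_powRf; first by lra.
  by apply: is_derive_addr; apply: is_derive_subr; apply: is_derive1_ln; lra.
have cF' t : beta' beta <= t -> {for t, continuous
    (fun t => (ln t - lb) `^ a + a * (ln t - lb) `^ (a - 1))}.
  by move=> bt; apply: continuousD; [exact: cla|apply: continuousM; [exact: cst_continuous|exact: cla]].
have intF : \int[lebesgue_measure]_(t in `[beta' beta, expR y])
    ((ln t - lb) `^ a + a * (ln t - lb) `^ (a - 1)) = F (expR y) - F (beta' beta).
  apply: int_FTC => // t /andP[bt _]; [exact: primitive_main|exact: cF'].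
have i1 : (@lebesgue_measure R).-integrable `[beta' beta, expR y]
    (EFin \o (fun t => (ln t - lb) `^ a * (1 + e t))).
  apply: (@continuous_mul_integrable_itv _ _ _ _ _ (1 + `|C|)).
  - by apply: cts_within => t /andP[bt _]; exact: cla.
  - by apply: measurable_funD => //; exact: measurable_cst.
  - move=> t bty; have [l1 l2] := ln_beta'_ge (andP bty).1.
    apply: le_trans (ler_normD _ _) _; rewrite normr1 lerD2l.
    apply: le_trans (eC' _ bty) _; apply: le_trans (ler_norm _) _.
    have lnt0 : 0 < ln t by exact: lt_le_trans l1.
    rewrite normrM ler_piMr// normfV ger0_norm ?powR_ge0// invf_le1 ?powR_gt0//.
    by rewrite -(powRr0 (ln t)) ler_powR//; exact: ltW (lt_trans ltr01 B_gt1).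
have i2 : (@lebesgue_measure R).-integrable `[beta' beta, expR y]
    (EFin \o (fun t => (ln t - lb) `^ a + a * (ln t - lb) `^ (a - 1))).
  by apply/continuous_integrable_itv/cts_within => t /andP[bt _]; exact: cF'.
have step1 : `|\int[lebesgue_measure]_(t in `[beta' beta, expR y])
      ((ln t - lb) `^ a * (1 + e t)) - (F (expR y) - F (beta' beta))| <=
    2 * K * phi (expR y) - 2 * K * phi (beta' beta).
  rewrite -intF -RintegralB//.
  pose G t := 2 * K * phi t.
  pose g t := 2 * K * ((ln t - lb + D) `^ (a - 1) +
    (a - 1) * (ln t - lb + D) `^ (a - 1 - 1)).
  apply: (@int_norm_le_FTC _ _ _ _ G g); first exact: Xb.
  - exact: integrable_subR.
  - by move=> t /andP[bt _]; apply: is_derive_scale; exact: primitive_error.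
  - move=> t /andP[bt _]; apply: continuousM; first exact: cst_continuous.
    by apply: continuousD; [exact: claD|apply: continuousM; [exact: cst_continuous|exact: claD]].
  - move=> t bty; have [bt _] := andP bty.
    apply: le_trans (integrand_error bt (eC' _ bty)) _; rewrite -/K /g.
    by rewrite (mulrC 2) -[leRHS]mulrA ler_wpM2l ?(ltW Kgt0)// primitive_error_ge.
have phiX : phi (beta' beta) <= phi (expR y).
  by have := le_trans (normr_ge0 _) step1; rewrite -mulrBr pmulr_rge0 ?subr_ge0// mulr_gt0.
have FK0 : F (beta' beta) <= K0 * phi (expR y).
  by rewrite -[X in X <= _](divfK (lt0r_neq0 phib0)) -/K0 ler_wpM2l.
have Fb0 : 0 <= F (beta' beta) by rewrite mulr_ge0 ?powR_ge0// (le_trans _ b4).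
have step2 : phi (expR y) <= expR y * (2 `^ `|a - 1| * y `^ (a - 1)).
  rewrite /phi ler_wpM2l ?expR_ge0// expRK.
  by apply: powR_comparable => //; [rewrite ler1n|exact: lt_le_trans y1].
have step3 : `|F (expR y) - expR y * y `^ a| <= expR y * (K1 * y `^ (a - 1)).
  rewrite /F expRK -mulrBr normrM ger0_norm ?expR_ge0// ler_wpM2l ?expR_ge0//.
  apply: le_trans (powR_lipschitz _ _ _) _; [exact: lt_le_trans y1| |].
    exact: yh.
  have -> : `|y - lb - y| = `|lb| by rewrite addrAC subrr add0r normrN.
  rewrite /K1 [leRHS]mulrAC ler_wpM2l//; first by rewrite mulr_ge0 ?powR_ge0 ?mulr_ge0.
  rewrite ler_expR ler_pdivrMr ?(lt_le_trans ltr01 y1)// ler_peMr//.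
have ey : expR y * expR (- y) = 1 by rewrite -expRD subrr expR0.
have ey0 := expR_gt0 (- y).
have -> : (N (expR y))%:R * expR (- y) - alpha * y `^ a =
  alpha * (((N (expR y))%:R / alpha - expR y * y `^ a) * expR (- y)).
  by rewrite -[alpha * _ in LHS]mulr1 -ey; field; rewrite gt_eqF.
rewrite normrM (gtr0_norm alpha_gt0) -mulrA ler_wpM2l ?(ltW alpha_gt0)//.
rewrite normrM (gtr0_norm ey0) -ler_pdivlMr// -expRN opprK.
rewrite cnt mulrC mulKf ?gt_eqF//.
exact: (combine_errors (ltW Kgt0) K0ge (ltW phib0) step1 step2 step3 Fb0 FK0).
Qed.

End CountAsymptotics.

(** * Cumulant generating functions and eta *)

(* All that is used of the law of Y(n): [g] is its cumulant generating function.  The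
   last two bounds come from the lower tail hypothesis (ii). *)
Record cgf_bounds {R : realType} (C : R) (g dg : R -> R) : Prop := CgfBounds {
  cgf0 : g 0 = 0;
  cgf_derive : forall u : R, is_derive u 1 g (dg u);
  cgf_cont : continuous dg;
  cgf_deriv01 : forall u : R, 0 <= u -> 0 <= dg u <= 1;
  cgf_deriv_le : forall u : R, 0 <= u -> dg u <= C * u;
  cgf_deriv_tail : forall x : R, 0 <= x -> 1 - dg (expR x) <= C / (1 + x) ^+ 2;
  cgf_tail : forall x : R, 0 <= x -> expR x - g (expR x) <= C * expR x / (1 + x) ^+ 2 }.

Lemma continuous_invf {R : realType} (f : R -> R) (u : R) : f u != 0 ->
  {for u, continuous f} -> {for u, continuous (fun y => (f y)^-1)}.
Proof. by move=> fu cf; exact: cvgV. Qed.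

Section Eta.
Context {R : realType}.
Variables (C : R) (g dg : R -> R).
Hypothesis gP : cgf_bounds C g dg.
Notation mu := (@lebesgue_measure R).

Let f u : R := if u < 1 then g u else g u - u.
Let eta : R := \int[mu]_(u in `]0, +oo[) (f u / u ^+ 2).

Lemma cgfC_ge0 : 0 <= C.
Proof.
have /andP[h1 _] := cgf_deriv01 gP ler01.
by apply: le_trans h1 _; rewrite -[C]mulr1 (cgf_deriv_le gP).
Qed.

Lemma cgf_continuous : continuous g.
Proof. by move=> u; apply: is_derive_continuous (cgf_derive gP u). Qed.

Lemma cgf_ge0_le u : 0 <= u -> [/\ 0 <= g u, g u <= u & g u <= C * u ^+ 2].
Proof.
rewrite le_eqVlt => /predU1P[<-|u0]; first by rewrite (cgf0 gP) lexx expr0n mulr0 lexx.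
have [c /[!in_itv]/= /andP[c0 cu]] := @MVT R g dg 0 u u0
  (fun x _ => cgf_derive gP x) (continuous_subspaceT cgf_continuous).
rewrite (cgf0 gP) !subr0 => ->.
have /andP[d0 d1] := cgf_deriv01 gP (ltW c0).
have dC := cgf_deriv_le gP (ltW c0); have C0 := cgfC_ge0.
split; [by rewrite mulr_ge0// ltW|by rewrite ler_piMl// ltW|].
rewrite expr2 mulrA ler_wpM2r ?(ltW u0)//; apply: le_trans dC _.
by rewrite ler_wpM2l// ltW.
Qed.

Lemma cgf_quot_le u : 0 < u -> `|g u / u| <= C * u.
Proof.
move=> u0; have [g0 _ g2] := cgf_ge0_le (ltW u0).
by rewrite ger0_norm ?divr_ge0 ?(ltW u0)// ler_pdivrMr// -mulrA -expr2.
Qed.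

Lemma cgf_f_small u : 0 < u < 1 -> `|f u / u ^+ 2| <= C.
Proof.
case/andP=> u0 u1; have [g0 _ g2] := cgf_ge0_le (ltW u0).
rewrite /f u1/= ger0_norm; last by rewrite divr_ge0// exprn_ge0// ltW.
by rewrite ler_pdivrMr// exprn_gt0.
Qed.

(** The tail bound at x = ln u. The majorant has the primitive - C / (1 + ln u), which gives
    convergence of eta at infinity with an explicit remainder. *)
Lemma cgf_f_large u : 1 <= u -> `|f u / u ^+ 2| <= C * (u^-1 * (1 + ln u) ^- 2).
Proof.
move=> u1; have u0 : 0 < u by lra.
have [g0 gu _] := cgf_ge0_le (ltW u0).
have l0 : 0 <= ln u by rewrite ln_ge0.
have := cgf_tail gP l0; rewrite lnK ?posrE// => ft.
rewrite /f ltNge u1/= normrM normfV (ger0_norm (_ : 0 <= u ^+ 2)) ?exprn_ge0 ?(ltW u0)//.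
rewrite ler0_norm ?subr_le0// opprB ler_pdivrMr ?exprn_gt0//.
apply: le_trans ft _; rewrite le_eqVlt; apply/orP; left; apply/eqP.
by field; rewrite !gt_eqF//; lra.
Qed.

Lemma is_derive_inv_ln (u : R) : 1 <= u ->
  is_derive u 1 (fun u : R => - (C * (1 + ln u)^-1)) (C * (u^-1 * (1 + ln u) ^- 2)).
Proof.
move=> u1; have u0 : 0 < u by lra.
have l0 : 0 <= ln u by rewrite ln_ge0.
have d1 : is_derive u 1 (fun u : R => 1 + ln u) u^-1.
  have -> : (fun u : R => 1 + ln u) = (fun u => ln u + 1).
    by apply/funext => t; rewrite addrC.
  by apply: is_derive_addr; exact: is_derive1_ln.
have d2 : is_derive u 1 (fun u : R => (1 + ln u)^-1) (- (1 + ln u) ^- 2 * u^-1).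
  apply: is_derive_val_eq.
    by apply: (is_deriveV _ d1); rewrite gt_eqF//; lra.
  by rewrite /GRing.scale/=.
have -> : (fun u : R => - (C * (1 + ln u)^-1)) = (fun u => - C * (1 + ln u)^-1).
  by apply/funext => t; rewrite mulNr.
apply: (is_derive_val_eq (is_derive_scale (- C) d2)).
by ring.
Qed.

Lemma measurable_f : measurable_fun setT f.
Proof.
have -> : f = (fun u => g u - \1_(`[1, +oo[) u * u).
  apply/funext => u; rewrite /f indicE mem_setE/= in_itv/= andbT leNgt.
  by case: (u < 1) => /=; rewrite ?mul0r ?subr0 ?mul1r.
apply: measurable_funB; first exact: continuous_measurable_fun cgf_continuous.
by apply: measurable_funM => //; exact: measurable_indic.
Qed.

Let F u := f u / u ^+ 2.

Lemma measurable_F : measurable_fun (`]0, +oo[%classic : set R) F.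
Proof.
apply: measurable_funM; first exact: measurable_funTS measurable_f.
apply: open_continuous_measurable_fun; first exact: interval_open.
move=> u; rewrite inE/= in_itv/= andbT => u0.
apply: (@continuous_invf _ (fun u : R => u ^+ 2)); last exact: exprn_continuous.
by rewrite expf_neq0// gt_eqF.
Qed.

Lemma integrable_F01 : mu.-integrable `]0, 1] (EFin \o F).
Proof.
apply: (@le_integrable _ _ _ mu _ _ _ (EFin \o cst C)) => //.
- apply/measurable_EFinP; apply: measurable_funS measurable_F => //.
  by move=> u /=; rewrite !in_itv/= => /andP[-> _].
- move=> u /=; rewrite in_itv/= lee_fin => /andP[u0].
  rewrite (ger0_norm cgfC_ge0) le_eqVlt => /predU1P[->|u1].
    by apply: le_trans (cgf_f_large (lexx _)) _; rewrite ln1 addr0 expr1n invr1 !mulr1.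
  by apply: cgf_f_small; rewrite u0.
- apply: (@integrableS _ _ _ mu `[0, 1]) => //.
    by move=> u /=; rewrite !in_itv/= => /andP[/ltW -> ->].
  exact: (@bounded_integrable_itv _ _ _ _ `|C|).
Qed.

Lemma cvg_inv_ln : - (C * (1 + ln u)^-1) @[u --> +oo] --> (0 : R).
Proof.
apply/cvgrPdist_le => e e0; near=> u; rewrite sub0r opprK.
have C0 := cgfC_ge0.
have eu : expR (C / e) <= u by near: u; apply: nbhs_pinfty_ge; rewrite num_real.
have u0 : 0 < u := lt_le_trans (expR_gt0 _) eu.
have Ce : C / e <= ln u.
  by rewrite -[X in X <= _]expRK ler_ln ?posrE ?expR_gt0.
have l0 : 0 <= ln u by apply: le_trans Ce; rewrite divr_ge0// ltW.
have l1 : 0 < 1 + ln u by lra.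
rewrite ger0_norm ?mulr_ge0 ?invr_ge0 ?(ltW l1)// ler_pdivrMr//.
by rewrite ler_pdivrMr// in Ce; nra.
Unshelve. all: by end_near. Qed.

Lemma continuous_D (u : R) : 1 <= u ->
  {for u, continuous (fun u : R => C * (u^-1 * (1 + ln u) ^- 2))}.
Proof.
  move=> u1; have l0 : 0 <= ln u by rewrite ln_ge0.
  apply: continuousM; first exact: cst_continuous.
  apply: continuousM; first by apply: inv_continuous; rewrite gt_eqF//; lra.
  apply: (@continuous_invf _ (fun u : R => (1 + ln u) ^+ 2)).
    by rewrite expf_neq0// gt_eqF//; lra.
  apply: (@continuous_comp _ _ _ (fun u : R => 1 + ln u) (fun v : R => v ^+ 2)).
    by apply: continuousD; [exact: cst_continuous|apply: continuous_ln; lra].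
  exact: exprn_continuous.
Qed.

Lemma D_ge0 (u : R) : 1 <= u -> 0 <= C * (u^-1 * (1 + ln u) ^- 2).
Proof.
move=> u1; have l0 := ln_ge0 u1; apply: mulr_ge0; first exact: cgfC_ge0.
by rewrite mulr_ge0 ?invr_ge0 ?exprn_ge0//; lra.
Qed.

Lemma measurable_D : measurable_fun (`[1, +oo[%classic : set R)
  (fun u : R => C * (u^-1 * (1 + ln u) ^- 2)).
Proof.
apply: subspace_continuous_measurable_fun => //.
apply: continuous_in_subspaceT => u; rewrite inE/= in_itv/= andbT.
exact: continuous_D.
Qed.

Lemma integral_inv_ln B : 1 <= B ->
  (\int[mu]_(u in `[B, +oo[) (C * (u^-1 * (1 + ln u) ^- 2))%:E = (C / (1 + ln B))%:E)%E.
Proof.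
move=> B1.
rewrite (@ge0_continuous_FTC2y _ _ (fun u : R => - (C * (1 + ln u)^-1)) _ 0).
- by rewrite -EFinB sub0r opprK.
- by move=> u Bu; apply: D_ge0; lra.
- apply: continuous_in_subspaceT => u; rewrite inE/= in_itv/= andbT => Bu.
  by apply: continuous_D; lra.
- exact: cvg_inv_ln.
- by move=> u Bu; have [] := @is_derive_inv_ln u ltac:(lra).
- apply/cvg_at_right_filter; apply: is_derive_continuous (is_derive_inv_ln B1).
- move=> u; rewrite in_itv/= andbT => Bu; rewrite derive1E.
  by have [_] := @is_derive_inv_ln u ltac:(lra).
Qed.

Lemma integrable_D : mu.-integrable `[1, +oo[
  (EFin \o (fun u : R => C * (u^-1 * (1 + ln u) ^- 2))).
Proof.
apply/integrableP; split; first by apply/measurable_EFinP; exact: measurable_D.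
under eq_integral => u.
  rewrite inE/= in_itv/= andbT => u1; rewrite ger0_norm.
    over.
  by rewrite D_ge0.
by rewrite integral_inv_ln// ltry.
Qed.

Lemma integrable_F1y : mu.-integrable `[1, +oo[ (EFin \o F).
Proof.
apply: (@le_integrable _ _ _ mu _ _ _
  (EFin \o (fun u : R => C * (u^-1 * (1 + ln u) ^- 2)))) => //.
- apply/measurable_EFinP; apply: measurable_funS measurable_F => //.
  by move=> u /=; rewrite !in_itv/= !andbT; exact: lt_le_trans.
- move=> u /=; rewrite in_itv/= andbT lee_fin => u1.
  by apply: le_trans (cgf_f_large u1) _; exact: ler_norm.
- exact: integrable_D.
Qed.

Lemma integrable_F : mu.-integrable `]0, +oo[ (EFin \o F).
Proof.
apply/integrableP; split; first by apply/measurable_EFinP; exact: measurable_F.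
have E : `]0, +oo[%classic = `]0, 1] `|` `]1, +oo[ :> set R.
  by rewrite -itv_bndbnd_setU// bnd_simp.
have mF : measurable_fun (`]0, +oo[%classic : set R) (fun u => `|(F u)%:E|)%E.
  apply: measurableT_comp => //; apply/measurable_EFinP; exact: measurable_F.
rewrite E ge0_integral_setU//=; last 2 first.
  by rewrite -E.
  apply/disj_setPS => u [/=]; rewrite !in_itv/= andbT => /andP[_ u1].
  by rewrite ltNge u1.
apply: lte_add_pinfty; first by have /integrableP[] := integrable_F01.
have : mu.-integrable `]1, +oo[ (EFin \o F).
  apply: integrableS integrable_F1y => //.
  by move=> u /=; rewrite !in_itv/= !andbT; exact: ltW.
by case/integrableP.
Qed.

Lemma eta_head b : 0 < b -> b < 1 -> `|\int[mu]_(u in `]0, b]) F u| <= C * b.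
Proof.
move=> b0 b1.
have iF : mu.-integrable `]0, b] (EFin \o F).
  apply: integrableS integrable_F => //.
  by move=> u /=; rewrite !in_itv/= andbT => /andP[].
apply: le_trans (le_normr_Rintegral _ iF) _ => //.
have ic : mu.-integrable `]0, b] (EFin \o cst C).
  apply: (@integrableS _ _ _ mu `[0, b]) => //.
    by move=> u /=; rewrite !in_itv/= => /andP[/ltW -> ->].
  exact: (@bounded_integrable_itv _ _ _ _ `|C|).
apply: (@le_trans _ _ (\int[mu]_(u in `]0, b]) C)).
  apply: le_Rintegral => //; first exact: integrable_normR.
  move=> u /=; rewrite in_itv/= => /andP[u0 ub].
  by apply: cgf_f_small; rewrite u0/=; lra.
rewrite Rintegral_cst//= lebesgue_measure_itv/= lte_fin b0 -EFinD/= subr0//.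
Qed.

Lemma eta_tail B : 1 <= B -> `|\int[mu]_(u in `]B, +oo[) F u| <= C / (1 + ln B).
Proof.
move=> B1.
have iF : mu.-integrable `]B, +oo[ (EFin \o F).
  apply: integrableS integrable_F => //.
  by move=> u /=; rewrite !in_itv/= !andbT => Bu; lra.
have iD : mu.-integrable `[B, +oo[
    (EFin \o (fun u : R => C * (u^-1 * (1 + ln u) ^- 2))).
  apply: integrableS integrable_D => //.
  by move=> u /=; rewrite !in_itv/= !andbT; exact: le_trans.
apply: le_trans (le_normr_Rintegral _ iF) _ => //.
have -> : C / (1 + ln B) =
    \int[mu]_(u in `[B, +oo[) (C * (u^-1 * (1 + ln u) ^- 2)).
  by rewrite /Rintegral integral_inv_ln.
rewrite -Rintegral_itv_obnd_cbnd; last first.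
  by apply: integrableS iD => // u /=; rewrite !in_itv/= !andbT; exact: ltW.
apply: le_Rintegral => //; first exact: integrable_normR.
  by apply: integrableS iD => // u /=; rewrite !in_itv/= !andbT; exact: ltW.
move=> u /=; rewrite in_itv/= andbT => Bu.
by apply: cgf_f_large; lra.
Qed.

(** From u = 1 on, [f] subtracts u; divided by u^2 this is 1/u, whose integral over [1, B] is ln
    B. *)
Lemma eta_middle b B : 0 < b -> b < 1 -> 1 <= B ->
  \int[mu]_(u in `]b, B]) F u = \int[mu]_(u in `[b, B]) (g u / u ^+ 2) - ln B.
Proof.
move=> b0 b1 B1.
have iF : mu.-integrable `[b, B] (EFin \o F).
  apply: integrableS integrable_F => //.
  by move=> u /=; rewrite !in_itv/= !andbT => /andP[/(lt_le_trans b0)].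
have ig : mu.-integrable `[b, B] (EFin \o (fun u => g u / u ^+ 2)).
  apply/continuous_integrable_itv/cts_within => u /andP[bu _].
  apply: continuousM; first exact: cgf_continuous.
  apply: (@continuous_invf _ (fun u : R => u ^+ 2)); last exact: exprn_continuous.
  by rewrite expf_neq0// gt_eqF//; lra.
rewrite Rintegral_itv_obnd_cbnd; last first.
  by apply: integrableS iF => // u /=; rewrite !in_itv/= => /andP[/ltW -> ->].
apply/eqP; rewrite eq_sym subr_eq addrC -subr_eq; apply/eqP.
rewrite -RintegralB//.
have <- : \int[mu]_(u in `[1, B]) u^-1 = ln B.
  rewrite -[ln B]subr0 -ln1; apply: int_FTC => // u /andP[u1 _].
    by apply: is_derive1_ln; lra.
  by apply: inv_continuous; rewrite gt_eqF//; lra.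
have -> : `[1, B]%classic = `[b, B] `&` `[1, +oo[ :> set R.
  apply/seteqP; split => u /=; rewrite !in_itv/= ?andbT.
    by move=> /andP[u1 uB]; split => //; apply/andP; split; lra.
  by case=> /andP[_ ->] ->.
rewrite Rintegral_mkcondr; apply: eq_Rintegral => u.
rewrite inE/= in_itv/= => /andP[bu _].
rewrite /patch mem_setE/= in_itv/= andbT /F /f ltNge.
case: (leP 1 u) => u1 /=; last by rewrite subrr.
by field; rewrite gt_eqF//; lra.
Qed.

Lemma eta_approx b B : 0 < b -> b < 1 -> 1 <= B ->
  `|eta - (\int[mu]_(u in `[b, B]) (g u / u ^+ 2) - ln B)| <= C * b + C / (1 + ln B).
Proof.
move=> b0 b1 B1; rewrite -eta_middle//.
have E1 := Rintegral_itvB integrable_F (_ : (BRight 0 <= BRight b)%O) (_ : (BRight b <= +oo)%O).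
have iF : mu.-integrable `]b, +oo[ (EFin \o F).
  apply: integrableS integrable_F => //.
  by move=> u /=; rewrite !in_itv/= !andbT; exact: lt_trans.
have E2 := Rintegral_itvB iF (_ : (BRight b <= BRight B)%O) (_ : (BRight B <= +oo)%O).
have -> : eta - \int[mu]_(u in `]b, B]) F u =
    \int[mu]_(u in `]0, b]) F u + \int[mu]_(u in `]B, +oo[) F u.
  rewrite -E2 ?bnd_simp//; last lra.
  by rewrite -E1 ?bnd_simp ?(ltW b0)// /eta addrA addrCA subrr addr0.
apply: le_trans (ler_normD _ _) _.
by apply: lerD; [exact: eta_head|exact: eta_tail].
Qed.

Lemma is_derive_expR_sub (s y : R) :
  is_derive y 1 (fun y => expR (s - y)) (- expR (s - y)).
Proof.
apply: (is_derive_val_eq (is_derive_expRf (is_derive_subl s (is_derive_var y)))).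
by rewrite mulrN1.
Qed.

Lemma is_derive_cgf_exp (s y : R) :
  is_derive y 1 (fun y => g (expR (s - y))) (- (dg (expR (s - y)) * expR (s - y))).
Proof.
apply: (is_derive_val_eq (is_derive_comp (is_derive_expR_sub s y) (cgf_derive gP _))).
by rewrite mulrN.
Qed.

Lemma continuous_expR_sub (s : R) : continuous (fun y : R => expR (s - y)).
Proof. by move=> y; apply: is_derive_continuous (is_derive_expR_sub s y). Qed.

Lemma continuous_deriv_exp (s : R) : continuous (fun y : R => dg (expR (s - y))).
Proof.
move=> y; apply: (@continuous_comp _ _ _ (fun y : R => expR (s - y)) dg).
  exact: continuous_expR_sub.
exact: (cgf_cont gP).
Qed.

Lemma substitution_exp (s X : R) : 0 < X ->
  \int[mu]_(u in `[expR (s - X), expR s]) (g u / u ^+ 2) =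
  \int[mu]_(y in `[0, X]) (g (expR (s - y)) / expR (s - y)).
Proof.
move=> X0; pose E (y : R) := expR (s - y).
have dE y : (derive1 E) y = - E y.
  by rewrite derive1E; have [] := is_derive_expR_sub s y.
have dEf : (derive1 E) = (fun y => - E y) by apply/funext.
have cdE : continuous (derive1 E).
  by rewrite dEf => y; apply: continuousN; exact: continuous_expR_sub.
have -> : expR s = E 0 by rewrite /E subr0.
rewrite -[expR (s - X)]/(E X) /Rintegral.
rewrite (@integration_by_substitution_decreasing _ E); last 1 first.
- apply: cts_within => u /andP[bu _].
  have u0 : 0 < u by exact: lt_le_trans (expR_gt0 _) bu.
  apply: continuousM; first exact: cgf_continuous.
  apply: (@continuous_invf _ (fun u : R => u ^+ 2)); last exact: exprn_continuous.
  by rewrite expf_neq0// gt_eqF.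
- congr fine; apply: eq_integral => y _; congr _%:E.
  rewrite dEf; change (g (E y) / E y ^+ 2 * - (- E y) = g (E y) / E y).
  rewrite opprK /E expr2.
  by field; rewrite gt_eqF ?expR_gt0.
- exact: ltW.
- by move=> x y _ _ xy; rewrite ltr_expR; lra.
- by move=> y _; exact: cdE.
- by apply: cvgP; apply: cvg_at_right_filter; exact: cdE.
- by apply: cvgP; apply: cvg_at_left_filter; exact: cdE.
- split.
  + by move=> y _; have [] := is_derive_expR_sub s y.
  + by apply: cvg_at_right_filter; exact: continuous_expR_sub.
  + by apply: cvg_at_left_filter; exact: continuous_expR_sub.
Qed.

(** The origin of 1 + eta. Integrate the derivative of - g(e^(s-y)) / e^(s-y): the boundary term at
    y = 0 is g(e^s) / e^s, close to 1 by the tail bound, and the one at y = X is O(e^(s-X)). What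
    remains becomes, under u = e^(s-y), the integral of g(u) / u^2 over [e^(s-X), e^s], which is eta
    + s up to the two truncations. *)
Lemma int_deriv_exp (s X : R) : 0 <= s -> s < X ->
  `|\int[mu]_(y in `[0, X]) dg (expR (s - y)) - (1 + eta + s)| <=
  2 * C * (expR (s - X) + (1 + s)^-1).
Proof.
move=> s0 sX; have X0 : 0 < X by lra.
pose F0 (y : R) := - (g (expR (s - y)) / expR (s - y)).
have cdiv : continuous (fun y : R => g (expR (s - y)) / expR (s - y)).
  move=> y; apply: (@continuousM _ _ (fun y : R => g (expR (s - y)))
      (fun y : R => (expR (s - y))^-1)).
    by apply: is_derive_continuous (is_derive_cgf_exp s y).
  apply: continuous_invf; last exact: continuous_expR_sub.
  by rewrite gt_eqF ?expR_gt0.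
have : \int[mu]_(y in `[0, X]) (dg (expR (s - y)) - g (expR (s - y)) / expR (s - y))
    = F0 X - F0 0.
  apply: int_FTC => [|y _|y _]; first exact: ltW.
    have -> : F0 = (fun y => - 1 * (g (expR (s - y)) * expR (- (s - y)))).
      by apply/funext => z; rewrite /F0 expRN mulN1r.
    have dN : is_derive y 1 (fun t : R => - (s - t)) 1.
      have -> : (fun t : R => - (s - t)) = (fun t : R => t - s).
        by apply/funext => t; rewrite opprB.
      exact: is_derive_subr (is_derive_var y).
    apply: (is_derive_val_eq (is_derive_scale (- 1)
      (is_derive_mul (is_derive_cgf_exp s y) (is_derive_expRf dN)))).
    by rewrite /= expRN; field; rewrite gt_eqF ?expR_gt0.
  by apply: continuousB; [exact: continuous_deriv_exp|exact: cdiv].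
rewrite RintegralB//; last 2 first.
- by apply/continuous_integrable_itv/continuous_subspaceT; exact: continuous_deriv_exp.
- by apply/continuous_integrable_itv/continuous_subspaceT.
rewrite -substitution_exp// => E1.
have b1 : expR (s - X) < 1 by rewrite -expR0 ltr_expR; lra.
have B1 : 1 <= expR s by rewrite -expR0 ler_expR.
have := eta_approx (expR_gt0 _) b1 B1; rewrite expRK.
have := cgf_quot_le (expR_gt0 (s - X)).
have := cgf_tail gP s0.
have [_ gs _] := cgf_ge0_le (expR_ge0 s).
move: E1; rewrite /F0 subr0.
set I1 := Rintegral _ _ _; set I2 := Rintegral _ _ _.
move=> E1 h1 h2 h3.
have h4 : 0 <= 1 - g (expR s) / expR s <= C / (1 + s) ^+ 2.
  have -> : 1 - g (expR s) / expR s = (expR s - g (expR s)) / expR s.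
    by field; rewrite gt_eqF ?expR_gt0.
  rewrite divr_ge0 ?expR_ge0 ?subr_ge0//= ler_pdivrMr ?expR_gt0//.
  by apply: le_trans h1 _; rewrite mulrAC.
have h5 : C / (1 + s) ^+ 2 <= C / (1 + s).
  rewrite ler_wpM2l ?cgfC_ge0// lef_pV2 ?posrE ?exprn_gt0//; try lra.
  by rewrite expr2; nra.
have C0 := cgfC_ge0.
move: h2 h3 h4 h5 E1; rewrite mulrDr.
set q1 := g (expR (s - X)) / expR (s - X); set q2 := g (expR s) / expR s.
set r1 := expR (s - X); rewrite -mulrA -[2 * C / _]mulrA.
move: (C * r1) (C / (1 + s)) (C / _) => v1 v2 v3.
rewrite !ler_norml => /andP[? ?] /andP[? ?] /andP[? ?] ? ?.
by apply/andP; split; lra.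
Qed.

End Eta.

Lemma sum_ord_le {R : realType} (F : nat -> R) m n : (m <= n)%N ->
  (forall i, 0 <= F i) -> \sum_(i < m) F i <= \sum_(i < n) F i.
Proof.
move=> mn F0; rewrite (big_ord_widen _ F mn) [leRHS](bigID (fun i : 'I_n => (i < m)%N))/=.
by rewrite lerDl sumr_ge0.
Qed.

Lemma mulr_expR_le {R : realType} (y : R) : 0 <= y -> y * expR y <= expR (2 * y).
Proof.
move=> y0; have -> : 2 * y = y + y by ring.
by rewrite expRD ler_wpM2r ?expR_ge0//; have := expR_ge1Dx y; lra.
Qed.

(** * Sums of a cumulant generating function over the sequence *)

Section PowerDensity.
Context {R : realType}.
Variables (alpha a C0 y0 : R) (n : R -> R).
Hypotheses (alpha_gt0 : 0 < alpha) (C0_ge0 : 0 <= C0) (y0_ge1 : 1 <= y0).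
Hypothesis nP : forall y, y0 <= y -> `|n y - alpha * y `^ a| <= C0 * y `^ (a - 1).

Lemma density_le y : y0 <= y -> n y <= (alpha + C0) * y `^ a.
Proof.
move=> yy; have h1 := y0_ge1; have := nP yy; rewrite ler_norml => /andP[_ h].
have : y `^ (a - 1) <= y `^ a by rewrite ler_powR; lra.
have := C0_ge0; rewrite mulrDl; nra.
Qed.

(** The linear loss 1 + (L - y) is affordable: against a weight of size (1 + L - y)^-2 it integrates
    to ln L. *)
Lemma density_mid L y : 2 * y0 <= L -> L / 2 <= y -> y <= L ->
  `|n y - alpha * L `^ a| <=
  (C0 * 2 `^ `|a - 1| + alpha * (2 * `|a| * expR `|a|)) * L `^ (a - 1) * (1 + (L - y)).
Proof.
move=> yL Ly yL'; have h1 := y0_ge1; have L0 : 0 < L by lra.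
have p0 := powR_gt0 (a - 1) L0.
have e1 : `|n y - alpha * y `^ a| <= C0 * (2 `^ `|a - 1| * L `^ (a - 1)).
  apply: le_trans (nP _) _; first lra.
  by rewrite ler_wpM2l ?C0_ge0//; apply: powR_comparable; lra.
have e2 : `|y `^ a - L `^ a| <= 2 * `|a| * expR `|a| * L `^ (a - 1) * (L - y).
  apply: le_trans (powR_lipschitz a L0 Ly) _.
  have -> : `|y - L| = L - y by rewrite ler0_norm; lra.
  have -> : 2 * `|a| * expR `|a| * L `^ (a - 1) * (L - y) =
    2 * `|a| * (L - y) * L `^ (a - 1) * expR `|a| by ring.
  have yL0 : 0 <= L - y by lra.
  rewrite ler_wpM2l ?ler_expR//; first by rewrite !mulr_ge0 ?(ltW p0).
  by rewrite ler_pdivrMr//; have := normr_ge0 a; nra.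
have -> : n y - alpha * L `^ a = (n y - alpha * y `^ a) + alpha * (y `^ a - L `^ a).
  by ring.
apply: le_trans (ler_normD _ _) _; rewrite normrM (gtr0_norm alpha_gt0).
have E0 : 0 <= 2 * `|a| * expR `|a| by rewrite !mulr_ge0 ?expR_ge0.
have T0 := powR_ge0 2 `|a - 1|.
move: e1 e2 E0 T0 p0 C0_ge0 alpha_gt0.
move: `|n y - _| `|_ `^ a - _| (2 * `|a| * _) (2 `^ _) (L `^ (a - 1)) => u v E T p.
move=> e1 e2 E0 T0 p0 c0 al0.
have := ler_wpM2l (ltW al0) e2.
have : 0 <= C0 * (T * p) by rewrite !mulr_ge0// ltW.
have : 0 <= alpha * E * p by rewrite !mulr_ge0// ltW.
nra.
Qed.

(** To the right of L the weight decays like e^(L-y), so half of this decay may be spent on the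
    growth of powers of y. The conditions on [L] make every exponent that arises at most (y -
    L)/2. *)
Lemma density_right L y : y0 <= L -> 8 * `|a| <= L -> 2 * `|a - 1| <= L -> L <= y ->
  `|n y - alpha * L `^ a| <=
  (C0 + alpha * (8 * `|a|)) * L `^ (a - 1) * expR ((y - L) / 2).
Proof.
move=> yL La La1 Ly; have h1 := y0_ge1; have L0 : 0 < L by lra.
have p0 := powR_gt0 (a - 1) L0.
have yL0 : 0 <= y - L by lra.
have e1 : `|n y - alpha * y `^ a| <= C0 * (L `^ (a - 1) * expR ((y - L) / 2)).
  apply: le_trans (nP _) _; first lra.
  rewrite ler_wpM2l ?C0_ge0//.
  have -> : y `^ (a - 1) = L `^ (a - 1) * expR ((a - 1) * ln (y / L)).
    by rewrite /powR !gt_eqF; try lra; rewrite -expRD ln_div ?posrE; try lra; congr expR; ring.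
  rewrite ler_wpM2l ?(ltW p0)// ler_expR.
  have lnyL : 0 <= ln (y / L) <= (y - L) / L.
    apply/andP; split; first by rewrite ln_ge0// ler_pdivlMr ?mul1r.
    have -> : y / L = 1 + (y - L) / L by field; rewrite gt_eqF.
    by apply: le_ln1Dx; have := divr_ge0 yL0 (ltW L0); lra.
  apply: (@le_trans _ _ (`|a - 1| * ((y - L) / L))).
    have := ler_norm (a - 1); case/andP: lnyL; have := normr_ge0 (a - 1); nra.
  by rewrite mulrA ler_pdivrMr//; nra.
have e2 : `|y `^ a - L `^ a| <= 8 * `|a| * L `^ (a - 1) * expR ((y - L) / 2).
  apply: le_trans (powR_lipschitz a L0 _) _; first lra.
  rewrite (ger0_norm yL0).
  have -> : 8 * `|a| * L `^ (a - 1) * expR ((y - L) / 2) =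
    2 * `|a| * L `^ (a - 1) * (4 * expR ((y - L) / 2)) by ring.
  have -> : 2 * `|a| * (y - L) * L `^ (a - 1) * expR (2 * `|a| * (y - L) / L) =
    2 * `|a| * L `^ (a - 1) * ((y - L) * expR (2 * `|a| * (y - L) / L)) by ring.
  rewrite ler_wpM2l ?mulr_ge0 ?(ltW p0)//.
  have := mulr_expR_le (_ : 0 <= (y - L) / 4); rewrite divr_ge0// => /(_ isT).
  have -> : 2 * ((y - L) / 4) = (y - L) / 2 by field.
  move=> h; apply: (@le_trans _ _ (4 * ((y - L) / 4 * expR ((y - L) / 4)))); last first.
    by rewrite ler_wpM2l.
  have -> : 4 * ((y - L) / 4 * expR ((y - L) / 4)) = (y - L) * expR ((y - L) / 4) by field.
  by rewrite ler_wpM2l// ler_expR ler_pdivrMr//; nra.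
have -> : n y - alpha * L `^ a = (n y - alpha * y `^ a) + alpha * (y `^ a - L `^ a).
  by ring.
apply: le_trans (ler_normD _ _) _; rewrite normrM (gtr0_norm alpha_gt0).
have := ler_wpM2l (ltW alpha_gt0) e2; move: e1; rewrite !mulrDl !mulrA; lra.
Qed.

End PowerDensity.

(* In the application [x i = ln (q i)], so [k y] counts the terms up to [e^y], [n] is the
   counting function divided by [e^y], and [h y = H(e^y)]. *)
Section WeightedIntegrals.
Context {R : realType}.
Variables (x : nat -> R) (k : R -> nat).
Hypothesis x_ge0 : forall n, 0 <= x n.
Hypothesis kP : forall n y, (x n <= y) = (n < k y)%N.
Notation mu := (@lebesgue_measure R).
Notation int a b f := (\int[mu]_(y in `[a, b]) (f y)).

Let n (y : R) : R := (k y)%:R * expR (- y).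
Let h (y : R) : R := \sum_(i < k y) expR (- x i).

Lemma continuous_expRN : continuous (fun y : R => expR (- y)).
Proof.
move=> y.
exact: is_derive_continuous (is_derive_expRf (is_derive_neg (is_derive_var y))).
Qed.

Lemma int_cst a b (c : R) : a <= b -> int a b (fun=> c) = c * (b - a).
Proof.
move=> ab; rewrite mulrBr; apply: (@int_FTC _ (fun y => c * y)) => // y _.
  by apply: (is_derive_val_eq (is_derive_scale c (is_derive_var y))); rewrite mulr1.
exact: cst_continuous.
Qed.

Lemma n_ge0 y : 0 <= n y.
Proof. by rewrite mulr_ge0 ?expR_ge0. Qed.

Lemma h_ndecr y z : y <= z -> h y <= h z.
Proof.
move=> yz; apply: (@sum_ord_le _ (fun i => expR (- x i))); first exact: k_ndecr yz.
by move=> i; exact: expR_ge0.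
Qed.

Lemma h_abel X : 0 <= X -> h X = n X + int 0 X n.
Proof.
move=> X0.
have -> : h X = (k X)%:R * expR (- X) - int 0 X (fun y => (k y)%:R * - expR (- y)).
  apply: (@abel_summation _ x k x_ge0 kP X (fun y => expR (- y)) (fun y => - expR (- y))) => //.
    move=> y _; apply: (is_derive_val_eq (is_derive_expRf (is_derive_neg (is_derive_var y)))).
    by rewrite mulrN1.
  by move=> y _; apply: continuousN; exact: continuous_expRN.
congr (_ + _).
have i0 : mu.-integrable `[0, X] (EFin \o n).
  by apply: (k_integrable kP); apply: continuous_subspaceT; exact: continuous_expRN.
rewrite -[RHS]opprK -[X in _ = - X]mulN1r -RintegralZl//.
by congr (- _); apply: eq_Rintegral => y _; rewrite mulrN mulN1r.
Qed.

Lemma nw_integrable X w : continuous w ->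
  mu.-integrable `[0, X] (EFin \o (fun y => n y * w y)).
Proof.
move=> cw; have -> : (fun y => n y * w y) = (fun y => (k y)%:R * (expR (- y) * w y)).
  by apply/funext => y; rewrite mulrA.
apply: (k_integrable kP); apply: continuous_subspaceT => y.
by apply: (@continuousM _ _ (fun y : R => expR (- y)) w); [exact: continuous_expRN|exact: cw].
Qed.

Lemma n_integrable X : mu.-integrable `[0, X] (EFin \o n).
Proof.
by apply: (k_integrable kP); apply: continuous_subspaceT; exact: continuous_expRN.
Qed.

Lemma w_integrable a b w : continuous w -> mu.-integrable `[a, b] (EFin \o w).
Proof. by move=> cw; apply/continuous_integrable_itv/continuous_subspaceT. Qed.

Lemma int_diff a b M w : 0 <= a -> continuous w ->
  int a b (fun y => n y * w y) - M * int a b w = int a b (fun y => (n y - M) * w y).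
Proof.
move=> a0 cw.
have i1 : mu.-integrable `[a, b] (EFin \o (fun y => n y * w y)).
  exact: integrable_itvS (nw_integrable _ cw).
rewrite -RintegralZl ?w_integrable// -RintegralB//.
  by apply: eq_Rintegral => y _; rewrite mulrBl.
by apply: integrable_scaleR => //; exact: w_integrable.
Qed.

Lemma diff_integrable a b M w : 0 <= a -> continuous w ->
  mu.-integrable `[a, b] (EFin \o (fun y => (n y - M) * w y)).
Proof.
move=> a0 cw; under [X in integrable _ _ X]eq_fun do rewrite /= mulrBl.
apply: integrable_subR => //; first exact: integrable_itvS (nw_integrable _ cw).
by apply: integrable_scaleR => //; exact: w_integrable.
Qed.

(** No pointwise asymptotics of [n] are available near 0. By [h_abel], however, its integral is at
    most h(L), and on [0, L/2] the weight is at most 4 C1 / L^2. *)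
Lemma left_integral_head (L C1 M H : R) (w : R -> R) : 2 <= L -> 0 <= M -> 0 <= C1 ->
  continuous w ->
  (forall y, 0 <= y <= L -> 0 <= w y <= C1 / (1 + (L - y)) ^+ 2) ->
  h L <= H ->
  `|int 0 (L / 2) (fun y => (n y - M) * w y)| <= 4 * C1 * H / L ^+ 2 + 2 * C1 * M / L.
Proof.
move=> L2 M0 C10 cw wP hH; have L0 : 0 < L by lra.
have wb y : 0 <= y <= L / 2 -> 0 <= w y <= 4 * C1 / L ^+ 2.
  move=> /andP[y0 yL]; have /andP[-> h1]/= := wP y ltac:(lra).
  apply: le_trans h1 _.
  have -> : 4 * C1 / L ^+ 2 = C1 / (L / 2) ^+ 2 by field; rewrite gt_eqF.
  rewrite ler_wpM2l// lef_pV2 ?posrE ?exprn_gt0//; try lra.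
  by rewrite lerXn2r ?nnegrE//; lra.
set c := 4 * C1 / L ^+ 2 in wb.
have c0 : 0 <= c by rewrite divr_ge0 ?exprn_ge0 ?mulr_ge0 ?(ltW L0).
apply: (@le_trans _ _ (int 0 (L / 2) (fun y => c * n y + c * M))).
  apply: int_norm_le.
  - exact: diff_integrable.
  - apply: integrable_addR => //; first by apply: integrable_scaleR => //; exact: n_integrable.
    by apply: w_integrable => y; exact: cst_continuous.
  - move=> y yL; have /andP[w0 wc] := wb y yL; have n0 := n_ge0 y.
    rewrite normrM (ger0_norm w0).
    have : `|n y - M| <= n y + M.
      by rewrite (le_trans (ler_normB _ _))// (ger0_norm n0) (ger0_norm M0).
    rewrite -mulrDr mulrC => H1; apply: ler_pM => //.
rewrite RintegralD//; last 2 first.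
- by apply: integrable_scaleR => //; exact: n_integrable.
- by apply: w_integrable => y; exact: cst_continuous.
rewrite RintegralZl//; last exact: n_integrable.
rewrite int_cst ?divr_ge0 ?(ltW L0)// subr0.
have := h_abel (_ : 0 <= L / 2); rewrite divr_ge0 ?(ltW L0)// => /(_ isT).
have := @h_ndecr (L / 2) L ltac:(lra); have := n_ge0 (L / 2).
move=> nL hL hE; apply: lerD.
  have -> : 4 * C1 * H / L ^+ 2 = c * H by rewrite /c; ring.
  by rewrite ler_wpM2l//; lra.
rewrite le_eqVlt; apply/orP; left; apply/eqP; rewrite /c.
by field; rewrite gt_eqF.
Qed.

(** The product of the two bounds is K2 C1 / (1 + L - y), whose integral is at most K2 C1 ln L: with
    L = log Z this is the loglog Z of the final error. *)
Lemma left_integral_body (L C1 M K2 : R) (w : R -> R) : 2 <= L -> 0 <= C1 -> 0 <= K2 ->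
  continuous w ->
  (forall y, 0 <= y <= L -> 0 <= w y <= C1 / (1 + (L - y)) ^+ 2) ->
  (forall y, L / 2 <= y <= L -> `|n y - M| <= K2 * (1 + (L - y))) ->
  `|int (L / 2) L (fun y => (n y - M) * w y)| <= K2 * C1 * ln L.
Proof.
move=> L2 C10 K20 cw wP nM.
pose G y := - (K2 * C1) * ln (1 + (L - y)).
pose g y := K2 * C1 * (1 + (L - y))^-1.
have dL (y : R) : is_derive y 1 (fun y => 1 + (L - y)) (-1).
  apply: (is_derive_val_eq (is_derive_add (is_derive_const y 1) (is_derive_subl L (is_derive_var y)))).
  by rewrite add0r.
apply: (@le_trans _ _ (G L - G (L / 2))).
  apply: (@int_norm_le_FTC _ _ _ _ G g); first lra.
  - by apply: diff_integrable => //; lra.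
  - move=> y /andP[y1 y2]; rewrite /G.
    have u0 : 0 < 1 + (L - y) by lra.
    apply: (is_derive_val_eq (is_derive_scale (- (K2 * C1))
      (is_derive_lnf (f := fun y => 1 + (L - y)) u0 (dL y)))).
    by rewrite /g; ring.
  - move=> y /andP[y1 y2]; apply: continuousM; first exact: cst_continuous.
    apply: continuous_invf; first by rewrite gt_eqF//; lra.
    exact: is_derive_continuous (dL y).
  - move=> y yL; have /andP[w0 w1] := wP y ltac:(lra); have n1 := nM y yL.
    rewrite normrM (ger0_norm w0) /g.
    have u0 : 0 < 1 + (L - y) by lra.
    have -> : K2 * C1 * (1 + (L - y))^-1 =
        (K2 * (1 + (L - y))) * (C1 / (1 + (L - y)) ^+ 2) by field; rewrite gt_eqF.
    by apply: ler_pM.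
rewrite /G subrr addr0 ln1 mulr0 sub0r mulNr opprK ler_wpM2l ?mulr_ge0//.
by rewrite ler_ln ?posrE; lra.
Qed.

Lemma left_integral (L C1 M K2 H : R) (w : R -> R) : 2 <= L -> 0 <= M -> 0 <= C1 ->
  0 <= K2 -> continuous w ->
  (forall y, 0 <= y <= L -> 0 <= w y <= C1 / (1 + (L - y)) ^+ 2) ->
  (forall y, L / 2 <= y <= L -> `|n y - M| <= K2 * (1 + (L - y))) -> h L <= H ->
  `|int 0 L (fun y => n y * w y) - M * int 0 L w| <=
  4 * C1 * H / L ^+ 2 + 2 * C1 * M / L + K2 * C1 * ln L.
Proof.
move=> L2 M0 C10 K20 cw wP nM hH.
rewrite int_diff// (@int_chasles _ 0 (L / 2)); try lra; last exact: diff_integrable.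
apply: le_trans (ler_normD _ _) _; apply: lerD.
  exact: left_integral_head.
exact: left_integral_body.
Qed.

(** Growth e^((y-L)/2) times decay e^(L-y) leaves e^((L-y)/2), whose integral over the half-line
    from L is 2. *)
Lemma right_integral (L X C2 M K3 : R) (w : R -> R) : 0 <= L -> L <= X -> 0 <= K3 ->
  0 <= C2 -> continuous w ->
  (forall y, L <= y <= X -> 0 <= w y <= C2 * expR (L - y)) ->
  (forall y, L <= y <= X -> `|n y - M| <= K3 * expR ((y - L) / 2)) ->
  `|int L X (fun y => n y * w y) - M * int L X w| <= 2 * (K3 * C2).
Proof.
move=> L0 LX K30 C20 cw wP nM; rewrite int_diff//.
pose G y := (-2 * (K3 * C2)) * expR ((L - y) / 2).
pose g y := K3 * C2 * expR ((L - y) / 2).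
have dL (y : R) : is_derive y 1 (fun y => (L - y) / 2) (- 2^-1).
  apply: (is_derive_val_eq (is_derive_mul (is_derive_subl L (is_derive_var y)) (is_derive_const y (2^-1)))).
  by rewrite mulr0 add0r mulN1r.
apply: (@le_trans _ _ (G X - G L)).
  apply: (@int_norm_le_FTC _ _ _ _ G g) => //.
  - exact: diff_integrable.
  - move=> y _; apply: (is_derive_val_eq (is_derive_scale _ (is_derive_expRf (dL y)))).
    by rewrite /g; field.
  - move=> y _; apply: continuousM; first exact: cst_continuous.
    exact: is_derive_continuous (is_derive_expRf (dL y)).
  - move=> y yL; have /andP[w0 w1] := wP y yL; have n1 := nM y yL.
    rewrite normrM (ger0_norm w0) /g.
    have -> : K3 * C2 * expR ((L - y) / 2) =
        (K3 * expR ((y - L) / 2)) * (C2 * expR (L - y)).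
      have -> : expR (L - y) = expR ((L - y) / 2) * expR ((L - y) / 2).
        by rewrite -expRD; congr expR; field.
      have -> : (y - L) / 2 = - ((L - y) / 2) by field.
      by rewrite expRN; field; rewrite gt_eqF ?expR_gt0.
    by apply: ler_pM.
rewrite /G subrr mul0r expR0 mulr1.
have := expR_gt0 ((L - X) / 2); have := mulr_ge0 K30 C20.
move: (K3 * C2) (expR _) => u v u0 v0; nra.
Qed.

End WeightedIntegrals.

Lemma expR_shift_le {R : realType} (L X : R) : 0 < L -> L <= X -> L + ln X <= X ->
  expR (L - X) <= L^-1.
Proof.
move=> L0 LX LXl; have X0 : 0 < X by lra.
apply: (@le_trans _ _ X^-1); last by rewrite lef_pV2.
by rewrite -[X in _ <= X^-1]lnK ?posrE// -expRN ler_expR; lra.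
Qed.

(** For X <= 2 L the powers of X and L are comparable, and e^(L-X) <= 1/L supplies the missing
    factor. For X > 2 L the power of X costs at most e^((X-L)/2), and the remaining e^(-L/2) is
    below 2/L. *)
Lemma powR_expR_shift_le {R : realType} (a L X : R) : 0 < L -> 2 * `|a| <= L ->
  L <= X -> L + ln X <= X ->
  X `^ a * expR (L - X) <= (2 `^ `|a| + 2) * L `^ (a - 1).
Proof.
move=> L0 La LX LXl; have X0 : 0 < X by lra.
have e0 := expR_shift_le L0 LX LXl.
have p0 := powR_gt0 (a - 1) L0; have T0 := powR_ge0 2 `|a|.
have [X2|X2] := leP X (2 * L).
  have : X `^ a <= 2 `^ `|a| * L `^ a by apply: powR_comparable; lra.
  move=> Xa; apply: (@le_trans _ _ (2 `^ `|a| * L `^ a * L^-1)).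
    by apply: ler_pM; rewrite ?powR_ge0 ?expR_ge0.
  rewrite (powR_split a L0); have -> : 2 `^ `|a| * (L * L `^ (a - 1)) / L =
    2 `^ `|a| * L `^ (a - 1) by field; rewrite gt_eqF.
  by rewrite mulrDl; lra.
have Xa : X `^ a <= L `^ a * expR ((X - L) / 2).
  have -> : X `^ a = L `^ a * expR (a * ln (X / L)).
    by rewrite /powR !gt_eqF// -expRD ln_div ?posrE//; congr expR; ring.
  rewrite ler_wpM2l ?powR_ge0// ler_expR.
  have XL0 : 0 <= (X - L) / L by rewrite divr_ge0; lra.
  have l1 : ln (X / L) <= (X - L) / L.
    have -> : X / L = 1 + (X - L) / L by field; rewrite gt_eqF.
    by apply: le_ln1Dx; lra.
  have l0 : 0 <= ln (X / L) by rewrite ln_ge0// ler_pdivlMr ?mul1r.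
  apply: (@le_trans _ _ (`|a| * ((X - L) / L))).
    by have := ler_norm a; have := normr_ge0 a; nra.
  by rewrite mulrA ler_pdivrMr//; nra.
apply: (@le_trans _ _ (L `^ a * (2 / L))).
  apply: (@le_trans _ _ (L `^ a * expR ((X - L) / 2) * expR (L - X))).
    by rewrite ler_wpM2r ?expR_ge0.
  rewrite -mulrA -expRD ler_wpM2l ?powR_ge0//.
  apply: (@le_trans _ _ (expR (- (L / 2)))); first by rewrite ler_expR; lra.
  rewrite expRN -[2 / L]invrK lef_pV2 ?posrE ?invr_gt0 ?divr_gt0 ?expR_gt0//.
  by rewrite invf_div; have := expR_ge1Dx (L / 2); lra.
rewrite (powR_split a L0); have -> : L * L `^ (a - 1) * (2 / L) = 2 * L `^ (a - 1).
  by field; rewrite gt_eqF.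
by rewrite mulrDl; nra.
Qed.

Section WeightBounds.
Context {R : realType}.
Variables (C Lam : R) (g dg : R -> R).
Hypotheses (Lam_ge0 : 0 <= Lam) (gP : cgf_bounds C g dg).

(** With s = L + lam - y: if s >= 0 the tail bound on the derivative applies and 1 + L - y <= (1 +
    Lam)(1 + s). If s < 0, then L - y < Lam and the trivial bound 1 is enough, whence the summand 1
    in C + 1. *)
Lemma weight_left (L lam y : R) : `|lam| <= Lam -> 0 <= y <= L ->
  0 <= 1 - dg (expR (L + lam - y)) <=
    ((C + 1) * (1 + Lam) ^+ 2) / (1 + (L - y)) ^+ 2.
Proof.
rewrite ler_norml => /andP[l1 l2] /andP[y0 yL].
have C0 := cgfC_ge0 gP; have Lam0 := Lam_ge0.
have /andP[d0 d1] := cgf_deriv01 gP (expR_ge0 (L + lam - y)).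
apply/andP; split; first by lra.
have u0 : 0 < (1 + (L - y)) ^+ 2 by rewrite exprn_gt0//; lra.
rewrite ler_pdivlMr//.
have [s0|s0] := leP 0 (L + lam - y).
  have := cgf_deriv_tail gP s0; set s := L + lam - y in s0 *.
  have v0 : 0 < (1 + s) ^+ 2 by rewrite exprn_gt0//; lra.
  rewrite ler_pdivlMr// => h.
  have h1 : (1 + (L - y)) ^+ 2 <= (1 + Lam) ^+ 2 * (1 + s) ^+ 2.
    rewrite -exprMn; apply: lerXn2r; rewrite ?nnegrE; [lra|apply: mulr_ge0; lra|].
    by rewrite /s in s0 *; nra.
  have d : 0 <= 1 - dg (expR s) by lra.
  apply: (@le_trans _ _ ((1 - dg (expR s)) * ((1 + Lam) ^+ 2 * (1 + s) ^+ 2))).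
    by rewrite ler_wpM2l.
  have T0 : 0 <= (1 + Lam) ^+ 2 by rewrite exprn_ge0//; lra.
  by rewrite mulrCA; apply: le_trans (ler_wpM2l T0 h) _; rewrite mulrDl mul1r mulrC lerDl.
have h1 : (1 + (L - y)) ^+ 2 <= (1 + Lam) ^+ 2.
  by apply: lerXn2r; rewrite ?nnegrE; lra.
have : 0 <= (1 + Lam) ^+ 2 by rewrite exprn_ge0//; lra.
nra.
Qed.

Lemma weight_right (L lam y : R) : `|lam| <= Lam ->
  0 <= dg (expR (L + lam - y)) <= C * expR Lam * expR (L - y).
Proof.
rewrite ler_norml => /andP[l1 l2].
have C0 := cgfC_ge0 gP.
have /andP[-> _] /= := cgf_deriv01 gP (expR_ge0 (L + lam - y)).
apply: le_trans (cgf_deriv_le gP (expR_ge0 _)) _.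
by rewrite -mulrA -expRD ler_wpM2l// ler_expR; lra.
Qed.

End WeightBounds.

Definition eta_of {R : realType} (g : R -> R) : R :=
  \int[lebesgue_measure]_(u in `]0, +oo[)
    ((if u < 1 then g u else g u - u) / u ^+ 2).

(** The sign of [c] need not be given: it is forced by 0 <= |z| <= c p. *)
Lemma norm_le_mul_mono {R : realType} (z c p q : R) : 0 < p -> p <= q ->
  `|z| <= c * p -> `|z| <= c * q.
Proof.
move=> p0 pq H; apply: (le_trans H); rewrite ler_wpM2l//.
by rewrite -(pmulr_lge0 _ p0); exact: le_trans (normr_ge0 _) H.
Qed.

Section SumIdentity.
Context {R : realType}.
Variables (x : nat -> R) (k : R -> nat).
Hypothesis x_ge0 : forall n, 0 <= x n.
Hypothesis kP : forall n y, (x n <= y) = (n < k y)%N.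
Variables (C : R) (g dg : R -> R).
Hypothesis gP : cgf_bounds C g dg.
Notation mu := (@lebesgue_measure R).
Notation int a b f := (\int[mu]_(y in `[a, b]) (f y)).

Let n (y : R) : R := (k y)%:R * expR (- y).
Let h (y : R) : R := \sum_(i < k y) expR (- x i).
Let w (s y : R) : R := dg (expR (s - y)).

Lemma sum_abel (s X : R) : 0 <= X ->
  \sum_(i < k X) g (expR (s - x i)) =
  (k X)%:R * g (expR (s - X)) + expR s * int 0 X (fun y => n y * w s y).
Proof.
move=> X0.
have -> : \sum_(i < k X) g (expR (s - x i)) = (k X)%:R * g (expR (s - X)) -
    int 0 X (fun y => (k y)%:R * - (dg (expR (s - y)) * expR (s - y))).
  apply: (@abel_summation _ x k x_ge0 kP X (fun y => g (expR (s - y)))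
    (fun y => - (dg (expR (s - y)) * expR (s - y)))) => //.
    by move=> y _; exact: (is_derive_cgf_exp gP).
  move=> y _; apply: continuousN; apply: continuousM.
    exact: (continuous_deriv_exp gP).
  exact: continuous_expR_sub.
congr (_ + _).
have i0 : mu.-integrable `[0, X] (EFin \o (fun y => n y * w s y)).
  by apply: (nw_integrable kP); exact: (continuous_deriv_exp gP).
rewrite -[RHS]opprK -[X in _ = - X]mulN1r mulrA -RintegralZl//.
congr (- _); apply: eq_Rintegral => y _.
by rewrite /n /w expRB expRN; field; rewrite gt_eqF ?expR_gt0.
Qed.

(* Subtracting [s H(Z)] leaves two integrals localised near [L = log Z], where the density
   [n] is almost constant. *)
Lemma sum_sub_h (s L X : R) : 0 <= L -> L <= X ->
  \sum_(i < k X) g (expR (s - x i)) - expR s * h L =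
  (k X)%:R * g (expR (s - X)) +
  expR s * (int L X (fun y => n y * w s y) -
            int 0 L (fun y => n y * (1 - w s y)) - n L).
Proof.
move=> L0 LX; have X0 : 0 <= X by lra.
have cw : continuous (w s) by exact: (continuous_deriv_exp gP).
have i0 : mu.-integrable `[0, X] (EFin \o (fun y => n y * w s y)).
  exact: (nw_integrable kP).
rewrite sum_abel// (int_chasles L0 LX i0).
rewrite /h (h_abel x_ge0 kP L0) -/n.
have -> : int 0 L (fun y => n y * (1 - w s y)) =
    int 0 L n - int 0 L (fun y => n y * w s y).
  rewrite -RintegralB//; last 2 first.
  - exact: (n_integrable kP).
  - exact: (nw_integrable kP).
  by apply: eq_Rintegral => y _; rewrite mulrBr mulr1.
by rewrite -/(n L); ring.
Qed.

(** The difference of the two integrals is the integral of [w s] over [0, X] minus L, so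
    [int_deriv_exp] applies. *)
Lemma int_weights (s L X : R) : 0 <= L -> L <= X -> 0 <= s -> s < X ->
  `|int L X (w s) - int 0 L (fun y => 1 - w s y) - (1 + eta_of g + s - L)| <=
  2 * C * (expR (s - X) + (1 + s)^-1).
Proof.
move=> L0 LX s0 sX.
have cw : continuous (w s) by exact: (continuous_deriv_exp gP).
have iw a b : mu.-integrable `[a, b] (EFin \o w s) by exact: w_integrable.
have := int_deriv_exp gP s0 sX.
rewrite (int_chasles L0 LX (iw _ _)) -/(eta_of g).
rewrite RintegralB//; last first.
  by apply: w_integrable => y; exact: cst_continuous.
rewrite int_cst// mul1r subr0 -/(w s).
congr (`|_| <= _); ring.
Qed.

End SumIdentity.

Section CgfSum.
Context {R : realType}.
Variables (alpha a C0 y0 Ch : R) (x : nat -> R) (k : R -> nat).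
Hypotheses (alpha_gt0 : 0 < alpha) (C0_ge0 : 0 <= C0) (y0_ge1 : 1 <= y0).
Hypothesis x_ge0 : forall n, 0 <= x n.
Hypothesis kP : forall n y, (x n <= y) = (n < k y)%N.
Notation mu := (@lebesgue_measure R).
Notation int a b f := (\int[mu]_(y in `[a, b]) (f y)).
Let n (y : R) : R := (k y)%:R * expR (- y).
Let h (y : R) : R := \sum_(i < k y) expR (- x i).
Hypothesis nP : forall y, y0 <= y -> `|n y - alpha * y `^ a| <= C0 * y `^ (a - 1).
Hypothesis hP : forall y, y0 <= y -> h y <= Ch * (y ^+ 2 * (y `^ (a - 1) * ln y)).

Variables (C Lam : R).
Hypothesis (Lam_ge0 : 0 <= Lam).

(** [C1] and [C2] bound the left and right weights, [K2] and [K3] the density on [L/2, L] and beyond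
    L; [K4] belongs to the boundary term at X, [K5] to the integrals of the weights, and [L0] is the
    threshold for all of them. *)
Let C1 := (C + 1) * (1 + Lam) ^+ 2.
Let C2 := C * expR Lam.
Let K2 := C0 * 2 `^ `|a - 1| + alpha * (2 * `|a| * expR `|a|).
Let K3 := C0 + alpha * (8 * `|a|).
Let K4 := (alpha + C0) * (C * expR Lam ^+ 2) * (2 `^ `|a| + 2).
Let K5 := 2 * C * (expR Lam + 2).
Let L0 := 2 * y0 + 8 * `|a| + 2 * `|a - 1| + 4 + expR (Lam + 1) + 2 * Lam.

Variables (g dg : R -> R) (L X lam : R).
Hypotheses (gP : cgf_bounds C g dg) (LL0 : L0 <= L) (LX : L + ln X <= X)
  (L_le_X : L <= X) (lam_le : `|lam| <= Lam).

Lemma L0_bounds : [/\ 2 * y0 <= L, 8 * `|a| <= L, 2 * `|a - 1| <= L, 4 <= L &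
  expR (Lam + 1) <= L /\ 2 * Lam <= L].
Proof.
have := LL0; rewrite /L0 => h1; have := y0_ge1; have := normr_ge0 a.
have := normr_ge0 (a - 1); have := Lam_ge0; have := expR_gt0 (Lam + 1).
by split; lra.
Qed.

Lemma left_estimate :
  `|int 0 L (fun y => n y * (1 - dg (expR (L + lam - y)))) -
    alpha * L `^ a * int 0 L (fun y => 1 - dg (expR (L + lam - y)))| <=
  (4 * C1 * Ch + 2 * C1 * alpha + K2 * C1) * (L `^ (a - 1) * ln L).
Proof.
have [h1 h2 h3 h4 [h5 h6]] := L0_bounds; have c0 := cgfC_ge0 gP.
have y1 := y0_ge1; have Lp : 0 < L by lra.
have C10 : 0 <= C1 by rewrite mulr_ge0 ?exprn_ge0//; have := Lam_ge0; lra.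
have T0 := powR_ge0 2 `|a - 1|.
have K20 : 0 <= K2.
  by rewrite addr_ge0// mulr_ge0 ?C0_ge0 ?(ltW alpha_gt0)// !mulr_ge0 ?expR_ge0.
have lnL : 1 <= ln L.
  rewrite -[1 in X in X <= _]expRK ler_ln ?posrE ?expR_gt0//.
  by apply: le_trans h5; rewrite ler_expR; have := Lam_ge0; lra.
have cw : continuous (fun y : R => 1 - dg (expR (L + lam - y))).
  by move=> y; apply: continuousB; [exact: cst_continuous|exact: (continuous_deriv_exp gP)].
have M0 : 0 <= alpha * L `^ a by rewrite mulr_ge0 ?powR_ge0// ltW.
have mid y : L / 2 <= y <= L ->
    `|n y - alpha * L `^ a| <= (K2 * L `^ (a - 1)) * (1 + (L - y)).
  move=> /andP[? ?]; exact: (density_mid alpha_gt0 C0_ge0 y0_ge1 nP).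
have p0 := powR_ge0 L (a - 1).
have hL : h L <= Ch * (L ^+ 2 * (L `^ (a - 1) * ln L)) by apply: hP; lra.
have := @left_integral _ _ _ x_ge0 kP L C1 (alpha * L `^ a) (K2 * L `^ (a - 1)) _ _
  (_ : 2 <= L) M0 C10 (mulr_ge0 K20 p0) cw
  (fun y yL => weight_left Lam_ge0 gP lam_le yL) mid hL.
move=> /(_ ltac:(lra)) H; apply: le_trans H _.
rewrite (powR_split a Lp).
have -> : 4 * C1 * (Ch * (L ^+ 2 * (L `^ (a - 1) * ln L))) / L ^+ 2 =
  4 * C1 * Ch * (L `^ (a - 1) * ln L) by field; rewrite gt_eqF.
have -> : 2 * C1 * (alpha * (L * L `^ (a - 1))) / L = 2 * C1 * alpha * L `^ (a - 1).
  by field; rewrite gt_eqF.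
have -> : K2 * L `^ (a - 1) * C1 * ln L = K2 * C1 * (L `^ (a - 1) * ln L) by ring.
rewrite [leRHS]mulrDl lerD2r [leRHS]mulrDl lerD2l ler_wpM2l//.
  by rewrite mulr_ge0 ?(ltW alpha_gt0)// mulr_ge0.
by rewrite ler_peMr.
Qed.

Lemma right_estimate :
  `|int L X (fun y => n y * dg (expR (L + lam - y))) -
    alpha * L `^ a * int L X (fun y => dg (expR (L + lam - y)))| <=
  2 * K3 * C2 * L `^ (a - 1).
Proof.
have [h1 h2 h3 h4 [h5 h6]] := L0_bounds; have c0 := cgfC_ge0 gP.
have y1 := y0_ge1; have Lp : 0 < L by lra.
have p0 := powR_ge0 L (a - 1).
have K30 : 0 <= K3 by rewrite addr_ge0// mulr_ge0 ?(ltW alpha_gt0)// mulr_ge0.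
have C20 : 0 <= C2 by rewrite mulr_ge0 ?expR_ge0.
have y0L : y0 <= L by lra.
have far y : L <= y <= X ->
    `|n y - alpha * L `^ a| <= (K3 * L `^ (a - 1)) * expR ((y - L) / 2).
  move=> /andP[Ly _]; apply: (density_right alpha_gt0 C0_ge0 y0_ge1 nP) => //.
have := @right_integral _ _ _ kP L X C2 (alpha * L `^ a) (K3 * L `^ (a - 1)) _
  (ltW Lp) L_le_X (mulr_ge0 K30 p0) C20 (continuous_deriv_exp gP (s := L + lam))
  (fun y yL => weight_right gP L y lam_le) far.
by move=> H; apply: le_trans H _; rewrite le_eqVlt; apply/orP; left; apply/eqP; ring.
Qed.

(** The effect of the cutoff at Q. The bound g(u) <= C u^2 leaves about e^L X^a e^(L-X), and L + ln
    X <= X, that is Z <= Q / log Q, brings this down to e^L L^(a-1). *)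
Lemma boundary_estimate :
  `|(k X)%:R * g (expR (L + lam - X))| <= K4 * (expR L * L `^ (a - 1)).
Proof.
have [h1 h2 h3 h4 [h5 h6]] := L0_bounds; have c0 := cgfC_ge0 gP.
have y1 := y0_ge1; have Lp : 0 < L by lra.
have [g0 _ g2] := cgf_ge0_le gP (expR_ge0 (L + lam - X)).
rewrite ger0_norm ?mulr_ge0//.
have -> : (k X)%:R * g (expR (L + lam - X)) = n X * (expR X * g (expR (L + lam - X))).
  by rewrite /n mulrA -(mulrA (k X)%:R) -expRD addNr expR0 mulr1.
have nX := density_le C0_ge0 y0_ge1 nP (_ : y0 <= X).
have {}nX : n X <= (alpha + C0) * X `^ a by apply: nX; have := L_le_X; lra.
have eX : expR X * g (expR (L + lam - X)) <=
    C * expR Lam ^+ 2 * (expR L * expR (L - X)).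
  apply: (@le_trans _ _ (expR X * (C * expR (L + lam - X) ^+ 2))).
    by rewrite ler_wpM2l ?expR_ge0.
  rewrite -!expRM_natl.
  have -> : expR X * (C * expR (2 * (L + lam - X))) =
      C * (expR (2 * lam) * (expR L * expR (L - X))).
    rewrite mulrCA -!expRD; congr (_ * expR _); ring.
  rewrite -mulrA ler_wpM2l// ler_wpM2r ?mulr_ge0 ?expR_ge0// ler_expR.
  by have := lam_le; rewrite ler_norml => /andP[_ ?]; lra.
have A0 : 0 <= alpha + C0 by have := alpha_gt0; have := C0_ge0; lra.
have tp := powR_expR_shift_le Lp (_ : 2 * `|a| <= L) L_le_X LX.
have {}tp : X `^ a * expR (L - X) <= (2 `^ `|a| + 2) * L `^ (a - 1).
  by apply: tp; have := normr_ge0 a; lra.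
apply: (@le_trans _ _ ((alpha + C0) * X `^ a * (C * expR Lam ^+ 2 * (expR L * expR (L - X))))).
  apply: ler_pM => //; first by rewrite mulr_ge0 ?expR_ge0.
  by rewrite mulr_ge0 ?expR_ge0.
have -> : (alpha + C0) * X `^ a * (C * expR Lam ^+ 2 * (expR L * expR (L - X))) =
  (alpha + C0) * (C * expR Lam ^+ 2) * expR L * (X `^ a * expR (L - X)) by ring.
have -> : K4 * (expR L * L `^ (a - 1)) =
  (alpha + C0) * (C * expR Lam ^+ 2) * expR L * ((2 `^ `|a| + 2) * L `^ (a - 1)).
  by rewrite /K4; ring.
by rewrite ler_wpM2l// !mulr_ge0 ?expR_ge0// exprn_ge0 ?expR_ge0.
Qed.

Lemma weights_estimate :
  `|int L X (fun y => dg (expR (L + lam - y))) -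
    int 0 L (fun y => 1 - dg (expR (L + lam - y))) - (1 + eta_of g + lam)| <= K5 / L.
Proof.
have [h1 h2 h3 h4 [h5 h6]] := L0_bounds; have c0 := cgfC_ge0 gP.
have Lp : 0 < L by lra.
have := lam_le; rewrite ler_norml => /andP[l1 l2].
have lnX : Lam + 1 <= ln X.
  rewrite -[X in X <= _]expRK ler_ln ?posrE ?expR_gt0//; first exact: le_trans L_le_X.
  exact: lt_le_trans L_le_X.
have s0 : 0 <= L + lam by lra.
have sX : L + lam < X by have := LX; lra.
have := int_weights gP (ltW Lp) L_le_X s0 sX.
have -> : 1 + eta_of g + (L + lam) - L = 1 + eta_of g + lam by ring.
move=> H; apply: le_trans H _; rewrite -mulrA /K5 -mulrA -[leRHS]mulrA.
rewrite ler_wpM2l// ler_wpM2l//.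
rewrite [leRHS]mulrDl; apply: lerD.
  have -> : L + lam - X = lam + (L - X) by ring.
  rewrite expRD; apply: ler_pM; rewrite ?expR_ge0 ?ler_expR//.
  exact: expR_shift_le.
by rewrite -[2 / L]invrK lef_pV2 ?posrE ?invr_gt0 ?divr_gt0// ?invf_div; lra.
Qed.

Lemma cgf_sum_estimate :
  `|\sum_(i < k X) g (expR (L + lam - x i)) - expR (L + lam) * h L -
    alpha * expR (L + lam) * L `^ a * (lam + eta_of g)| <=
  (K4 + expR Lam * (C0 + (4 * C1 * Ch + 2 * C1 * alpha + K2 * C1) + 2 * K3 * C2 +
    alpha * K5)) * (expR L * (L `^ (a - 1) * ln L)).
Proof.
have [h1 h2 h3 h4 [h5 h6]] := L0_bounds; have Lp : 0 < L by lra.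
have p0 := powR_gt0 (a - 1) Lp.
have lnL : 1 <= ln L.
  rewrite -[1 in X in X <= _]expRK ler_ln ?posrE ?expR_gt0//.
  by apply: le_trans h5; rewrite ler_expR; have := Lam_ge0; lra.
have pl : L `^ (a - 1) <= L `^ (a - 1) * ln L by rewrite ler_peMr// ltW.
have nL : `|n L - alpha * L `^ a| <= C0 * L `^ (a - 1).
  by apply: nP; have := y0_ge1; lra.
rewrite (sum_sub_h x_ge0 kP gP _ (ltW Lp) L_le_X).
have e1 := left_estimate; have e2 := right_estimate; have e3 := boundary_estimate.
have e4 := weights_estimate.
move: e1 e2 e3 e4 nL; rewrite -/(n L).
set A1 := Rintegral _ _ _; set J1 := Rintegral _ _ _; set A2 := Rintegral _ _ _.
set J2 := Rintegral _ _ _; set M := alpha * L `^ a; set Kx := (k X)%:R * _.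
move=> e1 e2 e3 e4 nL.
(* Everything is centred at the density [M] at L. The term - n(L) is close to - M and cancels the 1
   of 1 + eta + lam. *)
have -> : Kx + expR (L + lam) * (A2 - A1 - n L) -
    alpha * expR (L + lam) * L `^ a * (lam + eta_of g) =
  Kx + expR (L + lam) * (- (n L - M) + (A2 - M * J2) - (A1 - M * J1) +
    M * (J2 - J1 - (1 + eta_of g + lam))) by rewrite /M; ring.
apply: le_trans (ler_normD _ _) _.
rewrite [X in _ + X <= _]normrM (ger0_norm (expR_ge0 _)).
rewrite [leRHS]mulrDl; apply: lerD.
  by apply: (norm_le_mul_mono _ _ e3); rewrite ?mulr_gt0 ?expR_gt0// ler_wpM2l ?expR_ge0.
have e5 : `|M * (J2 - J1 - (1 + eta_of g + lam))| <= alpha * K5 * L `^ (a - 1).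
  rewrite normrM ger0_norm; last by rewrite mulr_ge0 ?powR_ge0// ltW.
  apply: le_trans (ler_wpM2l _ e4) _; first by rewrite mulr_ge0 ?powR_ge0// ltW.
  rewrite /M (powR_split a Lp) le_eqVlt; apply/orP; left; apply/eqP.
  by field; rewrite gt_eqF.
have e6 : `|- (n L - M) + (A2 - M * J2) - (A1 - M * J1) +
    M * (J2 - J1 - (1 + eta_of g + lam))| <=
  (C0 + (4 * C1 * Ch + 2 * C1 * alpha + K2 * C1) + 2 * K3 * C2 + alpha * K5) *
    (L `^ (a - 1) * ln L).
  have nL' := norm_le_mul_mono p0 pl nL; have e2' := norm_le_mul_mono p0 pl e2.
  have e5' := norm_le_mul_mono p0 pl e5.
  apply: le_trans (ler_normD _ _) _; rewrite [leRHS]mulrDl; apply: lerD => //.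
  apply: le_trans (ler_normB _ _) _; apply: le_trans (lerD (ler_normD _ _) (lexx _)) _.
  by rewrite normrN -addrA [leRHS]mulrDl [X in _ <= X + _]mulrDl -addrA; apply: lerD;
     rewrite // addrC; apply: lerD.
set K := (C0 + _ + _ + _) in e6 *.
set q := L `^ (a - 1) * ln L in e6 *.
rewrite expRD; have lamL : expR lam <= expR Lam.
  by rewrite ler_expR; have := lam_le; rewrite ler_norml => /andP[].
have -> : expR Lam * K * (expR L * q) = expR L * expR Lam * (K * q) by ring.
by apply: ler_pM; rewrite ?mulr_ge0 ?expR_ge0// ler_wpM2l ?expR_ge0.
Qed.

End CgfSum.

Lemma expR_taylor2 {R : realType} (z : R) :
  0 <= expR z - 1 - z <= z ^+ 2 * expR `|z|.
Proof.
have h1 : expR z - 1 <= z * expR z.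
  have := expR_ge1Dx (- z); rewrite expRN => h.
  have e0 := expR_gt0 z.
  have : (1 - z) * expR z <= 1 by rewrite -ler_pdivlMr// mul1r.
  lra.
have h2 := expR_ge1Dx z; have e0 := expR_gt0 z.
rewrite expr2; apply/andP; split; first by lra.
have [z0|z0] := leP 0 z.
  rewrite ger0_norm//; nra.
rewrite ltr0_norm//; have : 1 <= expR (- z) by rewrite -expR0 ler_expR; lra.
nra.
Qed.

(** Allows differentiation under the expectation: Taylor's bound for the exponential, uniform in the
    bounded variable, is integrated once. *)
Lemma is_derive_quadratic {R : realType} (F : R -> R) (u D K : R) :
  (forall h, `|h| <= 1 -> `|F (u + h) - F u - h * D| <= K * h ^+ 2) ->
  is_derive u 1 F D.
Proof.
move=> H.
have lim : (fun h : R => h^-1 *: (F (h *: (1 : R) + u) - F u)) @ 0^' --> D.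
  apply/cvgrPdist_le => e e0; near=> h.
  have h0 : h != 0 by near: h; exact: nbhs_dnbhs_neq.
  have hs : `|h| <= Num.min 1 (e / (`|K| + 1)).
    near: h; apply: dnbhs0_le.
    by rewrite lt_min ltr01 divr_gt0// ltr_wpDl.
  move: hs; rewrite le_min => /andP[h1 he].
  have Hh := H h h1; rewrite (addrC u) in Hh; rewrite /GRing.scale/= mulr1.
  have -> : D - h^-1 * (F (h + u) - F u) = - (h^-1 * (F (h + u) - F u - h * D)).
    by field.
  rewrite normrN normrM normfV ler_pdivrMl ?normr_gt0//.
  apply: (le_trans Hh); rewrite -(real_normK (num_real h)) expr2.
  have hp : 0 < `|h| by rewrite normr_gt0.
  have K1 : 0 < `|K| + 1 by rewrite ltr_wpDl.
  move: he; rewrite ler_pdivlMr// => he.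
  have := ler_norm K => KK; rewrite mulrCA ler_wpM2l//; nra.
by split; [exact: cvgP lim|exact: cvg_lim lim].
Unshelve. all: by end_near. Qed.

(** * Moment generating functions of bounded variables *)

Section BoundedExpectation.
Context d (T : measurableType d) {R : realType} (P : probability T R).
Implicit Types f g : T -> R.
Notation E f := (\int[P]_w (f w)).

Lemma bounded_integrable f M : measurable_fun setT f -> (forall w, `|f w| <= M) ->
  P.-integrable setT (EFin \o f).
Proof.
move=> mf fM; apply: (@le_integrable _ _ _ P _ _ _ (EFin \o cst M)) => //.
- exact/measurable_EFinP.
- by move=> w _ /=; rewrite lee_fin (le_trans (fM w))// ler_norm.
- exact: finite_measure_integrable_cst.
Qed.

Lemma E_le f g : P.-integrable setT (EFin \o f) -> P.-integrable setT (EFin \o g) ->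
  (forall w, f w <= g w) -> E f <= E g.
Proof. by move=> fi gi fg; exact: le_Rintegral. Qed.

Lemma E_cst (c : R) : E (fun=> c) = c.
Proof. by rewrite Rintegral_cst//= probability_setT mulr1. Qed.

Lemma E_ae_eq f g : measurable_fun setT f -> measurable_fun setT g ->
  {ae P, forall w, f w = g w} -> E f = E g.
Proof.
move=> mf mg fg; congr fine; apply: ae_eq_integral => //.
- exact/measurable_EFinP.
- exact/measurable_EFinP.
- by apply: filterS fg => w -> _.
Qed.

End BoundedExpectation.

Section Cgf.
Context d (T : measurableType d) {R : realType} (P : probability T R).
Variable X : T -> R.
Hypotheses (mX : measurable_fun setT X) (X1 : forall w, `|X w| <= 1).
Notation E f := (\int[P]_w (f w)).

Definition mgf (u : R) : R := E (fun w => expR (u * X w)).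
Definition dmgf (u : R) : R := E (fun w => X w * expR (u * X w)).

Lemma measurable_expRX u : measurable_fun setT (fun w => expR (u * X w)).
Proof.
apply: measurableT_comp; first exact: measurable_expR.
exact: measurable_funM.
Qed.

Lemma expRX_le u w : expR (u * X w) <= expR `|u|.
Proof.
rewrite ler_expR; apply: le_trans (ler_norm _) _.
by rewrite normrM ler_piMr.
Qed.

Lemma integrable_expRX u : P.-integrable setT (EFin \o (fun w => expR (u * X w))).
Proof.
apply: (@bounded_integrable _ _ _ _ _ (expR `|u|)); first exact: measurable_expRX.
by move=> w; rewrite ger0_norm ?expR_ge0// expRX_le.
Qed.

Lemma integrable_XexpRX u : P.-integrable setT (EFin \o (fun w => X w * expR (u * X w))).
Proof.
apply: (@bounded_integrable _ _ _ _ _ (expR `|u|)).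
  by apply: measurable_funM => //; exact: measurable_expRX.
move=> w; rewrite normrM (ger0_norm (expR_ge0 _)) -[leRHS]mul1r.
by apply: ler_pM; rewrite ?expR_ge0 ?expRX_le.
Qed.

Lemma integrable_X : P.-integrable setT (EFin \o X).
Proof. exact: (@bounded_integrable _ _ _ _ _ 1). Qed.

Lemma mgf_derive (u : R) : is_derive u 1 mgf (dmgf u).
Proof.
apply: (@is_derive_quadratic _ _ _ _ (expR (`|u| + 1))) => h h1.
have ih := integrable_scaleR measurableT h (integrable_XexpRX u).
rewrite /mgf /dmgf -RintegralZl//; last exact: integrable_XexpRX.
have iuh := integrable_expRX (u + h); have iu := integrable_expRX u.
have id := integrable_subR measurableT iuh iu.
rewrite -RintegralB// -RintegralB//.
apply: le_trans (le_normr_Rintegral _ _) _ => //; first exact: integrable_subR.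
rewrite -[leRHS](E_cst P); apply: E_le.
- by apply: integrable_normR => //; exact: integrable_subR.
- exact: finite_measure_integrable_cst.
- move=> w; have -> : expR ((u + h) * X w) - expR (u * X w) - h * (X w * expR (u * X w)) =
    expR (u * X w) * (expR (h * X w) - 1 - h * X w) by rewrite mulrDl expRD; ring.
  rewrite normrM ger0_norm ?expR_ge0//.
  have /andP[t0 t1] := expR_taylor2 (h * X w); rewrite (ger0_norm t0).
  have hX : `|h * X w| <= `|h| by rewrite normrM ler_piMr.
  rewrite expRD -mulrA; apply: ler_pM; rewrite ?expR_ge0 ?expRX_le//.
  apply: (le_trans t1); rewrite mulrC; apply: ler_pM; rewrite ?expR_ge0 ?sqr_ge0//.
    by rewrite ler_expR (le_trans hX).
  by rewrite -[leLHS]real_normK ?num_real// -[leRHS]real_normK ?num_real// lerXn2r.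
Qed.

Lemma dmgf_continuous : continuous dmgf.
Proof.
move=> u; apply/cvgrPdist_le => e e0.
have K0 : 0 < expR (`|u| + 1) by exact: expR_gt0.
near=> v.
have vu : `|v - u| <= Num.min 1 (e / expR (`|u| + 1)).
  rewrite distrC; near: v; apply: cvgr_dist_le; last by rewrite lt_min ltr01 divr_gt0.
  exact: cvg_id.
move: vu; rewrite le_min => /andP[v1 ve].
have iv := integrable_XexpRX v; have iu := integrable_XexpRX u.
rewrite distrC /dmgf -RintegralB//.
apply: le_trans (le_normr_Rintegral _ _) _ => //; first exact: integrable_subR.
rewrite -[leRHS](E_cst P); apply: E_le.
- by apply: integrable_normR => //; exact: integrable_subR.
- exact: finite_measure_integrable_cst.
- move=> w; have -> : X w * expR (v * X w) - X w * expR (u * X w) =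
    X w * (expR (u * X w) * (expR ((v - u) * X w) - 1)).
    by rewrite mulrBr mulr1 -expRD mulrBr; congr (_ * expR _ - _); ring.
  have hX : `|(v - u) * X w| <= `|v - u| by rewrite normrM ler_piMr.
  have e1 := norm_expR_sub1_le ((v - u) * X w).
  rewrite normrM normrM (ger0_norm (expR_ge0 _)).
  apply: (@le_trans _ _ (1 * (expR `|u| * (`|v - u| * expR 1)))).
    apply: ler_pM => //; apply: ler_pM; rewrite ?expR_ge0 ?expRX_le//.
    apply: (le_trans e1); apply: ler_pM; rewrite ?expR_ge0// ler_expR.
    exact: le_trans hX v1.
  rewrite mul1r mulrCA -expRD.
  by move: ve; rewrite ler_pdivlMr.
Unshelve. all: by end_near. Qed.

End Cgf.

(** * Bounds on the cumulant generating function from the lower tail hypothesis *)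

Section TailNumerics.
Context {R : realType}.
Implicit Types c x : R.

Lemma sqr_le_expR_half x : 0 <= x -> (1 + x) ^+ 2 <= 16 * expR (x / 2).
Proof.
move=> x0; have -> : expR (x / 2) = expR (x / 4) ^+ 2.
  by rewrite -expRM_natl; congr expR; field.
have -> : 16 * expR (x / 4) ^+ 2 = (4 * expR (x / 4)) ^+ 2 by ring.
by apply: lerXn2r; rewrite ?nnegrE; have := expR_ge1Dx (x / 4); lra.
Qed.

Lemma expR_expR_decay x : 0 <= x -> expR (- expR (x / 2)) <= 16 / (1 + x) ^+ 2.
Proof.
move=> x0; have h := sqr_le_expR_half x0.
have s0 : 0 < (1 + x) ^+ 2 by rewrite exprn_gt0//; lra.
rewrite expRN ler_pdivlMr// mulrC ler_pdivrMr ?expR_gt0//.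
apply: (le_trans h); rewrite ler_wpM2l// ler_expR.
by have := expR_ge1Dx (x / 2); lra.
Qed.

(** The left side collects the cost of the tail hypothesis, the right side the gain in the exponent.
    From e^(x/2) >= (x/6)^3 and 8 (x/6)^3 = x^3 / 27 comes the threshold 27 (c + 1). *)
Lemma expR_half_dominated c x : 0 <= c -> 27 * (c + 1) <= x ->
  c * expR (x / 2) + expR (x / 2) <= 8 * expR x / x ^+ 2.
Proof.
move=> c0 cx; have x0 : 0 < x by lra.
have e6 : x / 6 <= expR (x / 6) by have := expR_ge1Dx (x / 6); lra.
have e3 : (x / 6) ^+ 3 <= expR (x / 2).
  have -> : expR (x / 2) = expR (x / 6) ^+ 3 by rewrite -expRM_natl; congr expR; field.
  by apply: lerXn2r; rewrite ?nnegrE ?expR_ge0//; lra.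
have -> : expR x = expR (x / 2) * expR (x / 2) by rewrite -expRD; congr expR; field.
have -> : c * expR (x / 2) + expR (x / 2) = (c + 1) * expR (x / 2) by ring.
have -> : 8 * (expR (x / 2) * expR (x / 2)) / x ^+ 2 =
  8 * expR (x / 2) / x ^+ 2 * expR (x / 2) by ring.
rewrite ler_wpM2r ?expR_ge0// ler_pdivlMr ?exprn_gt0//.
apply: (@le_trans _ _ (8 * (x / 6) ^+ 3)); last by rewrite ler_wpM2l.
have -> : 8 * (x / 6) ^+ 3 = x / 27 * x ^+ 2 by field.
by rewrite ler_wpM2r ?sqr_ge0//; lra.
Qed.

Lemma inv_sqr_le x : 1 <= x -> 16 / x ^+ 2 <= 64 / (1 + x) ^+ 2.
Proof.
move=> x1; rewrite ler_pdivrMr ?exprn_gt0//; try lra.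
rewrite mulrAC ler_pdivlMr ?exprn_gt0//; try lra.
by rewrite !expr2; nra.
Qed.

End TailNumerics.

(** One constant dominating 4 >= e, the constants of [dcgf_tail_large] and [cgf_tail_large], and (1
    + x1)^2, with which trivial bounds suffice for x <= x1. It depends on c0 and c1 alone, hence is
    uniform in the laws. *)
Definition cgf_const {R : realType} (c0 c1 : R) : R :=
  68 + 32 / c1 + 16 * `|ln c1| + (3 + 27 * (c0 + 1)) ^+ 2.

Section CgfBounds.
Context d (T : measurableType d) {R : realType} (P : probability T R).
Variables (X : T -> R) (c0 c1 : R).
Hypotheses (mX : measurable_fun setT X) (X1 : forall w, `|X w| <= 1).
Hypotheses (c0_gt0 : 0 < c0) (c1_gt0 : 0 < c1).
Hypothesis EX0 : \int[P]_w X w = 0.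
Hypothesis tailX : forall t : R, 1 <= t ->
  ((c1 * expR (- c0 * expR (Num.sqrt t)))%:E <= P [set w | (1 - 2 / t <= X w)%R])%E.
Notation E f := (\int[P]_w (f w)).
Notation M := (mgf P X).
Notation D := (dmgf P X).

Lemma X_itv w : -1 <= X w <= 1.
Proof. by rewrite -ler_norml. Qed.

Lemma mgf_ge1 u : 1 <= M u.
Proof.
have i1 := finite_measure_integrable_cst P (1 : R) measurableT.
have iX := integrable_scaleR measurableT u (integrable_X P mX X1).
have -> : 1 = E (fun w => 1 + u * X w).
  rewrite RintegralD// E_cst RintegralZl ?EX0 ?mulr0 ?addr0//.
  exact: integrable_X.
apply: E_le; [exact: integrable_addR|exact: integrable_expRX|] => w.
exact: expR_ge1Dx.
Qed.

Lemma mgf_gt0 u : 0 < M u.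
Proof. exact: lt_le_trans (mgf_ge1 u). Qed.

(** As E X = 0, D(u) = E[X (e^(uX) - 1)]. The integrand is nonnegative for u >= 0 and at most u
    e^u. *)
Lemma dmgf_bounds u : 0 <= u -> [/\ 0 <= D u, D u <= M u & D u <= u * expR u].
Proof.
move=> u0; have iX := integrable_X P mX X1.
have iXe := integrable_XexpRX P mX X1 u.
have mono w : X w <= X w * expR (u * X w).
  have /andP[_ x1] := X_itv w.
  have [x0|x0] := leP 0 (X w).
    by rewrite ler_peMr// -expR0 ler_expR mulr_ge0.
  rewrite ler_nMr// -expR0 ler_expR; nra.
split.
- by rewrite -EX0; apply: E_le.
- apply: E_le => //; first exact: integrable_expRX.
  by move=> w; have /andP[_ x1] := X_itv w; rewrite ler_piMl// expR_ge0.
- rewrite -[leLHS]subr0 -EX0 -RintegralB// -[leRHS](E_cst P).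
  apply: E_le; [exact: integrable_subR|exact: finite_measure_integrable_cst|] => w.
  have -> : X w * expR (u * X w) - X w = X w * (expR (u * X w) - 1) by ring.
  apply: (le_trans (ler_norm _)); rewrite normrM.
  have h := norm_expR_sub1_le (u * X w).
  have uX : `|u * X w| <= u by rewrite normrM (ger0_norm u0) ler_piMr.
  rewrite -[leRHS]mul1r; apply: ler_pM => //; apply: (le_trans h).
  by apply: ler_pM; rewrite ?expR_ge0 ?ler_expR.
Qed.

Lemma mgf_lower t u : 1 <= t -> 0 <= u ->
  c1 * expR (- c0 * expR (Num.sqrt t)) * expR (u * (1 - 2 / t)) <= M u.
Proof.
move=> t1 u0; set A := [set w | (1 - 2 / t <= X w)%R].
have mA : measurable A.
  have -> : A = setT `&` X @^-1` `[1 - 2 / t, +oo[.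
    by rewrite setTI; apply/seteqP; split => w /=; rewrite in_itv/= andbT.
  exact: mX.
have PA : c1 * expR (- c0 * expR (Num.sqrt t)) <= fine (P A).
  by rewrite -lee_fin fineK ?fin_num_measure// tailX.
have eA : E (fun w => expR (u * (1 - 2 / t)) * \1_A w) =
    expR (u * (1 - 2 / t)) * fine (P A).
  rewrite RintegralZl//; last exact: integrable_indic.
  by congr (_ * _); rewrite /Rintegral integral_indic// setIT.
apply: (@le_trans _ _ (expR (u * (1 - 2 / t)) * fine (P A))).
  by rewrite mulrC ler_wpM2l ?expR_ge0.
rewrite -eA; apply: E_le.
- by apply: integrable_scaleR => //; exact: integrable_indic.
- exact: integrable_expRX.
- move=> w; rewrite indicE; have [|_] := boolP (w \in A); last first.
    by rewrite mulr0 expR_ge0.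
  by rewrite inE /A/= => Xw; rewrite mulr1 ler_expR ler_wpM2l.
Qed.

(** The event X >= 1 - 2/t with t = (x/2)^2: the tail hypothesis then costs c0 e^(x/2), negligible
    against u = e^x, and the loss 2/t is only 8/x^2. *)
Lemma mgf_lower_exp x : 2 <= x ->
  c1 * expR (- c0 * expR (x / 2)) * expR (expR x * (1 - 8 / x ^+ 2)) <= M (expR x).
Proof.
move=> x2; have := @mgf_lower ((x / 2) ^+ 2) (expR x) _ (expR_ge0 _).
rewrite sqrtr_sqr ger0_norm; last lra.
have -> : 2 / (x / 2) ^+ 2 = 8 / x ^+ 2 by field; rewrite gt_eqF//; lra.
by apply; rewrite expr_ge1//; lra.
Qed.

(** M - D is E[(1 - X) e^(uX)]. Where X >= 1 - tau the first factor is at most tau; elsewhere it is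
    at most 2 and the exponential at most e^(u(1-tau)). *)
Lemma mgf_sub_dmgf u tau : 0 <= u -> 0 <= tau ->
  M u - D u <= tau * M u + 2 * expR (u * (1 - tau)).
Proof.
move=> u0 tau0; have iX := integrable_X P mX X1.
have iXe := integrable_XexpRX P mX X1 u; have ie := integrable_expRX P mX X1 u.
rewrite -RintegralB//.
have ic := finite_measure_integrable_cst P (2 * expR (u * (1 - tau))) measurableT.
rewrite -[X in _ <= _ + X](E_cst P) -RintegralZl// -RintegralD//; last first.
  exact: integrable_scaleR.
apply: E_le; first exact: integrable_subR.
  by apply: integrable_addR => //; exact: integrable_scaleR.
move=> w; have /andP[xm x1] := X_itv w.
have e0 := expR_gt0 (u * X w).
have [h|h] := leP (1 - tau) (X w).
  by have := expR_gt0 (u * (1 - tau)); nra.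
have : expR (u * X w) <= expR (u * (1 - tau)) by rewrite ler_expR; nra.
by have := expR_gt0 (u * (1 - tau)); nra.
Qed.

Let C := cgf_const c0 c1.
Let x1 := 2 + 27 * (c0 + 1).

Lemma cgf_const_parts : [/\ 4 <= C, 64 + 32 / c1 <= C, 64 + 16 * `|ln c1| <= C &
  (1 + x1) ^+ 2 <= C].
Proof.
rewrite /C /cgf_const /x1; have -> : 1 + (2 + 27 * (c0 + 1)) = 3 + 27 * (c0 + 1) by ring.
have := sqr_ge0 (3 + 27 * (c0 + 1)); have := normr_ge0 (ln c1).
have : 0 < 32 / c1 by rewrite divr_gt0.
by split; lra.
Qed.

Lemma dcgf_tail_large x : x1 <= x ->
  1 - D (expR x) / M (expR x) <= (64 + 32 / c1) / (1 + x) ^+ 2.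
Proof.
have cp := c0_gt0; rewrite /x1 => x1x; have M0 := mgf_gt0 (expR x).
have x2 : 2 <= x by lra.
have -> : 1 - D (expR x) / M (expR x) = (M (expR x) - D (expR x)) / M (expR x).
  by field; rewrite gt_eqF.
(* tau = 16/x^2 is twice the loss 8/x^2 in [mgf_lower_exp]; the surplus 8 e^x / x^2 in the exponent
   pays for c0 e^(x/2) and leaves a further e^(x/2). *)
have tau0 : 0 <= 16 / x ^+ 2 by rewrite divr_ge0 ?sqr_ge0.
rewrite ler_pdivrMr//; apply: (le_trans (mgf_sub_dmgf (expR_ge0 x) tau0)).
have -> : (64 + 32 / c1) / (1 + x) ^+ 2 * M (expR x) =
  64 / (1 + x) ^+ 2 * M (expR x) + 2 / c1 * (16 / (1 + x) ^+ 2 * M (expR x)) by ring.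
apply: lerD; last first.
  have -> : 2 * expR (expR x * (1 - 16 / x ^+ 2)) =
    2 / c1 * (c1 * expR (expR x * (1 - 16 / x ^+ 2))) by field; rewrite gt_eqF.
  rewrite ler_wpM2l ?divr_ge0 ?(ltW c1_gt0)//.
  apply: (@le_trans _ _ (expR (- expR (x / 2)) * M (expR x))); last first.
    by rewrite ler_wpM2r ?(ltW M0)// expR_expR_decay//; lra.
  apply: (@le_trans _ _ (expR (- expR (x / 2)) * (c1 * expR (- c0 * expR (x / 2)) *
    expR (expR x * (1 - 8 / x ^+ 2))))); last first.
    by rewrite ler_wpM2l ?expR_ge0// mgf_lower_exp.
  rewrite mulrCA -!mulrA ler_wpM2l ?(ltW c1_gt0)// -!expRD ler_expR.
  have := expR_half_dominated (ltW cp) (_ : 27 * (c0 + 1) <= x).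
  move=> /(_ ltac:(lra)).
  have -> : 8 * expR x / x ^+ 2 = expR x * (1 - 8 / x ^+ 2) - expR x * (1 - 16 / x ^+ 2).
    by ring.
  lra.
by rewrite ler_wpM2r ?(ltW M0)// inv_sqr_le//; lra.
Qed.

Lemma cgf_tail_large x : x1 <= x ->
  expR x - ln (M (expR x)) <= (64 + 16 * `|ln c1|) * expR x / (1 + x) ^+ 2.
Proof.
have cp := c0_gt0; rewrite /x1 => x1x; have M0 := mgf_gt0 (expR x).
have x2 : 2 <= x by lra.
have := mgf_lower_exp x2; rewrite -ler_ln ?posrE ?mulr_gt0 ?expR_gt0//.
rewrite !lnM ?posrE ?mulr_gt0 ?expR_gt0// !expRK => h.
have := expR_half_dominated (ltW cp) (_ : 27 * (c0 + 1) <= x).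
move=> /(_ ltac:(lra)) h1.
have e0 := expR_gt0 (x / 2).
have s0 : 0 < (1 + x) ^+ 2 by rewrite exprn_gt0//; lra.
have h2 : `|ln c1| <= 16 * `|ln c1| * expR x / (1 + x) ^+ 2.
  rewrite ler_pdivlMr//.
  have -> : 16 * `|ln c1| * expR x = `|ln c1| * (16 * expR x) by ring.
  rewrite ler_wpM2l//; apply: (le_trans (sqr_le_expR_half _)); first lra.
  by rewrite ler_wpM2l// ler_expR; lra.
have h3 : 16 * expR x / x ^+ 2 <= 64 * expR x / (1 + x) ^+ 2.
  rewrite mulrAC [leRHS]mulrAC ler_wpM2r ?expR_ge0// inv_sqr_le//; lra.
have -> : (64 + 16 * `|ln c1|) * expR x / (1 + x) ^+ 2 =
  64 * expR x / (1 + x) ^+ 2 + 16 * `|ln c1| * expR x / (1 + x) ^+ 2 by ring.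
have e2 : 16 * expR x / x ^+ 2 = 8 * expR x / x ^+ 2 + 8 * expR x / x ^+ 2 by ring.
have e1 : expR x * (1 - 8 / x ^+ 2) = expR x - 8 * expR x / x ^+ 2 by ring.
have := ler_norm (- ln c1); rewrite normrN => h4.
rewrite e1 in h; rewrite e2 in h3; lra.
Qed.

Lemma cgf_bounds_of_tail :
  cgf_bounds C (fun u => ln (M u)) (fun u => D u / M u).
Proof.
have [C4 CA CB CC] := cgf_const_parts; have cp := c0_gt0.
have small x v : 0 <= x -> x <= x1 -> 0 <= v -> v <= C * v / (1 + x) ^+ 2.
  move=> x0 xx v0; rewrite ler_pdivlMr; last by rewrite exprn_gt0//; lra.
  rewrite mulrC ler_wpM2r//; apply: le_trans CC.
  by apply: lerXn2r; rewrite ?nnegrE ?lerD2l//; lra.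
have d01 u : 0 <= u -> 0 <= D u / M u <= 1.
  move=> u0; have [D0 DM _] := dmgf_bounds u0; have M0 := mgf_gt0 u.
  by rewrite divr_ge0 ?(ltW M0)//= ler_pdivrMr ?mul1r.
split.
- have -> : M 0 = 1 by rewrite /mgf; under eq_Rintegral do rewrite mul0r expR0; rewrite E_cst.
  exact: ln1.
- move=> u; apply: (is_derive_val_eq (is_derive_lnf (mgf_gt0 u) (mgf_derive P mX X1 u))).
  by rewrite mulrC.
- move=> u; apply: continuousM; first exact: dmgf_continuous.
  apply: continuous_invf; first by rewrite gt_eqF ?mgf_gt0.
  exact: is_derive_continuous (mgf_derive P mX X1 u).
- exact: d01.
- move=> u u0; have [D0 DM Du] := dmgf_bounds u0; have M0 := mgf_gt0 u.
  have [u1|u1] := leP u 1.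
    rewrite ler_pdivrMr//; apply: (le_trans Du).
    have e4 : expR u <= C.
      by apply: le_trans C4; apply: le_trans (@expR1_le4 R); rewrite ler_expR.
    have := mgf_ge1 u => M1; have : u * expR u <= C * u by rewrite mulrC ler_wpM2r.
    have : 0 <= C * u by rewrite mulr_ge0//; lra.
    nra.
  have /andP[_ d1] := d01 u u0; apply: (le_trans d1); nra.
- move=> x x0; have [xx|xx] := leP x x1.
    have /andP[d0 d1] := d01 _ (expR_ge0 x).
    apply: (@le_trans _ _ 1); first lra.
    by have := small x 1 x0 xx ler01; rewrite mulr1.
  apply: (le_trans (dcgf_tail_large (ltW xx))).
  by rewrite ler_wpM2r ?invr_ge0 ?sqr_ge0.
- move=> x x0; have [xx|xx] := leP x x1.
    apply: (le_trans _ (small x (expR x) x0 xx (expR_ge0 x))).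
    by rewrite gerBl ln_ge0// mgf_ge1.
  apply: (le_trans (cgf_tail_large (ltW xx))).
  by rewrite ler_wpM2r ?invr_ge0 ?sqr_ge0// ler_wpM2r ?expR_ge0.
Qed.

End CgfBounds.

Lemma norm_sub_le {R : realType} (a b c : R) :
  a <= b + c -> b <= a + c -> `|a - b| <= c.
Proof. by move=> h1 h2; rewrite ler_norml; apply/andP; split; lra. Qed.

(** * Comparison of the cumulant generating functions of two close variables *)

Section MgfCompare.
Context d (T : measurableType d) {R : realType} (P : probability T R).
Variables (X X' : T -> R) (eps : R).
Hypotheses (mX : measurable_fun setT X) (X1 : forall w, `|X w| <= 1).
Hypotheses (mX' : measurable_fun setT X') (X1' : forall w, `|X' w| <= 1).
Hypotheses (EX0 : \int[P]_w X w = 0) (EX0' : \int[P]_w X' w = 0).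
Hypothesis XX' : forall w, `|X w - X' w| <= eps.
Notation E f := (\int[P]_w (f w)).

Lemma ln_mgf_le u : 0 <= u -> ln (mgf P X u) <= ln (mgf P X' u) + u * eps.
Proof.
move=> u0; have M0 := mgf_gt0 mX X1 EX0 u; have M0' := mgf_gt0 mX' X1' EX0' u.
rewrite -[u * eps]expRK -lnM ?posrE ?expR_gt0//.
rewrite ler_ln ?posrE ?mulr_gt0 ?expR_gt0// mulrC.
rewrite /mgf -RintegralZl//; last exact: integrable_expRX.
apply: E_le; first exact: integrable_expRX.
  by apply: integrable_scaleR => //; exact: integrable_expRX.
move=> w; rewrite -expRD ler_expR.
have -> : u * X w = u * (X w - X' w) + u * X' w by ring.
by rewrite lerD2r ler_wpM2l// (le_trans (ler_norm _)).
Qed.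

(** The subtracted linear term has expectation 0 once both means vanish, so the difference of the
    generating functions is quadratic in u. The constant is 132 = 4 * 2 * 16 + 4, from the two terms
    of the decomposition. *)
Lemma expR_diff_le u x y : 0 <= u <= 1 -> `|x| <= 1 -> `|y| <= 1 -> `|x - y| <= eps ->
  `|expR (u * x) - expR (u * y) - u * (x - y)| <= 132 * u ^+ 2 * eps.
Proof.
move=> /andP[u0 u1] x1 y1 xy; have eps0 := le_trans (normr_ge0 _) xy.
have -> : expR (u * x) - expR (u * y) - u * (x - y) =
    expR (u * y) * (expR (u * (x - y)) - 1 - u * (x - y)) +
    u * (x - y) * (expR (u * y) - 1).
  have -> : u * x = u * y + u * (x - y) by ring.
  by rewrite expRD; ring.
have e4 := @expR1_le4 R.
have uy : `|u * y| <= u by rewrite normrM (ger0_norm u0) ler_piMr.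
have uxy : `|u * (x - y)| <= u * eps by rewrite normrM (ger0_norm u0) ler_wpM2l.
have uxy2 : `|u * (x - y)| <= 2 * u.
  rewrite normrM (ger0_norm u0) mulrC ler_wpM2r//.
  by apply: (le_trans (ler_normB _ _)); lra.
have ey : expR `|u * y| <= 4.
  by apply: le_trans e4; rewrite ler_expR (le_trans uy).
have exy : expR `|u * (x - y)| <= 16.
  apply: (@le_trans _ _ (expR (1 + 1))); first by rewrite ler_expR; lra.
  by rewrite expRD; have := expR_gt0 (1 : R); nra.
have t1 : `|expR (u * y) * (expR (u * (x - y)) - 1 - u * (x - y))| <=
    4 * ((u * eps) * (2 * u) * 16).
  rewrite normrM (ger0_norm (expR_ge0 _)); apply: ler_pM; rewrite ?expR_ge0//.
    by apply: le_trans ey; rewrite ler_expR ler_norm.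
  have /andP[s0 s1] := expR_taylor2 (u * (x - y)).
  rewrite (ger0_norm s0); apply: (le_trans s1); apply: ler_pM; rewrite ?sqr_ge0 ?expR_ge0//.
  by rewrite -[leLHS]real_normK ?num_real// expr2; apply: ler_pM.
have t2 : `|u * (x - y) * (expR (u * y) - 1)| <= (u * eps) * (u * 4).
  rewrite normrM; apply: ler_pM => //.
  by apply: (le_trans (norm_expR_sub1_le _)); apply: ler_pM; rewrite ?expR_ge0.
apply: (le_trans (ler_normD _ _)); apply: (le_trans (lerD t1 t2)).
by rewrite le_eqVlt; apply/orP; left; apply/eqP; ring.
Qed.

Lemma mgf_diff_le u : 0 <= u <= 1 -> `|mgf P X u - mgf P X' u| <= 132 * u ^+ 2 * eps.
Proof.
move=> u01.
have ie := integrable_expRX P mX X1 u; have ie' := integrable_expRX P mX' X1' u.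
have iX := integrable_X P mX X1; have iX' := integrable_X P mX' X1'.
have iXX := integrable_subR measurableT iX iX'.
have -> : mgf P X u - mgf P X' u =
    E (fun w => expR (u * X w) - expR (u * X' w) - u * (X w - X' w)).
  rewrite RintegralB//; last exact: integrable_scaleR.
    by rewrite RintegralZl// RintegralB// RintegralB// EX0 EX0' subrr mulr0 subr0.
  exact: integrable_subR.
apply: (le_trans (le_normr_Rintegral _ _)) => //.
  by apply: integrable_subR => //; [exact: integrable_subR|exact: integrable_scaleR].
rewrite -[leRHS](E_cst P); apply: E_le.
- by apply: integrable_normR => //; apply: integrable_subR => //;
    [exact: integrable_subR|exact: integrable_scaleR].
- exact: finite_measure_integrable_cst.
- by move=> w; exact: expR_diff_le.
Qed.

Lemma ln_diff_le (m m' : R) : 1 <= m -> 1 <= m' -> ln m - ln m' <= `|m - m'|.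
Proof.
move=> m1 m1'; rewrite -ln_div ?posrE; try lra.
have m'0 : 0 < m' by lra.
have -> : m / m' = 1 + (m - m') / m' by field; rewrite gt_eqF.
apply: (le_trans (le_ln1Dx _)).
  by have -> : (m - m') / m' = m / m' - 1 by [field; rewrite gt_eqF|];
     have : 0 < m / m' by [rewrite divr_gt0//; lra|]; lra.
rewrite ler_pdivrMr//; apply: (le_trans (ler_norm _)).
by rewrite ler_peMr.
Qed.

End MgfCompare.

(** Both bounds are needed: the linear one for q_n <= Z, where u is large, and the quadratic one for
    q_n > Z, where a sum of 1/q_n would be too large but that of 1/q_n^2 is not. *)
Lemma ln_mgf_compare d (T : measurableType d) {R : realType} (P : probability T R)
    (X X' : T -> R) (eps u : R) :
  measurable_fun setT X -> (forall w, `|X w| <= 1) -> \int[P]_w X w = 0 ->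
  measurable_fun setT X' -> (forall w, `|X' w| <= 1) -> \int[P]_w X' w = 0 ->
  (forall w, `|X w - X' w| <= eps) -> 0 <= u ->
  `|ln (mgf P X u) - ln (mgf P X' u)| <= u * eps /\
  `|ln (mgf P X u) - ln (mgf P X' u)| <= 132 * u ^+ 2 * eps.
Proof.
move=> mX X1 EX mX' X1' EX' XX' u0.
have X'X w : `|X' w - X w| <= eps by rewrite distrC.
have e1 : `|ln (mgf P X u) - ln (mgf P X' u)| <= u * eps.
  by apply: norm_sub_le; exact: ln_mgf_le.
split=> //; have [u1|u1] := leP u 1.
  have u01 : 0 <= u <= 1 by rewrite u0.
  apply: le_trans (mgf_diff_le mX X1 mX' X1' EX EX' XX' u01).
  have M1 := mgf_ge1 mX X1 EX u; have M1' := mgf_ge1 mX' X1' EX' u.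
  rewrite ler_norml; apply/andP; split; last exact: ln_diff_le.
  by rewrite lerNl opprB distrC; exact: ln_diff_le.
have eps0 : 0 <= eps := le_trans (normr_ge0 _) (XX' point).
apply: (le_trans e1); rewrite ler_wpM2r// expr2; nra.
Qed.

(** * Replacing Y(n) by Y *)

Section SquareTail.
Context {R : realType}.
Variables (x : nat -> R) (k : R -> nat).
Hypothesis x_ge0 : forall n, 0 <= x n.
Hypothesis kP : forall n y, (x n <= y) = (n < k y)%N.
Notation mu := (@lebesgue_measure R).
Notation int a b f := (\int[mu]_(y in `[a, b]) (f y)).
Let n (y : R) : R := (k y)%:R * expR (- y).
Let S (y : R) : R := \sum_(i < k y) expR (- (2 * x i)).

Lemma square_abel X : 0 <= X ->
  S X = n X * expR (- X) + 2 * int 0 X (fun y => n y * expR (- y)).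
Proof.
move=> X0.
have -> : S X = (k X)%:R * expR (- (2 * X)) -
    int 0 X (fun y => (k y)%:R * - (2 * expR (- (2 * y)))).
  have dx (y : R) : is_derive y 1 (fun y : R => expR (- (2 * y))) (- (2 * expR (- (2 * y)))).
    apply: (is_derive_val_eq (is_derive_expRf (is_derive_neg
      (is_derive_scale 2 (is_derive_var y))))).
    by rewrite mulr1 mulrN mulrC.
  apply: (@abel_summation _ x k x_ge0 kP X (fun y => expR (- (2 * y)))
    (fun y => - (2 * expR (- (2 * y))))) => //.
  move=> y _; apply: continuousN; apply: continuousM; first exact: cst_continuous.
  exact: is_derive_continuous (dx y).
have e2 (y : R) : expR (- (2 * y)) = expR (- y) * expR (- y).
  by rewrite -expRD; congr expR; ring.
congr (_ + _); first by rewrite e2 mulrA.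
rewrite -[RHS]opprK -[X in _ = - X]mulN1r mulrA -RintegralZl//; last first.
  by apply: (nw_integrable kP); exact: continuous_expRN.
congr (- _); apply: eq_Rintegral => y _.
by rewrite e2 /n; ring.
Qed.

Lemma square_tail L X : 0 <= L -> L <= X ->
  S X - S L <= n X * expR (- X) + 2 * int L X (fun y => n y * expR (- y)).
Proof.
move=> L0 LX; rewrite !square_abel//; last exact: le_trans LX.
rewrite (int_chasles L0 LX); last by apply: (nw_integrable kP); exact: continuous_expRN.
have : 0 <= n L * expR (- L) by rewrite mulr_ge0 ?expR_ge0// (@n_ge0 _ k).
lra.
Qed.

End SquareTail.

Section CgfDifference.
Context {R : realType}.
Variables (alpha a C0 y0 Ch : R) (x : nat -> R) (k : R -> nat).
Hypotheses (alpha_gt0 : 0 < alpha) (C0_ge0 : 0 <= C0) (y0_ge1 : 1 <= y0).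
Hypothesis x_ge0 : forall n, 0 <= x n.
Hypothesis kP : forall n y, (x n <= y) = (n < k y)%N.
Notation mu := (@lebesgue_measure R).
Notation int a b f := (\int[mu]_(y in `[a, b]) (f y)).
Let n (y : R) : R := (k y)%:R * expR (- y).
Let h (y : R) : R := \sum_(i < k y) expR (- x i).
Hypothesis nP : forall y, y0 <= y -> `|n y - alpha * y `^ a| <= C0 * y `^ (a - 1).

(** Converts indices into sizes: a term with log q_n > L/2 has log n >= L/4, so the coupling error
    c2 / (log n)^2 is O(L^-2). Powers of y and constants are absorbed by half of the exponent. *)
Lemma count_lower : exists y1, forall y, y1 <= y -> expR (y / 2) <= (k y)%:R.
Proof.
pose delta := (4 * (`|a| + 1))^-1.
pose c := `|a| * (- 1 - ln delta) - ln (alpha / 2).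
exists (y0 + 2 * C0 / alpha + 4 * `|c|) => y yge.
have y01 := y0_ge1; have al := alpha_gt0; have c00 := C0_ge0.
have a0 := normr_ge0 a; have cn := normr_ge0 c.
have Ca : 0 <= 2 * C0 / alpha by rewrite divr_ge0 ?mulr_ge0// ltW.
have yy : 0 < y by lra.
have d0 : 0 < delta by rewrite invr_gt0; lra.
have lny := ln_le_linear d0 yy.
have ad : `|a| * delta <= 4^-1.
  by rewrite /delta ler_pdivrMr; lra.
have l0 : 0 <= ln y by rewrite ln_ge0//; lra.
have lb : - (a * ln y) <= y / 4 + `|a| * (- 1 - ln delta).
  have am : - a <= `|a| by rewrite -normrN ler_norm.
  apply: (@le_trans _ _ (`|a| * ln y)); first by rewrite -mulNr ler_wpM2r.
  apply: (le_trans (ler_wpM2l a0 lny)).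
  have -> : `|a| * (delta * y - 1 - ln delta) =
    `|a| * delta * y + `|a| * (- 1 - ln delta) by ring.
  by rewrite lerD2r mulrC ler_wpM2l ?(ltW yy)//.
have half : alpha / 2 * y `^ a <= n y.
  have := nP (_ : y0 <= y); move=> /(_ ltac:(lra)); rewrite ler_norml => /andP[h1 _].
  have : C0 * y `^ (a - 1) <= alpha / 2 * y `^ a.
    rewrite (powR_split a yy) mulrA ler_wpM2r ?powR_ge0//.
    have : 2 * C0 / alpha <= y by lra.
    by rewrite ler_pdivrMr//; lra.
  lra.
have -> : (k y)%:R = n y * expR y by rewrite /n -mulrA -expRD addNr expR0 mulr1.
apply: (@le_trans _ _ (alpha / 2 * y `^ a * expR y)); last first.
  by rewrite ler_wpM2r ?expR_ge0.
have -> : y `^ a = expR (a * ln y) by rewrite /powR gt_eqF.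
have a2 : 0 < alpha / 2 by rewrite divr_gt0.
rewrite -[alpha / 2]lnK ?posrE// -!expRD ler_expR.
have := ler_norm c; rewrite {1}/c; lra.
Qed.

Variables (C Lam c2 : R) (gs dgs : nat -> R -> R) (g dg : R -> R) (L X lam : R).
Hypotheses (Lam_ge0 : 0 <= Lam) (c2_ge0 : 0 <= c2).
Hypotheses (gP : cgf_bounds C g dg) (gsP : forall i, cgf_bounds C (gs i) (dgs i)).
Hypothesis gs_g : forall i u, (0 < i)%N -> 0 <= u ->
  `|gs i u - g u| <= u * (c2 / ln i.+1%:R ^+ 2) /\
  `|gs i u - g u| <= 132 * u ^+ 2 * (c2 / ln i.+1%:R ^+ 2).
Hypotheses (L_ge : y0 + 4 * Lam + 8 * `|a| + 2 * `|a - 1| + 4 <= L)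
  (kL : expR (L / 4) <= (k (L / 2))%:R).
Hypotheses (LX : L + ln X <= X) (L_le_X : L <= X) (lam_le : `|lam| <= Lam).
Hypothesis hL : h L <= Ch * (L ^+ 2 * (L `^ (a - 1) * ln L)).

Let s := L + lam.

Lemma L_bounds : [/\ y0 <= L, 4 * Lam <= L, 8 * `|a| <= L, 2 * `|a - 1| <= L & 4 <= L].
Proof.
have := L_ge; have := y0_ge1; have := normr_ge0 a; have := normr_ge0 (a - 1).
by have := Lam_ge0; split; lra.
Qed.

Lemma eps_le i : L / 2 < x i -> (0 < i)%N /\ c2 / ln i.+1%:R ^+ 2 <= 16 * c2 / L ^+ 2.
Proof.
have [_ _ _ _ L4] := L_bounds; move=> xi.
have ki : (k (L / 2) <= i)%N by rewrite leqNgt -kP -ltNge.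
have ei : expR (L / 4) <= i%:R by apply: (le_trans kL); rewrite ler_nat.
have i0 : (0 < i)%N by rewrite -(ltr0n R); exact: lt_le_trans (expR_gt0 _) ei.
split=> //.
have li : L / 4 <= ln i.+1%:R.
  rewrite -[X in X <= _]expRK ler_ln ?posrE ?expR_gt0 ?ltr0n//.
  by apply: (le_trans ei); rewrite ler_nat.
have -> : 16 * c2 / L ^+ 2 = c2 / (L / 4) ^+ 2 by field; rewrite gt_eqF//; lra.
rewrite ler_wpM2l ?c2_ge0// lef_pV2 ?posrE ?exprn_gt0//; try lra.
by apply: lerXn2r; rewrite ?nnegrE//; lra.
Qed.

Lemma term_far i : L < x i ->
  `|gs i (expR (s - x i)) - g (expR (s - x i))| <=
  132 * (16 * c2) / L ^+ 2 * expR (2 * (L + Lam)) * expR (- (2 * x i)).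
Proof.
have [_ _ _ _ L4] := L_bounds; move=> Lx.
have [i0 ei] := eps_le (ltac:(lra) : L / 2 < x i).
have [_ h2] := gs_g i0 (expR_ge0 (s - x i)); apply: (le_trans h2).
have -> : expR (s - x i) ^+ 2 = expR (2 * s) * expR (- (2 * x i)).
  by rewrite -expRM_natl -expRD; congr expR; ring.
have -> : 132 * (16 * c2) / L ^+ 2 * expR (2 * (L + Lam)) * expR (- (2 * x i)) =
  132 * (expR (2 * (L + Lam)) * expR (- (2 * x i))) * (16 * c2 / L ^+ 2) by ring.
have hs : expR (2 * s) <= expR (2 * (L + Lam)).
  by rewrite ler_expR /s; have := lam_le; rewrite ler_norml => /andP[_ ?]; lra.
have e0 := expR_ge0 (- (2 * x i)).
apply: (le_trans (ler_wpM2l _ ei)); first by rewrite !mulr_ge0 ?expR_ge0.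
have q0 : 0 <= 16 * c2 / L ^+ 2.
  by apply: divr_ge0; [apply: mulr_ge0; rewrite ?c2_ge0|exact: sqr_ge0].
by rewrite ler_wpM2r// ler_wpM2l// ler_wpM2r.
Qed.

(** For x_i > L/2 the coupling error is small. For x_i <= L/2 the index may be small and the
    coupling useless, but there u = e^(s - x_i) is so large that the tail bound puts both functions
    within O(u / L^2) of u. *)
Lemma term_near i : x i <= L ->
  `|gs i (expR (s - x i)) - g (expR (s - x i))| <=
  16 * (C + c2) / L ^+ 2 * expR (L + Lam) * expR (- x i).
Proof.
have [_ L1 _ _ L4] := L_bounds; move=> xL.
have C_0 := cgfC_ge0 gP; have c20 := c2_ge0.
have := lam_le; rewrite ler_norml => /andP[lam1 lam2].
have es : expR (s - x i) <= expR (L + Lam) * expR (- x i).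
  by rewrite -expRD ler_expR /s; lra.
have L2 : 0 < L ^+ 2 by rewrite exprn_gt0//; lra.
suff H : `|gs i (expR (s - x i)) - g (expR (s - x i))| <=
    16 * (C + c2) / L ^+ 2 * expR (s - x i).
  apply: (le_trans H); rewrite -[leRHS]mulrA ler_wpM2l//.
  by apply: divr_ge0; [apply: mulr_ge0|exact: ltW]; lra.
have [xi|xi] := leP (x i) (L / 2); last first.
  have [i0 ei] := eps_le xi.
  have [h1 _] := gs_g i0 (expR_ge0 (s - x i)); apply: (le_trans h1).
  rewrite mulrC ler_wpM2r ?expR_ge0//; apply: (le_trans ei).
  by rewrite ler_wpM2r ?invr_ge0 ?(ltW L2)//; lra.
have z0 : 0 <= s - x i by rewrite /s; lra.
have zL : L / 4 <= 1 + (s - x i) by rewrite /s; lra.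
have t1 := cgf_tail gP z0; have t2 := cgf_tail (gsP i) z0.
have [_ u1 _] := cgf_ge0_le gP (expR_ge0 (s - x i)).
have [_ u2 _] := cgf_ge0_le (gsP i) (expR_ge0 (s - x i)).
have tb : C * expR (s - x i) / (1 + (s - x i)) ^+ 2 <= 16 * (C + c2) / L ^+ 2 * expR (s - x i).
  rewrite mulrAC ler_wpM2r ?expR_ge0//.
  apply: (@le_trans _ _ (C / (L / 4) ^+ 2)).
    rewrite ler_wpM2l// lef_pV2 ?posrE ?exprn_gt0//; try lra.
    by apply: lerXn2r; rewrite ?nnegrE//; lra.
  have -> : C / (L / 4) ^+ 2 = 16 * C / L ^+ 2 by field; rewrite gt_eqF//; lra.
  by rewrite ler_wpM2r ?invr_ge0 ?(ltW L2)//; lra.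
by rewrite ler_norml; apply/andP; split; lra.
Qed.

Let K3 := C0 + alpha * (8 * `|a|).
Let K8 := (alpha + C0) * (2 `^ `|a| + 2) + 4 * K3 + 2 * alpha.

Lemma square_tail_bound :
  n X * expR (- X) + 2 * int L X (fun y => n y * expR (- y)) <=
  K8 * (expR (- L) * (L * L `^ (a - 1))).
Proof.
have [yL L1 La La1 L4] := L_bounds; have y01 := y0_ge1; have LX' := L_le_X.
have a0 := normr_ge0 a; have Lp : 0 < L by lra.
have p0 := powR_ge0 L (a - 1).
have A0 : 0 <= alpha + C0 by have := alpha_gt0; have := C0_ge0; lra.
have K30 : 0 <= K3 by rewrite addr_ge0// mulr_ge0 ?(ltW alpha_gt0)// mulr_ge0.
have nX : n X <= (alpha + C0) * X `^ a by apply: (density_le C0_ge0 y0_ge1 nP); lra.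
have tp := powR_expR_shift_le Lp (ltac:(lra) : 2 * `|a| <= L) L_le_X LX.
have far y : L <= y <= X ->
    `|n y - alpha * L `^ a| <= (K3 * L `^ (a - 1)) * expR ((y - L) / 2).
  by move=> /andP[Ly _]; apply: (density_right alpha_gt0 C0_ge0 y0_ge1 nP).
have wP y : L <= y <= X -> 0 <= expR (- y) <= expR (- L) * expR (L - y).
  by move=> _; rewrite expR_ge0 -expRD ler_expR; lra.
have := @right_integral _ _ _ kP L X (expR (- L)) (alpha * L `^ a) (K3 * L `^ (a - 1)) _
  (ltW Lp) L_le_X (mulr_ge0 K30 p0) (expR_ge0 _) continuous_expRN wP far.
have -> : int L X (fun y => expR (- y)) = expR (- L) - expR (- X).
  have -> : expR (- L) - expR (- X) = - expR (- X) - - expR (- L).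
    by rewrite opprK addrC.
  apply: (@int_FTC _ (fun y : R => - expR (- y)) (fun y => expR (- y)) L X L_le_X).
    2: by move=> y _; exact: continuous_expRN.
  move=> y _.
  apply: (is_derive_val_eq (is_derive_neg (is_derive_expRf (is_derive_neg (is_derive_var y))))).
  by rewrite mulrN1 opprK.
rewrite ler_norml => /andP[_ h1].
have h2 : n X * expR (- X) <= (alpha + C0) * (2 `^ `|a| + 2) * (expR (- L) * L `^ (a - 1)).
  apply: (@le_trans _ _ ((alpha + C0) * X `^ a * expR (- X))).
    by rewrite ler_wpM2r ?expR_ge0.
  have -> : expR (- X) = expR (- L) * expR (L - X) by rewrite -expRD; congr expR; ring.
  have -> : (alpha + C0) * X `^ a * (expR (- L) * expR (L - X)) =
    (alpha + C0) * expR (- L) * (X `^ a * expR (L - X)) by ring.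
  have -> : (alpha + C0) * (2 `^ `|a| + 2) * (expR (- L) * L `^ (a - 1)) =
    (alpha + C0) * expR (- L) * ((2 `^ `|a| + 2) * L `^ (a - 1)) by ring.
  by rewrite ler_wpM2l// mulr_ge0 ?expR_ge0.
have pL : expR (- L) * L `^ (a - 1) <= expR (- L) * (L * L `^ (a - 1)).
  by rewrite ler_wpM2l ?expR_ge0// ler_peMl//; lra.
have T0 : 0 <= (alpha + C0) * (2 `^ `|a| + 2) by rewrite mulr_ge0// addr_ge0 ?powR_ge0.
have h3 := ler_wpM2l T0 pL; have h4 := ler_wpM2l K30 pL.
have h5 : alpha * L `^ a * (expR (- L) - expR (- X)) <=
    alpha * (expR (- L) * (L * L `^ (a - 1))).
  rewrite (powR_split a Lp) -mulrA ler_wpM2l ?(ltW alpha_gt0)// mulrC ler_wpM2r//.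
    by rewrite mulr_ge0// ltW.
  by rewrite gerBl expR_ge0.
have -> : K8 * (expR (- L) * (L * L `^ (a - 1))) =
  (alpha + C0) * (2 `^ `|a| + 2) * (expR (- L) * (L * L `^ (a - 1))) +
  4 * (K3 * (expR (- L) * (L * L `^ (a - 1)))) +
  2 * (alpha * (expR (- L) * (L * L `^ (a - 1)))) by rewrite /K8; ring.
have h6 : K3 * L `^ (a - 1) * expR (- L) = K3 * (expR (- L) * L `^ (a - 1)) by ring.
rewrite h6 in h1; lra.
Qed.

(** The terms up to L contribute e^L h(L) / L^2, and those beyond L contribute e^(2L) / L^2 times
    the tail of the sum of q_n^-2, which is O(e^(-L) L^a). Both fit into e^L L^(a-1) ln L. *)
Lemma cgf_sum_difference :
  `|\sum_(i < k X) gs i (expR (s - x i)) - \sum_(i < k X) g (expR (s - x i))| <=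
  (16 * (C + c2) * expR Lam * Ch + 132 * (16 * c2) * expR (2 * Lam) * K8) *
    (expR L * (L `^ (a - 1) * ln L)).
Proof.
have [yL L1 La La1 L4] := L_bounds; have y01 := y0_ge1; have LX' := L_le_X.
have Lp : 0 < L by lra.
have kk := k_ndecr kP L_le_X.
rewrite -sumrB; apply: (le_trans (ler_norm_sum _ _ _)).
pose F i := `|gs i (expR (s - x i)) - g (expR (s - x i))|.
rewrite -(big_mkord xpredT F) (big_cat_nat _ kk)//=.
pose A := 16 * (C + c2) / L ^+ 2 * expR (L + Lam).
pose B := 132 * (16 * c2) / L ^+ 2 * expR (2 * (L + Lam)).
have C_0 := cgfC_ge0 gP; have c20 := c2_ge0.
have A0 : 0 <= A.
  apply: mulr_ge0; last exact: expR_ge0.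
  by apply: divr_ge0; [apply: mulr_ge0; rewrite // addr_ge0|exact: sqr_ge0].
have B0 : 0 <= B.
  apply: mulr_ge0; last exact: expR_ge0.
  apply: divr_ge0; last exact: sqr_ge0.
  by apply: mulr_ge0; [exact: ler0n|apply: mulr_ge0].
have near_sum : \sum_(0 <= i < k L) F i <= A * h L.
  rewrite big_mkord /h mulr_sumr; apply: ler_sum => i _.
  by apply: term_near; rewrite kP.
have far_sum : \sum_(k L <= i < k X) F i <= B * (K8 * (expR (- L) * (L * L `^ (a - 1)))).
  apply: (@le_trans _ _ (B * \sum_(k L <= i < k X) expR (- (2 * x i)))).
    rewrite mulr_sumr; apply: ler_sum_nat => i /andP[ki _].
    by apply: term_far; rewrite ltNge kP -leqNgt.
  rewrite ler_wpM2l//; apply: le_trans square_tail_bound.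
  apply: le_trans (square_tail x_ge0 kP (ltW Lp) L_le_X).
  rewrite -(big_mkord xpredT (fun i => expR (- (2 * x i)))).
  rewrite -(big_mkord xpredT (fun i => expR (- (2 * x i)))).
  have -> : \sum_(0 <= i < k X) expR (- (2 * x i)) =
      \sum_(0 <= i < k L) expR (- (2 * x i)) + \sum_(k L <= i < k X) expR (- (2 * x i)).
    exact: big_cat_nat.
  by rewrite addrC addKr.
apply: (le_trans (lerD near_sum far_sum)).
have p0 := powR_ge0 L (a - 1).
have lnL : 1 <= ln L.
  rewrite -[1 in X in X <= _]expRK ler_ln ?posrE ?expR_gt0//.
  exact: le_trans (@expR1_le4 R) L4.
rewrite [leRHS]mulrDl; apply: lerD.
  apply: (le_trans (ler_wpM2l A0 hL)); rewrite /A expRD le_eqVlt.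
  by apply/orP; left; apply/eqP; field; rewrite gt_eqF.
rewrite /B; have -> : expR (2 * (L + Lam)) = expR L * expR L * expR (2 * Lam).
  by rewrite -!expRD; congr expR; ring.
rewrite expRN.
have -> : 132 * (16 * c2) / L ^+ 2 * (expR L * expR L * expR (2 * Lam)) *
    (K8 * ((expR L)^-1 * (L * L `^ (a - 1)))) =
  132 * (16 * c2) * expR (2 * Lam) * K8 * (expR L * (L `^ (a - 1) * L^-1)).
  by field; rewrite !gt_eqF ?expR_gt0.
have K80 : 0 <= K8.
  have := alpha_gt0; have := C0_ge0 => c00 al0.
  by rewrite /K8 /K3 !addr_ge0 ?mulr_ge0 ?addr_ge0 ?powR_ge0 ?(ltW al0)// !mulr_ge0 ?(ltW al0).
rewrite ler_wpM2l//; first by rewrite !mulr_ge0 ?expR_ge0.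
rewrite ler_wpM2l ?expR_ge0// ler_wpM2l//; apply: le_trans lnL.
by rewrite invf_le1//; lra.
Qed.

End CgfDifference.

(** * Independence *)

Section WeightedExpectation.
Import HBNNSimple.
Context d (T : measurableType d) {R : realType} (P : probability T R).
Context d' (U : measurableType d').
Implicit Types (X : T -> U) (W : T -> R) (h : U -> R).
Local Open Scope ereal_scope.

(** [W] stands for the product of the other factors and [c] for its expectation. A simple function
    is a combination of indicators of its level sets, to which the hypothesis applies;
    [integral_weight] passes to monotone limits. *)
Lemma integral_weight_nnsfun X W (c : R) (phi : {nnsfun U >-> R}) :
  measurable_fun setT X -> measurable_fun setT W -> (forall w, 0 <= W w)%R ->
  (0 <= c)%R ->
  (forall D : set U, measurable D ->
    \int[P]_w (W w * \1_D (X w))%:E = c%:E * P (X @^-1` D)) ->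
  \int[P]_w (W w * phi (X w))%:E = c%:E * \int[P]_w (phi (X w))%:E.
Proof.
move=> mX mW W0 c0 H.
pose s := fset_set (phi @` setT).
pose D (i : nat) := phi @^-1` [set s`_i].
have mD i : measurable (D i) by exact: measurable_sfunP.
have s0 (i : 'I_#|`s|) : (0 <= s`_i)%R.
  have : s`_i \in s by rewrite mem_nth.
  by rewrite in_fset_set// inE => -[y _ <-].
have mXD i : measurable (X @^-1` D i) by rewrite -[X in measurable X]setTI; exact: mX.
have mI i : measurable_fun setT (fun w => \1_(D i) (X w) : R).
  by apply: measurableT_comp => //; exact: measurable_indic.
have H1 i : \int[P]_w (\1_(D i) (X w))%:E = P (X @^-1` D i).
  rewrite (eq_integral (fun w => (\1_(X @^-1` D i) w)%:E)) ?integral_indic ?setIT//.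
transitivity (\sum_(i < #|`s|) (s`_i)%:E * (c%:E * P (X @^-1` D i))).
  under eq_integral do rewrite fimfunEord mulr_sumr -sumEFin.
  rewrite ge0_integral_sum//=; last 2 first.
  - move=> i; apply/measurable_EFinP; apply: measurable_funM => //.
    by apply: measurable_funM => //; exact: mI.
  - by move=> i w _; rewrite lee_fin mulr_ge0 ?W0 ?mulr_ge0 ?s0 ?indicE.
  apply: eq_bigr => i _; rewrite -H//.
  under eq_integral do rewrite mulrCA EFinM.
  rewrite ge0_integralZl ?lee_fin ?s0//.
  - by apply/measurable_EFinP; apply: measurable_funM => //; exact: (mI i).
  - by move=> w _; rewrite lee_fin mulr_ge0.
under [in RHS]eq_integral do rewrite fimfunEord -sumEFin.
rewrite ge0_integral_sum//=; last 2 first.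
- by move=> i; apply/measurable_EFinP; apply: measurable_funM => //; exact: (mI i).
- by move=> i w _; rewrite lee_fin mulr_ge0 ?s0 ?indicE.
rewrite ge0_sume_distrr; last first.
  by move=> i _; apply: integral_ge0 => w _; rewrite lee_fin mulr_ge0 ?s0 ?indicE.
apply: eq_bigr => i _; under eq_integral do rewrite EFinM.
rewrite ge0_integralZl ?lee_fin ?s0//; last first.
  by apply/measurable_EFinP; exact: (mI i).
by rewrite H1 muleCA.
Qed.

Lemma integral_weight X W (c : R) h :
  measurable_fun setT X -> measurable_fun setT W -> (forall w, 0 <= W w)%R ->
  (0 <= c)%R -> measurable_fun setT h -> (forall y, 0 <= h y)%R ->
  (forall D : set U, measurable D ->
    \int[P]_w (W w * \1_D (X w))%:E = c%:E * P (X @^-1` D)) ->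
  \int[P]_w (W w * h (X w))%:E = c%:E * \int[P]_w (h (X w))%:E.
Proof.
move=> mX mW W0 c0 mh h0 H.
have mEh : measurable_fun setT (EFin \o h) by exact/measurable_EFinP.
pose phi := nnsfun_approx measurableT mEh.
have cphi y : (phi n y)%:E @[n --> \oo] --> (h y)%:E.
  apply: (@cvg_nnsfun_approx _ _ _ _ measurableT _ mEh _ y) => //.
  by move=> z _; rewrite lee_fin h0.
have ndphi y : {homo (fun n => phi n y) : m n / (m <= n)%N >-> (m <= n)%R}.
  by move=> m n mn; apply/lefP; exact: nd_nnsfun_approx.
have mphi n : measurable_fun setT (fun w => phi n (X w)) by exact: measurableT_comp.
have lim1 : \int[P]_w (W w * phi n (X w))%:E @[n --> \oo] --> \int[P]_w (W w * h (X w))%:E.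
  have -> : \int[P]_w (W w * h (X w))%:E =
      \int[P]_w (limn (fun n => (W w * phi n (X w))%:E)).
    apply: eq_integral => w _; apply/esym/cvg_lim => //.
    by under eq_fun do rewrite EFinM; rewrite EFinM; apply: cvgeZl => //.
  apply: cvg_monotone_convergence => //.
  - by move=> n; apply/measurable_EFinP; apply: measurable_funM.
  - by move=> n w _; rewrite lee_fin mulr_ge0.
  - by move=> w _ m n mn; rewrite lee_fin ler_wpM2l// ndphi.
have lim2 : \int[P]_w (phi n (X w))%:E @[n --> \oo] --> \int[P]_w (h (X w))%:E.
  have -> : \int[P]_w (h (X w))%:E =
      \int[P]_w (limn (fun n => (phi n (X w))%:E)).
    by apply: eq_integral => w _; apply/esym/cvg_lim.
  apply: cvg_monotone_convergence => //.
  - by move=> n; apply/measurable_EFinP.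
  - by move=> n w _; rewrite lee_fin.
  - by move=> w _ m n mn; rewrite lee_fin ndphi.
have := cvg_lim _ lim1; move=> <- //.
apply/cvg_lim => //.
under eq_fun do rewrite (integral_weight_nnsfun _ mX mW W0 c0 H).
exact: cvgeZl.
Qed.

End WeightedExpectation.

Section IndependentProduct.
Context d (T : measurableType d) {R : realType} (P : probability T R).
Context d' (U : measurableType d').
Variable X : nat -> T -> U.
Hypotheses (indX : mutually_independent P X) (mX : forall i, measurable_fun setT (X i)).
Notation E f := (\int[P]_w (f w)).

Let good (f : U -> R) : Prop :=
  [/\ measurable_fun setT f, forall y, 0 <= f y & exists M, forall y, f y <= M].

Lemma good_indic (D : set U) : measurable D -> good (\1_D).
Proof.
move=> mD; split; first exact: measurable_indic.
  by move=> y; rewrite indicE.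
by exists 1 => y; rewrite indicE lern1 leq_b1.
Qed.

Lemma E_indic (D : set U) i : measurable D ->
  (E (fun w => \1_D (X i w)))%:E = P (X i @^-1` D).
Proof.
move=> mD; have mXD : measurable (X i @^-1` D).
  by rewrite -[X in measurable X]setTI; exact: mX.
rewrite /Rintegral (eq_integral (fun w => (\1_(X i @^-1` D) w)%:E)) //.
by rewrite integral_indic// setIT fineK// fin_num_measure.
Qed.

Lemma prod_good (I : finType) (Q : pred I) (e : I -> nat) (f : nat -> U -> R) :
  (forall i, good (f i)) ->
  [/\ measurable_fun setT (fun w => \prod_(i | Q i) f (e i) (X (e i) w)),
      forall w, 0 <= \prod_(i | Q i) f (e i) (X (e i) w) &
      P.-integrable setT (EFin \o (fun w => \prod_(i | Q i) f (e i) (X (e i) w)))].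
Proof.
move=> gf.
have m : measurable_fun setT (fun w => \prod_(i | Q i) f (e i) (X (e i) w)).
  under eq_fun do rewrite -big_filter.
  apply: measurable_prod => i _; have [mf _ _] := gf (e i).
  exact: measurableT_comp.
have p w : 0 <= \prod_(i | Q i) f (e i) (X (e i) w).
  by apply: prodr_ge0 => i _; have [_ f0 _] := gf (e i).
split=> //.
have /choice[M fM] : forall i, exists M, forall y, f i y <= M.
  by move=> i; have [_ _ h] := gf i.
apply: (@bounded_integrable _ _ _ _ _ (\prod_(i | Q i) M (e i))) => // w.
rewrite ger0_norm//; apply: ler_prod => i _; rewrite fM andbT.
by have [_ f0 _] := gf (e i).
Qed.

Lemma E_prod_indic m (D : nat -> set U) : (forall i, measurable (D i)) ->
  E (fun w => \prod_(i < m) \1_(D i) (X i w)) =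
  \prod_(i < m) E (fun w => \1_(D i) (X i w)).
Proof.
move=> mD.
pose J := [fset i | i in iota 0 m]%fset.
have memJ i : (i \in J) = (i < m)%N.
  apply/imfsetP/idP => [[j /= + ->]|im]; first by rewrite mem_iota.
  by exists i => //=; rewrite mem_iota.
have prodJ (F : nat -> \bar R) : (\prod_(i <- J) F i = \prod_(i < m) F i)%E.
  rewrite -(big_mkord xpredT F) /index_iota subn0; apply: perm_big.
  apply: uniq_perm; [exact: fset_uniq|exact: iota_uniq|] => i.
  by rewrite mem_iota memJ.
apply: EFin_inj; rewrite [RHS](big_morph EFin (@EFinM R) (erefl 1%:E)); under [RHS]eq_bigr do rewrite E_indic//.
rewrite -(prodJ (fun i => P (X i @^-1` D i))) -indX//.
have mB : measurable (\bigcap_(n in [set` J]) X n @^-1` D n).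
  apply: fin_bigcap_measurable => // i _; rewrite -[X in measurable X]setTI.
  exact: mX.
rewrite /Rintegral (eq_integral (fun w =>
  (\1_(\bigcap_(n in [set` J]) X n @^-1` D n) w)%:E)).
  by rewrite integral_indic// setIT fineK// fin_num_measure.
move=> w _; congr _%:E; rewrite indicE.
have [/[!inE] wB|wB] := boolP (w \in _).
  rewrite big1// => i _; rewrite indicE mem_set//.
  by apply: (wB i); rewrite /= memJ.
have [i im Di] : exists2 i : 'I_m, true & ~ D i (X i w).
  apply: contrapT => H; move/negP: wB; apply; rewrite inE => i /=.
  rewrite memJ => im; apply: contrapT => nD.
  by apply: H; exists (Ordinal im).
by rewrite (bigD1 i)//= indicE memNset// mul0r.
Qed.

(** Independence is given for events only. Induction on [k], where the factors of index at least [k]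
    are indicators, frees one factor at a time. *)
Lemma E_prod m (f : nat -> U -> R) : (forall i, good (f i)) ->
  E (fun w => \prod_(i < m) f i (X i w)) = \prod_(i < m) E (fun w => f i (X i w)).
Proof.
suff H k : (k <= m)%N -> forall f : nat -> U -> R, (forall i, good (f i)) ->
    (forall i, (k <= i < m)%N -> exists2 D, measurable D & f i = \1_D) ->
    E (fun w => \prod_(i < m) f i (X i w)) = \prod_(i < m) E (fun w => f i (X i w)).
  move=> gf; apply: (H m) => // i /andP[mi im].
  by move: (leq_ltn_trans mi im); rewrite ltnn.
elim: k => [_|k IH km] {}f gf fD.
  have /choice[D HD] : forall i, exists D, measurable D /\ ((i < m)%N -> f i = \1_D).
    move=> i; have [im|im] := boolP (i < m)%N.
      by have [|D mD fiD] := fD i; [rewrite im|exists D].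
    by exists set0; split.
  under eq_Rintegral do under eq_bigr => i _ do rewrite (HD i).2//.
  under [RHS]eq_bigr => i _ do under eq_Rintegral do rewrite (HD i).2//.
  by apply: E_prod_indic => i; exact: (HD i).1.
pose k' := Ordinal km.
pose W w := \prod_(i < m | i != k') f i (X i w).
pose c := \prod_(i < m | i != k') E (fun w => f i (X i w)).
have [mW W0 iW] := prod_good (fun i : 'I_m => i != k') (@nat_of_ord m) gf.
have c0 : 0 <= c.
  by apply: prodr_ge0 => i _; apply: Rintegral_ge0 => w _; have [_ -> _] := gf i.
rewrite (bigD1 k')//= -/c mulrC.
have -> : (fun w => \prod_(i < m) f i (X i w)) = (fun w => W w * f k (X k w)).
  by apply/funext => w; rewrite (bigD1 k')//= mulrC.
have [mfk fk0 [Mk fkM]] := gf k.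
have ifk : P.-integrable setT (EFin \o (fun w => f k (X k w))).
  apply: (@bounded_integrable _ _ _ _ _ Mk); first exact: measurableT_comp.
  by move=> w; rewrite ger0_norm.
rewrite /Rintegral (integral_weight (mX k) mW W0 c0 mfk fk0).
  by rewrite fineM// integrable_fin_num.
move=> D mD.
(* With the k-th factor replaced by an indicator the induction hypothesis applies; it yields the
   factorisation that [integral_weight] asks of [W]. *)
pose f' i := if i == k then \1_D else f i.
have gf' i : good (f' i).
  by rewrite /f'; case: eqP => _; [exact: good_indic|exact: gf].
have f'D i : (k <= i < m)%N -> exists2 D, measurable D & f' i = \1_D.
  rewrite /f'; case: eqP => [_ _|/eqP ik /andP[ki im]]; first by exists D.
  by apply: fD; rewrite im ltn_neqAle eq_sym ik ki.
have := IH (ltnW km) f' gf' f'D.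
have eW w : \prod_(i < m) f' i (X i w) = W w * \1_D (X k w).
  rewrite (bigD1 k')//= /f' eqxx mulrC; congr (_ * _).
  by apply: eq_bigr => i ik; rewrite (_ : (i == k :> nat) = false)//; exact/negbTE.
under eq_Rintegral do rewrite eW.
rewrite [X in _ = X](bigD1 k')//= {1}/f' eqxx.
have -> : \prod_(i < m | i != k') E (fun w => f' i (X i w)) = c.
  apply: eq_bigr => i ik; apply: eq_Rintegral => w _.
  by rewrite /f' (_ : (i == k :> nat) = false)//; exact/negbTE.
move=> EE.
have iWD : P.-integrable setT (EFin \o (fun w => W w * \1_D (X k w))).
  have [_ _] := prod_good xpredT (@nat_of_ord m) gf'.
  by under eq_fun do rewrite eW.
rewrite -[LHS]fineK; last exact: integrable_fin_num.
rewrite -[fine _]/(E (fun w => W w * \1_D (X k w))) EE EFinM muleC.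
by rewrite E_indic.
Qed.

End IndependentProduct.

(** * From the moment generating function to the tail *)

Section RateFunction.
Context {R : realType}.
Implicit Types u : R.

Lemma rate_le u : 0 <= u <= 1 -> expR u * (u - 1) <= u ^+ 2 - 1.
Proof. by move=> /andP[u0 u1]; have := expR_ge1Dx u; rewrite expr2; nra. Qed.

(** Squaring 1 - u/2 <= e^(-u/2) gives (1 - u + u^2/4) e^u <= 1, which rearranges to the claim as
    e^u >= 1. *)
Lemma rate_ge u : 0 <= u <= 1 -> u ^+ 2 / 4 - 1 <= expR u * (u - 1).
Proof.
move=> /andP[u0 u1]; have h := expR_ge1Dx (- (u / 2)).
have e0 := expR_gt0 u.
have h2 : (1 - u / 2) ^+ 2 <= expR (- u).
  have -> : expR (- u) = expR (- (u / 2)) ^+ 2.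
    by rewrite -expRM_natl; congr expR; field.
  by apply: lerXn2r; rewrite ?nnegrE ?expR_ge0//; lra.
have h3 : (1 - u / 2) ^+ 2 * expR u <= 1.
  by rewrite -ler_pdivlMr// mul1r -expRN.
have h4 : 1 - u / 2 + (u / 2) ^+ 2 - u / 2 <= 1 by rewrite expr2; nra.
have : (1 - u) * expR u + u ^+ 2 / 4 * expR u <= 1.
  by rewrite -mulrDl; congr (_ * _ <= _) : h3; field.
have : u ^+ 2 / 4 <= u ^+ 2 / 4 * expR u.
  by rewrite ler_peMr ?divr_ge0 ?sqr_ge0// -expR0 ler_expR.
lra.
Qed.

Lemma expRN1_le : expR (- 1) <= 2^-1 :> R.
Proof.
rewrite expRN lef_pV2 ?posrE ?expR_gt0//.
by have := expR_ge1Dx (1 : R); lra.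
Qed.

Lemma expRN2_le : expR (- 2) <= 4^-1 :> R.
Proof.
have -> : - 2 = - 1 + - 1 :> R by ring.
rewrite expRD; have := expRN1_le; have := expR_gt0 (- 1 : R); nra.
Qed.

Lemma expR_mul_sub1_ge u : 0 <= u -> u <= expR u * (expR u - 1).
Proof. by move=> u0; have := expR_ge1Dx u; nra. Qed.

Section TailRate.
Variables (S m eps V r u MS Ms Ms2 p : R).
Hypotheses (S0 : 0 < S) (m0 : 0 < m) (r0 : 0 <= r) (r8 : 8 * r <= 1)
  (r2 : r ^+ 2 = eps) (meps : 1 <= m * eps) (uE : u = 4 * r)
  (MS0 : 0 < MS) (Ms0 : 0 < Ms) (Ms20 : 0 < Ms2).
(** [MS], [Ms], [Ms2] are the moment generating function at the tilts [S], [s], [s2], and [p] is the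
    tail probability at V. With u = 4 sqrt(eps) the gain m u^2 / 4 is 4 m eps, against errors of 2 m
    eps in each comparison. [delta] is the width of the window above V, chosen so that (s2 - s)
    delta >= 4 m u^2. *)
Let s := S * expR u.
Let s2 := S * expR (2 * u).
Let delta := 4 * m * u / S.
Hypotheses (h0 : `|ln MS - S * V - m * (1 * (0 - 1))| <= m * eps)
  (h1 : `|ln Ms - s * V - m * (expR u * (u - 1))| <= m * eps)
  (h2 : `|ln Ms2 - s2 * V - m * (expR (2 * u) * (2 * u - 1))| <= m * eps)
  (low : Ms - expR ((s - S) * V) * MS - expR (- ((s2 - s) * (V + delta))) * Ms2 <=
    expR (s * (V + delta)) * p)
  (up : p <= expR (ln MS - S * V)).

Lemma u_bounds : 0 <= u <= 1 /\ 0 <= 2 * u <= 1.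
Proof.
have := r0; have := r8; have := uE => *.
by split; apply/andP; split; lra.
Qed.

Lemma mu2 : m * (u ^+ 2 / 4) = 4 * (m * eps).
Proof. by rewrite -r2 uE; field. Qed.

Lemma below_le : expR ((s - S) * V) * MS <= 4^-1 * Ms.
Proof.
have [u01 _] := u_bounds.
rewrite -{1}[MS]lnK ?posrE// -{1}[Ms]lnK ?posrE// -expRD.
apply: (@le_trans _ _ (expR (- 2) * expR (ln Ms))); last first.
  by rewrite ler_wpM2r ?expR_ge0// expRN2_le.
rewrite -expRD ler_expR.
have := ler_wpM2l (ltW m0) (rate_ge u01); rewrite mulrBr mulr1 mu2.
have := meps; have := h0; have := h1; rewrite !ler_norml => /andP[g1 _] /andP[_ g2].
move: g1 g2; move: (ln Ms) (ln MS) (m * (expR u * (u - 1))) (m * eps) => *; lra.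
Qed.

Lemma gap_ge : 4 * m * u ^+ 2 <= (s2 - s) * delta.
Proof.
have [/andP[u0 _] _] := u_bounds.
have -> : s2 - s = S * (expR u * (expR u - 1)).
  by rewrite /s /s2 (_ : 2 * u = u + u) ?expRD; ring.
have -> : S * (expR u * (expR u - 1)) * delta = 4 * m * u * (expR u * (expR u - 1)).
  by rewrite /delta; field; rewrite gt_eqF.
by rewrite expr2 mulrA ler_wpM2l ?expR_mul_sub1_ge// !mulr_ge0// ltW.
Qed.

(** The rate at 2u is at most 4 m u^2 - m; [gap_ge] cancels the 4 m u^2. The rate at u then leaves -
    4 m eps + 2 m eps <= -2, and e^-2 <= 1/4. *)
Lemma above_le : expR (- ((s2 - s) * (V + delta))) * Ms2 <= 4^-1 * Ms.
Proof.
have [u01 u02] := u_bounds.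
rewrite -{1}[Ms2]lnK ?posrE// -{1}[Ms]lnK ?posrE// -expRD.
apply: (@le_trans _ _ (expR (- 2) * expR (ln Ms))); last first.
  by rewrite ler_wpM2r ?expR_ge0// expRN2_le.
rewrite -expRD ler_expR.
have := ler_wpM2l (ltW m0) (rate_ge u01); rewrite mulrBr mulr1 mu2.
have := ler_wpM2l (ltW m0) (rate_le u02).
have -> : m * ((2 * u) ^+ 2 - 1) = 4 * m * u ^+ 2 - m by ring.
have gap := gap_ge; have mm := mu2.
have e16 : 4 * m * u ^+ 2 = 64 * (m * eps).
  by rewrite -[m * eps](mulKf (_ : 4 != 0)) -?mu2//; field.
have := meps; have := h2; have := h1; rewrite !ler_norml => /andP[g1 _] /andP[_ g2].
move: g1 g2 gap e16.
have -> : (s2 - s) * (V + delta) = s2 * V - s * V + (s2 - s) * delta by ring.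
move: ((s2 - s) * delta) (ln Ms) (ln Ms2) (m * (expR u * (u - 1))) (m * eps) => *; lra.
Qed.

(** At least half of the tilted mass lies in the window. Undoing the tilt costs s delta = 4 m u e^u
    <= 64 m r; the factor 1/2 and the error in ln Ms fit into the remaining 2 m r, since 1 <= m eps
    <= m r. *)
Lemma mass_ge : expR (- m - m * (66 * r)) <= p.
Proof.
have [/andP[u0 u1] _] := u_bounds.
have low' : 2^-1 * Ms <= expR (s * (V + delta)) * p.
  have := low; have := below_le; have := above_le; lra.
have sdelta : s * delta <= 64 * (m * r).
  have -> : s * delta = 4 * m * u * expR u by rewrite /s /delta; field; rewrite gt_eqF.
  have eu4 : expR u <= 4 by apply: le_trans (@expR1_le4 R); rewrite ler_expR.
  apply: (@le_trans _ _ (4 * m * u * 4)).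
    by rewrite ler_wpM2l// !mulr_ge0// ltW.
  by rewrite uE le_eqVlt; apply/orP; left; apply/eqP; ring.
have : expR (- 1) * Ms <= expR (s * (V + delta)) * p.
  by apply: le_trans low'; rewrite ler_wpM2r ?(ltW Ms0)// expRN1_le.
rewrite -ler_pdivrMl ?expR_gt0// => /(le_trans _); apply.
rewrite -{1}[Ms]lnK ?posrE// -expRN -!expRD ler_expR.
have err : m * eps <= m * r.
  rewrite ler_wpM2l ?(ltW m0)// -r2 expr2 ler_piMl//; have := r8; have := r0; lra.
have := ler_wpM2l (ltW m0) (rate_ge (_ : 0 <= u <= 1)); rewrite u0 u1 => /(_ isT).
rewrite mulrBr mulr1 mu2.
have := meps; have := h1; rewrite ler_norml => /andP[g1 _].
rewrite [s * (V + delta)]mulrDr; move: g1 sdelta.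
move: (s * delta) (ln Ms) (m * (expR u * (u - 1))) (m * eps) err => *; lra.
Qed.

Lemma tail_rate : exists e, `|e| <= 66 * r /\ p = expR (- (m * (1 + e))).
Proof.
have p0 : 0 < p by apply: lt_le_trans mass_ge; exact: expR_gt0.
exists (- ln p / m - 1); split; last first.
  have -> : - (m * (1 + (- ln p / m - 1))) = ln p by field; rewrite gt_eqF.
  by rewrite lnK.
have lo : - m - m * (66 * r) <= ln p by rewrite -ler_expR lnK ?posrE// mass_ge.
have hi : ln p <= ln MS - S * V by rewrite -ler_expR lnK ?posrE.
have -> : - ln p / m - 1 = (- ln p - m) / m by field; rewrite gt_eqF.
rewrite normrM normfV (gtr0_norm m0) ler_pdivrMr// ler_norml.
have err : m * eps <= m * r.
  rewrite ler_wpM2l ?(ltW m0)// -r2 expr2 ler_piMl//; have := r8; have := r0; lra.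
have mr : 0 <= m * r by rewrite mulr_ge0// ltW.
have := h0; rewrite ler_norml => /andP[_ g1].
by apply/andP; split; lra.
Qed.

End TailRate.
End RateFunction.

Section TailProbability.
Context d (T : measurableType d) {R : realType} (P : probability T R).
Variables (H : T -> R) (B V : R).
Hypotheses (mH : measurable_fun setT H) (HB : forall w, `|H w| <= B).
Notation E f := (\int[P]_w (f w)).
Notation M s := (E (fun w => expR (s * H w))).
Let A : set T := [set w | V < H w].

Lemma measurable_gt (c : R) : measurable [set w | c < H w].
Proof.
have -> : [set w | c < H w] = H @^-1` `]c, +oo[.
  by apply/seteqP; split => w /=; rewrite in_itv/= andbT.
by rewrite -[X in measurable X]setTI; exact: mH.
Qed.

Lemma E_indic_gt c : E (fun w => \1_[set w | c < H w] w) = fine (P [set w | c < H w]).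
Proof. by rewrite /Rintegral integral_indic ?setIT//; exact: measurable_gt. Qed.

Lemma integrable_expH s : P.-integrable setT (EFin \o (fun w => expR (s * H w))).
Proof.
apply: (@bounded_integrable _ _ _ _ _ (expR (`|s| * B))).
  by apply: measurableT_comp; [exact: measurable_expR|exact: measurable_funM].
move=> w; rewrite ger0_norm ?expR_ge0// ler_expR; apply: (le_trans (ler_norm _)).
by rewrite normrM ler_wpM2l.
Qed.

Lemma integrable_indicR (D : set T) : measurable D ->
  P.-integrable setT (EFin \o (fun w => \1_D w)).
Proof. exact: integrable_indic. Qed.

Lemma mgfH_gt0 s : 0 < M s.
Proof.
have : expR (- (`|s| * B)) <= M s.
  rewrite -[leLHS](E_cst P); apply: E_le.
  - exact: finite_measure_integrable_cst.
  - exact: integrable_expH.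
  - move=> w; rewrite ler_expR lerNl; apply: (le_trans (ler_norm _)).
    by rewrite normrN normrM ler_wpM2l.
by apply: lt_le_trans; exact: expR_gt0.
Qed.

Lemma tail_upper s : 0 <= s -> fine (P A) <= expR (ln (M s) - s * V).
Proof.
move=> s0; rewrite expRB lnK ?posrE ?mgfH_gt0//.
rewrite ler_pdivlMr ?expR_gt0// mulrC -E_indic_gt -RintegralZl//; last first.
  by apply: integrable_indicR; exact: measurable_gt.
apply: E_le; last 2 first.
- exact: integrable_expH.
- move=> w; rewrite indicE; have [|_] := boolP (w \in _); last first.
    by rewrite mulr0 expR_ge0.
  by rewrite inE/= => VH; rewrite mulr1 ler_expR ler_wpM2l// ltW.
apply: integrable_scaleR => //; apply: integrable_indicR; exact: measurable_gt.
Qed.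

(* Exponential tilting: [s1 < s < s2] bound the mass below V and above V + delta
   in the law tilted by [s], so what remains sits just above V. *)
Lemma tail_lower s1 s s2 delta : s1 <= s -> s <= s2 -> 0 <= s -> 0 <= delta ->
  M s - expR ((s - s1) * V) * M s1 - expR (- ((s2 - s) * (V + delta))) * M s2 <=
  expR (s * (V + delta)) * fine (P A).
Proof.
move=> s1s ss2 s0 d0.
have i1 := integrable_scaleR measurableT (expR ((s - s1) * V)) (integrable_expH s1).
have i2 := integrable_scaleR measurableT (expR (- ((s2 - s) * (V + delta)))) (integrable_expH s2).
have i := integrable_expH s.
have iA := integrable_indicR (measurable_gt V).
rewrite -RintegralZl//; last exact: integrable_expH.
rewrite -RintegralZl//; last exact: integrable_expH.
rewrite -RintegralB// -RintegralB//; last exact: integrable_subR.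
rewrite -E_indic_gt -RintegralZl//; apply: E_le.
- by apply: integrable_subR => //; exact: integrable_subR.
- exact: integrable_scaleR.
move=> w; rewrite -!expRD indicE.
have e1 := expR_gt0 ((s - s1) * V + s1 * H w).
have e2 := expR_gt0 (- ((s2 - s) * (V + delta)) + s2 * H w).
have [|] := boolP (w \in _); rewrite ?inE ?notin_setE/= => VH.
  rewrite mulr1; have [Hd|Hd] := leP (H w) (V + delta).
    have : expR (s * H w) <= expR (s * (V + delta)) by rewrite ler_expR ler_wpM2l.
    lra.
  have : expR (s * H w) <= expR (- ((s2 - s) * (V + delta)) + s2 * H w).
    rewrite ler_expR; have : 0 <= (s2 - s) * (H w - (V + delta)).
      by rewrite mulr_ge0 ?subr_ge0// ltW.
    lra.
  by have := expR_gt0 (s * (V + delta)); lra.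
rewrite mulr0; have {}VH : H w <= V by rewrite leNgt; exact/negP.
have : expR (s * H w) <= expR ((s - s1) * V + s1 * H w).
  rewrite ler_expR; have : 0 <= (s - s1) * (V - H w) by rewrite mulr_ge0 ?subr_ge0.
  lra.
lra.
Qed.

Lemma tail_probability (S m eps : R) : 0 < S -> 0 < m -> 0 <= eps ->
  8 * Num.sqrt eps <= 1 -> 1 <= m * eps ->
  (forall u, 0 <= u <= 1 ->
    `|ln (M (S * expR u)) - S * expR u * V - m * (expR u * (u - 1))| <= m * eps) ->
  exists e, `|e| <= 66 * Num.sqrt eps /\ P A = (expR (- (m * (1 + e))))%:E.
Proof.
move=> S0 m0 eps0 eps1 meps HL.
have r0 : 0 <= Num.sqrt eps by rewrite sqrtr_ge0.
have r2 : Num.sqrt eps ^+ 2 = eps by rewrite sqr_sqrtr.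
move: (Num.sqrt eps) r0 r2 eps1 => r r0 r2 eps1.
have [u uE] : exists u, u = 4 * r by exists (4 * r).
have u01 : 0 <= u <= 1 by apply/andP; split; lra.
have u02 : 0 <= 2 * u <= 1 by apply/andP; split; lra.
have u00 : 0 <= (0 : R) <= 1 by rewrite lexx ler01.
have h0 := HL 0 u00; have h1 := HL u u01; have h2 := HL (2 * u) u02.
rewrite expR0 mulr1 in h0.
have Ss : S <= S * expR u.
  by rewrite ler_peMr ?(ltW S0)// -expR0 ler_expR; case/andP: u01.
have ss2 : S * expR u <= S * expR (2 * u).
  by rewrite ler_wpM2l ?(ltW S0)// ler_expR; lra.
have d0 : 0 <= 4 * m * u / S.
  by apply: divr_ge0; rewrite ?(ltW S0)// !mulr_ge0 ?(ltW m0)//; case/andP: u01.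
have low := tail_lower Ss ss2 (le_trans (ltW S0) Ss) d0.
have up := tail_upper (ltW S0).
have fp : P A = (fine (P A))%:E by rewrite fineK// fin_num_measure//; exact: measurable_gt.
have [e [eb eE]] := tail_rate S0 m0 r0 eps1 r2 meps uE (mgfH_gt0 _) (mgfH_gt0 _)
  (mgfH_gt0 _) h0 h1 h2 low up.
by exists e; split=> //; rewrite fp eE.
Qed.

End TailProbability.

(** * Harmonic sums and the range of V *)

Section MainTerm.
Context {R : realType}.
Variables (alpha A : R).
Hypothesis alpha_gt0 : 0 < alpha.
Notation a := (A - 1).

(** The main term of H in the variable y = log(x / beta): in both cases a primitive of alpha
    y^(A-1), so the rest of the argument need not distinguish them. *)
Definition Umain (y : R) : R := if A == 0 then alpha * ln y else alpha / A * y `^ A.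

Lemma Umain_derive (y : R) : 0 < y -> is_derive y 1 Umain (alpha * y `^ a).
Proof.
move=> y0; rewrite /Umain; case: (eqVneq A 0) => [->|An0].
  rewrite sub0r powR_inv1 ?(ltW y0)//.
  exact: is_derive_scale (is_derive1_ln y0).
apply: (is_derive_val_eq (is_derive_scale _ (is_derive_powRf A y0 (is_derive_var y)))).
by rewrite mulr1 mulrA divfK.
Qed.

Lemma Umain_mvt (y z : R) : 0 < y -> y <= z ->
  exists2 c, y <= c <= z & Umain z - Umain y = alpha * c `^ a * (z - y).
Proof.
move=> y0; rewrite le_eqVlt => /predU1P[<-|yz].
  by exists y; rewrite ?lexx// !subrr mulr0.
have dU t : t \in `]y, z[%R -> is_derive t 1 Umain (alpha * t `^ a).
  by rewrite in_itv/= => /andP[yt _]; apply: Umain_derive; exact: lt_trans yt.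
have cU : {within `[y, z], continuous Umain}.
  apply: cts_within => t /andP[yt _].
  by apply: is_derive_continuous (Umain_derive _); exact: lt_le_trans yt.
have [c /[!in_itv]/= /andP[yc cz] ->] := MVT yz dU cU.
by exists c => //; rewrite !ltW.
Qed.

Lemma Umain_increment_le (y h : R) : 0 <= h -> h <= y / 2 -> 0 < y ->
  Umain y - Umain (y - h) <= alpha * h * (2 `^ `|a| * y `^ a).
Proof.
move=> h0 hy y0; have [c /andP[c1 c2] ->] := @Umain_mvt (y - h) y ltac:(lra) ltac:(lra).
have -> : alpha * c `^ a * (y - (y - h)) = alpha * h * c `^ a by ring.
rewrite ler_wpM2l ?mulr_ge0 ?(ltW alpha_gt0)//.
by apply: powR_comparable; lra.
Qed.

Lemma Umain_decrement_le (y h : R) : 0 <= h -> h <= y -> 0 < y ->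
  Umain (y + h) - Umain y <= alpha * h * (2 `^ `|a| * y `^ a).
Proof.
move=> h0 hy y0; have [c /andP[c1 c2] ->] := @Umain_mvt y (y + h) ltac:(lra) ltac:(lra).
have -> : alpha * c `^ a * (y + h - y) = alpha * h * c `^ a by ring.
rewrite ler_wpM2l ?mulr_ge0 ?(ltW alpha_gt0)//.
by apply: powR_comparable; lra.
Qed.

Lemma Umain_shift_le (y b : R) : `|b| <= y / 2 -> 0 < y ->
  `|Umain (y - b) - Umain y| <= alpha * `|b| * (2 `^ `|a| * y `^ a).
Proof.
move=> by2 y0; have P0 y1 y2 : 0 < y1 -> y1 <= y2 -> Umain y1 <= Umain y2.
  move=> p0 p1; have [c /andP[c1 _] e] := Umain_mvt p0 p1.
  rewrite -subr_ge0 e mulr_ge0 ?subr_ge0// mulr_ge0 ?powR_ge0//; exact: ltW.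
have [b0|b0] := leP 0 b.
  rewrite ger0_norm// in by2 *.
  rewrite ler0_norm ?opprB; first exact: Umain_increment_le.
  by rewrite subr_le0; apply: P0; lra.
rewrite ltr0_norm// in by2 *.
rewrite ger0_norm; first by apply: Umain_decrement_le; lra.
by rewrite subr_ge0; apply: P0; lra.
Qed.

(** Second order is required: the linear term reproduces alpha log log Q (log Q)^(A-1) in R with its
    exact constant, and only the quadratic remainder may be left to Theta. *)
Lemma Umain_sub_ge (y h : R) : 0 <= h -> h <= y / 2 -> 0 < y ->
  Umain y - alpha * h * y `^ a - alpha * (2 * `|a| * expR `|a|) * (h ^+ 2 * y `^ (a - 1))
  <= Umain (y - h).
Proof.
move=> h0 hy y0; have [c /andP[c1 c2] e] := @Umain_mvt (y - h) y ltac:(lra) ltac:(lra).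
have L := powR_lipschitz a y0 (ltac:(lra) : y / 2 <= c).
have cy : `|c - y| <= h by rewrite ler_norml; apply/andP; split; lra.
have Le : `|c `^ a - y `^ a| <= 2 * `|a| * expR `|a| * (h * y `^ (a - 1)).
  apply: (le_trans L).
  have -> : 2 * `|a| * expR `|a| * (h * y `^ (a - 1)) =
    2 * `|a| * h * y `^ (a - 1) * expR `|a| by ring.
  apply: ler_pM; rewrite ?expR_ge0 ?mulr_ge0 ?powR_ge0//.
    by rewrite ler_wpM2r ?powR_ge0// ler_wpM2l ?mulr_ge0.
  rewrite ler_expR ler_pdivrMr//.
  apply: (@le_trans _ _ (2 * `|a| * (y / 2))).
    by rewrite ler_wpM2l ?mulr_ge0//; lra.
  by rewrite le_eqVlt; apply/orP; left; apply/eqP; field.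
have -> : Umain (y - h) = Umain y - alpha * c `^ a * (y - (y - h)) by rewrite -e; ring.
have := le_trans (ler_norm _) Le => Le'.
have ah : 0 <= alpha * h by rewrite mulr_ge0 ?(ltW alpha_gt0).
have := ler_wpM2l ah Le'; rewrite expr2; lra.
Qed.

End MainTerm.

Lemma ln_sqr_le {R : realType} (y : R) : 1 <= y -> ln y ^+ 2 <= 4 * y.
Proof.
move=> y1; have y0 : 0 < y by lra.
have s0 : 0 < Num.sqrt y by rewrite sqrtr_gt0.
have ys : y = Num.sqrt y ^+ 2 by rewrite sqr_sqrtr// ltW.
have l0 := ln_ge0 y1.
have : ln y <= 2 * Num.sqrt y.
  rewrite {1}ys lnXn// mulr_natl lerMn2r/=.
  exact: ltW (ln_sublinear s0).
move=> h; apply: (@le_trans _ _ ((2 * Num.sqrt y) ^+ 2)).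
  by apply: lerXn2r; rewrite ?nnegrE// mulr_ge0// ltW.
by rewrite exprMn -ys; lra.
Qed.

Lemma ln_ge1 {R : realType} (y : R) : 4 <= y -> 1 <= ln y.
Proof.
move=> y4; rewrite -[1 in X in X <= _]expRK ler_ln ?posrE ?expR_gt0//; last lra.
exact: le_trans (@expR1_le4 R) y4.
Qed.

Lemma powR_ge1 {R : realType} (y b : R) : 1 <= y -> 0 <= b -> 1 <= y `^ b.
Proof. by move=> y1 b0; rewrite -(powRr0 y) ler_powR. Qed.

Section LogScale.
Context {R : realType}.
Variables (q : nat -> R) (N : R -> nat).
Hypotheses (q_ge1 : forall i, 1 <= q i) (NP : forall i x, (q i <= x) = (i < N x)%N).

Lemma log_count i y : (ln (q i) <= y) = (i < N (expR y))%N.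
Proof.
have q0 : 0 < q i by have := q_ge1 i; lra.
by rewrite -NP -{2}[q i]lnK ?posrE// ler_expR.
Qed.

Lemma log_ge0 i : 0 <= ln (q i).
Proof. exact: ln_ge0. Qed.

Lemma Hsum_log y : Hsum q (expR y) = \sum_(i < N (expR y)) expR (- ln (q i)).
Proof.
rewrite (Hsum_count NP); apply: eq_bigr => i _.
by rewrite expRN lnK// posrE; have := q_ge1 i; lra.
Qed.

End LogScale.

Section HarmonicSum.
Context {R : realType}.
Variables (alpha beta A CA C0 y0 : R) (q : nat -> R) (N : R -> nat).
Hypotheses (alpha_gt0 : 0 < alpha) (beta_gt0 : 0 < beta) (A_ge0 : 0 <= A)
  (C0_ge0 : 0 <= C0) (y0_ge1 : 1 <= y0).
Hypotheses (q_ge1 : forall i, 1 <= q i) (NP : forall i x, (q i <= x) = (i < N x)%N).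
Hypothesis q_CA : is_CA alpha beta A q CA.
Notation a := (A - 1).
Notation lb := (ln beta).
Notation mu := (@lebesgue_measure R).
Notation int a b f := (\int[mu]_(y in `[a, b]) (f y)).
Let x i := ln (q i).
Let k y := N (expR y).
Let n (y : R) : R := (k y)%:R * expR (- y).
Let h (y : R) : R := \sum_(i < k y) expR (- x i).
Notation U := (Umain alpha A).
Hypothesis nP : forall y, y0 <= y -> `|n y - alpha * y `^ a| <= C0 * y `^ (a - 1).

Let kP i y : (x i <= y) = (i < k y)%N.
Proof. exact: log_count. Qed.

Let x_ge0 i : 0 <= x i.
Proof. exact: log_ge0. Qed.

Lemma h_Hsum y : h y = Hsum q (expR y).
Proof. by rewrite (Hsum_log q_ge1 NP). Qed.

Lemma Hmain_log y : Hmain alpha beta A (expR y) = U (y - lb).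
Proof.
by rewrite /Hmain /Umain ln_div ?posrE ?expR_gt0// expRK.
Qed.

Lemma CA_approx e : 0 < e -> exists y1, forall y, y1 <= y ->
  `|h y - U (y - lb) - CA| <= e.
Proof.
move=> e0; have /cvgrPdist_le/(_ e e0) := q_CA.
move=> [M [_ HM]]; exists (ln (Num.max M 1) + 1) => y My.
rewrite h_Hsum -Hmain_log distrC; apply: HM.
have m0 : 0 < Num.max M 1 by rewrite lt_max ltr01 orbT.
apply: (@le_lt_trans _ _ (Num.max M 1)); first by rewrite le_max lexx.
by rewrite -[X in X < _]lnK ?posrE// ltr_expR; lra.
Qed.

(** A crude bound y^A ln y covering A = 0 and A > 0 alike. It suffices because h(L) is only used
    divided by L^2, and it is written so that this quotient is visibly L^(a-1) ln L. *)
Lemma H_upper : exists Ch y1, forall y, y1 <= y ->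
  h y <= Ch * (y ^+ 2 * (y `^ (a - 1) * ln y)).
Proof.
have [y1 hy1] := CA_approx ltr01.
pose cU := if A == 0 then 2 * alpha else alpha / A * 2 `^ A.
have cU0 : 0 <= cU.
  rewrite /cU; case: ifP => _; first by rewrite mulr_ge0// ltW.
  by rewrite mulr_ge0 ?powR_ge0// divr_ge0// ltW.
exists (cU + `|CA| + 1), (Num.max y1 (2 * `|lb| + 4)) => y; rewrite ge_max => /andP[yy yb].
have l0 := normr_ge0 lb; have y4 : 4 <= y by lra.
have ln1 := ln_ge1 y4; have y0' : 0 < y by lra.
have -> : y ^+ 2 * (y `^ (a - 1) * ln y) = y `^ A * ln y.
  by rewrite (powR_split A y0') (powR_split a y0'); ring.
have yA1 : 1 <= y `^ A by apply: powR_ge1 => //; lra.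
have := hy1 y yy; rewrite ler_norml => /andP[_ hU].
have lbb : - lb <= `|lb| by rewrite -normrN ler_norm.
have lbb' := ler_norm lb.
have UU : U (y - lb) <= cU * (y `^ A * ln y).
  rewrite /Umain /cU; case: (eqVneq A 0) => [->|An0].
    rewrite powRr0 mul1r [2 * _]mulrC -mulrA ler_wpM2l// ?(ltW alpha_gt0)//.
    have -> : 2 * ln y = ln (y ^+ 2) by rewrite lnXn// mulr_natl.
    by rewrite ler_ln ?posrE ?exprn_gt0//; [rewrite expr2; nra|lra].
  rewrite -[leRHS]mulrA; apply: ler_wpM2l; first by rewrite divr_ge0// ltW.
  apply: (@le_trans _ _ (2 `^ A * y `^ A)); last first.
    by rewrite ler_wpM2l ?powR_ge0// ler_peMr// powR_ge0.
  rewrite -powRM//; last exact: ltW.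
  by apply: ge0_ler_powR; rewrite // ?nnegrE; lra.
have t1 : 1 <= y `^ A * ln y by nra.
have := ler_norm CA; have := normr_ge0 CA; nra.
Qed.

Lemma h_increment y z : 0 <= y -> y <= z -> h z - h y = n z - n y + int y z n.
Proof.
move=> y_ge0 yz; rewrite /h !(h_abel x_ge0 kP) //; last exact: le_trans yz.
rewrite (int_chasles y_ge0 yz); last exact: (n_integrable kP).
by rewrite -/(n z) -/(n y); ring.
Qed.

Lemma cts_powR b (y : R) : 0 < y -> {for y, continuous (fun t => t `^ b)}.
Proof.
move=> yp.
exact: is_derive_continuous (is_derive_powRf b yp (is_derive_var y)).
Qed.

(** Since a < 0, the integral of C0 t^(a-1) from y to infinity converges to C0 y^a / |a|, so the
    error does not depend on [z]. *)
Lemma h_increment_le y z : A < 1 -> y0 <= y -> y <= z ->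
  h z - h y <= U z - U y + (alpha + C0 + C0 / `|a|) * y `^ a.
Proof.
move=> A1 yy yz; have y01 := y0_ge1; have yp : 0 < y by lra.
have an : 0 < `|a| by rewrite normr_gt0; lra.
have aE : `|a| = - a by rewrite ltr0_norm//; lra.
rewrite h_increment//; last exact: ltW.
have n0 : 0 <= n y by exact: n_ge0.
have nz : n z <= (alpha + C0) * y `^ a.
  have := density_le C0_ge0 y0_ge1 nP (le_trans yy yz) => H; apply: (le_trans H).
  rewrite ler_wpM2l//; first by have := alpha_gt0; have := C0_ge0; lra.
  have aN : a = - `|a| by rewrite aE opprK.
  rewrite aN !powRN lef_pV2 ?posrE ?powR_gt0//; last lra.
  by apply: ge0_ler_powR; rewrite // ?nnegrE; lra.
have iU : int y z (fun t => alpha * t `^ a) = U z - U y.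
  apply: int_FTC => // t /andP[yt _]; first by apply: Umain_derive => //; lra.
  by apply: continuousM; [exact: cst_continuous|apply: cts_powR; exact: lt_le_trans yt].
have ia : int y z (fun t => C0 * t `^ (a - 1)) = C0 / a * z `^ a - C0 / a * y `^ a.
  apply: (@int_FTC _ (fun t => C0 / a * t `^ a) (fun t => C0 * t `^ (a - 1)) _ _ yz) => t /andP[yt _]; last first.
    by apply: continuousM; [exact: cst_continuous|apply: cts_powR; exact: lt_le_trans yt].
  have t0 : 0 < t by lra.
  apply: (is_derive_val_eq (is_derive_scale (C0 / a) (is_derive_powRf a t0 (is_derive_var t)))).
  by rewrite mulr1 mulrA divfK//; lra.
have i1 : mu.-integrable `[y, z] (EFin \o (fun t => alpha * t `^ a)).
  apply/continuous_integrable_itv/cts_within => t /andP[yt _].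
  by apply: continuousM; [exact: cst_continuous|apply: cts_powR; exact: lt_le_trans yt].
have i2 : mu.-integrable `[y, z] (EFin \o (fun t => C0 * t `^ (a - 1))).
  apply/continuous_integrable_itv/cts_within => t /andP[yt _].
  by apply: continuousM; [exact: cst_continuous|apply: cts_powR; exact: lt_le_trans yt].
have inn : int y z n <= U z - U y + (C0 / a * z `^ a - C0 / a * y `^ a).
  rewrite -iU -ia -RintegralD//; apply: int_le.
  - by apply: integrable_itvS (n_integrable kP z) => //; lra.
  - exact: integrable_addR.
  - move=> t /andP[yt tz]; have := nP (le_trans yy yt).
    by rewrite ler_norml lerBlDl => /andP[_].
have : C0 / a * z `^ a <= 0.
  rewrite mulr_le0_ge0 ?powR_ge0// mulr_ge0_le0 ?C0_ge0// invr_le0.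
  by rewrite subr_le0 ltW.
have : - (C0 / a * y `^ a) = C0 / `|a| * y `^ a by rewrite aE invrN; ring.
rewrite ![(_ + _) * y `^ a]mulrDl; move: nz n0 inn; rewrite !mulrDl; lra.
Qed.

(* For A < 1 the o(1) in [is_CA] need not be O(y^(A-1)), so h y is compared with h z for
   some z so large that both this o(1) and z^(A-1) are negligible. *)
Lemma H_lower : exists C3 y2, 0 <= C3 /\ forall y, y2 <= y ->
  U (y - lb) + CA - C3 * y `^ a <= h y.
Proof.
have [A1|A1] := leP 1 A.
  have [y1 hy1] := CA_approx ltr01; exists 1, (Num.max y1 1); split=> // y.
  rewrite ge_max => /andP[yy y1']; have := hy1 y yy; rewrite ler_norml => /andP[hU _].
  have : 1 <= y `^ a by apply: powR_ge1; lra.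
  lra.
have an : 0 < `|a| by rewrite normr_gt0; lra.
pose K := alpha * `|lb| * 2 `^ `|a|.
have K0 : 0 <= K by rewrite !mulr_ge0 ?powR_ge0// ltW.
have aC : 0 <= alpha + C0 + C0 / `|a|.
  have := divr_ge0 C0_ge0 (ltW an); have := alpha_gt0; have := C0_ge0; lra.
exists (alpha + C0 + C0 / `|a| + K + 2), (y0 + 2 * `|lb|); split; first lra.
move=> y yge; have lb0 := normr_ge0 lb; have y01 := y0_ge1; have yp : 0 < y by lra.
have p0 : 0 < y `^ a by exact: powR_gt0.
have [y1 hy1] := CA_approx p0.
(* The last entry solves z^a = y^a / (K + 1); as a < 0, a larger z only helps. It makes the shift by
   [lb] at z cost at most y^a. *)
pose z := Num.max (Num.max y1 y) (Num.max (2 * `|lb|) (expR (ln (y `^ a / (K + 1)) / a))).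
have zy1 : y1 <= z by rewrite /z !le_max lexx.
have zy : y <= z by rewrite /z !le_max lexx orbT.
have zlb : 2 * `|lb| <= z by rewrite /z !le_max lexx !orbT.
have ze : expR (ln (y `^ a / (K + 1)) / a) <= z by rewrite /z !le_max lexx !orbT.
have zp : 0 < z by lra.
have K1 : 0 < K + 1 by lra.
have za : z `^ a <= y `^ a / (K + 1).
  have d0 : 0 < y `^ a / (K + 1) by rewrite divr_gt0.
  rewrite -[leRHS]lnK ?posrE// /powR gt_eqF// ler_expR.
  have : ln (y `^ a / (K + 1)) / a <= ln z.
    by rewrite -[X in X <= _]expRK ler_ln ?posrE ?expR_gt0.
  by rewrite ler_ndivrMr; [rewrite mulrC|lra].
have Ksmall : K * z `^ a <= y `^ a.
  apply: (le_trans (ler_wpM2l K0 za)); rewrite mulrA ler_pdivrMr// mulrC.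
  by rewrite ler_wpM2l ?(ltW p0)//; lra.
have Sz := Umain_shift_le A alpha_gt0 (_ : `|lb| <= z / 2) zp.
have {}Sz : `|U (z - lb) - U z| <= K * z `^ a.
  by rewrite /K -mulrA; apply: Sz => //; lra.
have Sy := Umain_shift_le A alpha_gt0 (_ : `|lb| <= y / 2) yp.
have {}Sy : `|U (y - lb) - U y| <= K * y `^ a.
  by rewrite /K -mulrA; apply: Sy => //; lra.
have hh := h_increment_le A1 (_ : y0 <= y) zy.
have {}hh : h z - h y <= U z - U y + (alpha + C0 + C0 / `|a|) * y `^ a by apply: hh; lra.
have hz := hy1 z zy1.
have -> : (alpha + C0 + C0 / `|a| + K + 2) * y `^ a =
  (alpha + C0 + C0 / `|a|) * y `^ a + K * y `^ a + 2 * y `^ a by ring.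
move: Sz Sy hh hz; rewrite !ler_norml.
move: ((alpha + C0 + C0 / `|a|) * y `^ a) (K * y `^ a) => c1 c2.
move=> /andP[s1 s2] /andP[s3 s4] hh /andP[s5 s6]; lra.
Qed.

(** The left side is R for X = log Q and the right side is H(Q / log Q). So V <= R forces Z <= Q /
    log Q. *)
Lemma Rbound_le_h : exists Theta X0, 0 < Theta /\ forall X, X0 <= X ->
  U X + CA - (alpha * ln X + Theta) * X `^ a <= h (X - ln X).
Proof.
have [C3 [y2 [C30 hy2]]] := H_lower.
pose K4 := alpha * (2 * `|a| * expR `|a|) * (8 + 2 * `|lb| ^+ 2).
have K40 : 0 <= K4.
  have s0 : 0 <= `|lb| ^+ 2 by exact: sqr_ge0.
  by apply: mulr_ge0; [rewrite !mulr_ge0 ?expR_ge0// ltW|lra].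
(* The summands pay for the shift by log beta, the second-order term of [Umain_sub_ge], the error of
   [H_lower] at X - ln X, and strict positivity. *)
pose T := alpha * `|lb| + K4 + C3 * 2 `^ `|a| + 1.
have T0 : 0 < T.
  by rewrite ltr_wpDl// !addr_ge0 ?mulr_ge0 ?powR_ge0// ltW.
pose delta : R := 4^-1.
exists T, (2 * `|y2| + 4 * (`|lb| + `|1 + ln delta|) + 4 + expR `|lb|); split=> // X XX.
have lb0 := normr_ge0 lb; have ld0 := normr_ge0 (1 + ln delta); have yn := normr_ge0 y2.
have eb := expR_gt0 `|lb|.
have Xp : 0 < X by lra.
have d0 : 0 < delta by rewrite invr_gt0.
have dl := ln_le_linear d0 Xp.
have dabs : - (1 + ln delta) <= `|1 + ln delta| by rewrite -normrN ler_norm.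
have lnX0 : `|lb| <= ln X.
  by rewrite -[X in X <= _]expRK ler_ln ?posrE ?expR_gt0//; lra.
have lnXle : ln X <= X / 4 + `|1 + ln delta|.
  apply: (le_trans dl); rewrite /delta [4^-1 * X]mulrC; rewrite /delta in dabs; lra.
have lbl : - `|lb| <= lb by rewrite lerNl -normrN ler_norm.
have lbr := ler_norm lb.
set hX := ln X + lb.
have h0 : 0 <= hX by rewrite /hX; lra.
have hle : hX <= X / 2 by rewrite /hX; lra.
have XlnX : X / 2 <= X - ln X by lra.
have low := hy2 (X - ln X) ltac:(have := ler_norm y2; lra).
have eU : X - ln X - lb = X - hX by rewrite /hX; ring.
rewrite eU in low; apply: le_trans low.
have US := Umain_sub_ge A alpha_gt0 h0 hle Xp.
have h2 : hX ^+ 2 <= (8 + 2 * `|lb| ^+ 2) * X.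
  have := ln_sqr_le (ltac:(lra) : 1 <= X).
  have : lb ^+ 2 = `|lb| ^+ 2 by rewrite real_normK ?num_real.
  have : 0 <= (ln X - lb) ^+ 2 by exact: sqr_ge0.
  have : `|lb| ^+ 2 <= `|lb| ^+ 2 * X by rewrite ler_peMr ?sqr_ge0//; lra.
  by rewrite /hX !expr2; lra.
have e1 : alpha * (2 * `|a| * expR `|a|) * (hX ^+ 2 * X `^ (a - 1)) <= K4 * X `^ a.
  rewrite (powR_split a Xp) /K4.
  have -> : alpha * (2 * `|a| * expR `|a|) * (8 + 2 * `|lb| ^+ 2) * (X * X `^ (a - 1)) =
    alpha * (2 * `|a| * expR `|a|) * ((8 + 2 * `|lb| ^+ 2) * X * X `^ (a - 1)) by ring.
  rewrite ler_wpM2l ?ler_wpM2r ?powR_ge0// mulr_ge0 ?(ltW alpha_gt0)// !mulr_ge0 ?expR_ge0//.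
have e2 : C3 * (X - ln X) `^ a <= C3 * 2 `^ `|a| * X `^ a.
  rewrite -mulrA ler_wpM2l//; 
  apply: powR_comparable; rewrite ?ler1n// 1?mulrC -?ler_pdivrMr//.
  rewrite ler_pdivrMr// (@le_trans _ _ X)//; first by rewrite gerBl (le_trans lb0).
  by rewrite ler_peMr ?ler1n// ltW.
have Xa := powR_ge0 X a.
have e3 : alpha * hX * X `^ a <= alpha * ln X * X `^ a + alpha * `|lb| * X `^ a.
  by rewrite -mulrDl ler_wpM2r// -mulrDr ler_wpM2l ?(ltW alpha_gt0)// lerD2l.
have -> : (alpha * ln X + T) * X `^ a = alpha * ln X * X `^ a + alpha * `|lb| * X `^ a +
  K4 * X `^ a + C3 * 2 `^ `|a| * X `^ a + X `^ a by rewrite /T; ring.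
lra.
Qed.

(** Over an interval of length 1/L the continuous growth of H is of order L^a / L, and the density
    [n] is itself known only up to O(L^(a-1)). A shorter step would not improve the bound on the
    jump of H. *)
Lemma h_gap_le L V : 2 * y0 <= L -> 2 <= L -> h (L - L^-1) <= V -> V <= h L ->
  `|h L - V| <= (alpha + 6 * (C0 * 2 `^ `|a - 1| + alpha * (2 * `|a| * expR `|a|))) *
    L `^ (a - 1).
Proof.
move=> L0 L2 Vl Vr; set K2 := C0 * _ + _; have Lp : 0 < L by lra.
have y01 := y0_ge1.
have K20 : 0 <= K2.
  by rewrite addr_ge0// mulr_ge0 ?powR_ge0 ?(ltW alpha_gt0)// !mulr_ge0 ?expR_ge0.
have Li : L^-1 <= 2^-1 by rewrite lef_pV2 ?posrE.
have Li0 : 0 < L^-1 by rewrite invr_gt0.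
set y := L - L^-1 in Vl *.
have yL : L / 2 <= y by rewrite /y; lra.
have yL' : y <= L by rewrite /y; lra.
have p0 := powR_gt0 (a - 1) Lp.
have nM t : y <= t -> t <= L -> `|n t - alpha * L `^ a| <= 2 * (K2 * L `^ (a - 1)).
  move=> yt tL; have tl : L / 2 <= t by lra.
  have := density_mid alpha_gt0 C0_ge0 y0_ge1 nP L0 tl tL; rewrite -/K2 => H.
  apply: (le_trans H); rewrite mulrC ler_wpM2r ?mulr_ge0 ?(ltW p0)//.
  by rewrite /y in yt; lra.
have int_le1 : int y L n <= (alpha + 2 * K2) * L `^ (a - 1).
  pose M := alpha * L `^ a + 2 * (K2 * L `^ (a - 1)).
  apply: (@le_trans _ _ (int y L (fun=> M))).
    apply: int_le.
    - by apply: integrable_itvS (n_integrable kP L) => //; lra.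
    - by apply: w_integrable => t; exact: cst_continuous.
    - move=> t /andP[yt tL]; have := nM t yt tL; rewrite ler_norml /M => /andP[_]; lra.
  rewrite int_cst//.
  have -> : L - y = L^-1 by rewrite /y; ring.
  rewrite ler_pdivrMr// /M (powR_split a Lp).
  have : K2 * L `^ (a - 1) <= K2 * L `^ (a - 1) * L.
    by rewrite ler_peMr ?mulr_ge0 ?(ltW p0)//; lra.
  lra.
have inc := h_increment (ltac:(lra) : 0 <= y) yL'.
rewrite ger0_norm ?subr_ge0//.
have nL := nM L yL' (lexx _); have ny := nM y (lexx _) yL'.
move: nL ny; rewrite !ler_norml => /andP[_ nL] /andP[ny _].
move: int_le1; rewrite !mulrDl; lra.
Qed.

End HarmonicSum.

(** * The laws of Y(n) and Y *)

Section Clip.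
Context {R : realType}.
Implicit Types z : R.

(** Projection onto [-1, 1]. It turns almost sure bounds into sure ones without changing the
    variable almost surely and, being 1-Lipschitz, respects the coupling. *)
Definition clip z : R := Num.max (-1) (Num.min z 1).

Lemma clip_itv z : -1 <= clip z <= 1.
Proof. by rewrite /clip le_max lexx ge_max ge_min lexx orbT andbT; lra. Qed.

Lemma clip_cases z :
  [\/ z <= -1 /\ clip z = -1, -1 <= z <= 1 /\ clip z = z | 1 <= z /\ clip z = 1].
Proof.
rewrite /clip; have [z1|z1] := leP z 1; last by apply: Or33; rewrite max_r; lra.
have [z2|z2] := leP (-1) z; first by apply: Or32.
by apply: Or31; split=> //; exact: ltW.
Qed.

Lemma clip_le1 z : `|clip z| <= 1.
Proof. by rewrite ler_norml clip_itv. Qed.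

Lemma clip_id z : `|z| <= 1 -> clip z = z.
Proof.
rewrite ler_norml => /andP[z1 z2]; rewrite /clip.
by rewrite min_l// max_r.
Qed.

Lemma clip_ge z c : c <= 1 -> c <= z -> c <= clip z.
Proof. by move=> c1 cz; rewrite /clip le_max le_min cz c1 orbT. Qed.

Lemma clip_lipschitz z z' : `|clip z - clip z'| <= `|z - z'|.
Proof.
have := ler_norm (z - z'); have : z' - z <= `|z - z'| by rewrite distrC ler_norm.
move: `|z - z'| => c h1 h2; rewrite ler_norml.
by case: (clip_cases z) => -[e1 ->]; case: (clip_cases z') => -[e2 ->];
  apply/andP; split; lra.
Qed.

Lemma measurable_clip : measurable_fun [set: R] clip.
Proof.
apply: measurable_maxr; first exact: measurable_cst.
by apply: measurable_minr; [exact: measurable_id|exact: measurable_cst].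
Qed.

End Clip.

Lemma ae_le_measure d (T : measurableType d) {R : realType} (P : probability T R)
    (D D' : set T) : measurable D -> measurable D' ->
  {ae P, forall w, D w -> D' w} -> (P D <= P D')%E.
Proof.
move=> mD mD' [N [mN N0 DN]]; have mU := measurableU _ _ mD' mN.
apply: (@le_trans _ _ (P (D' `|` N))).
  apply: le_measure; rewrite ?inE// => w Dw.
  by have [D'w|nD'w] := pselect (D' w); [left|right; apply: DN => /(_ Dw)].
have N0' : P N = 0%E := N0.
have : (P (D' `|` N) <= P D' + P N)%E by exact: measureU2.
by rewrite N0' adde0.
Qed.

Section Transfer.
Context {R : realType}.
Context d (T : measurableType d) (P : probability T R) (X : {RV P >-> R}).
Context d' (T' : measurableType d') (P' : probability T' R) (Y : {RV P' >-> R}).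
Hypothesis XY : forall D : set R, measurable D -> distribution P X D = distribution P' Y D.

Lemma E_law (f : R -> R) M : measurable_fun setT f -> (forall y, `|f y| <= M) ->
  \int[P]_w f (X w) = \int[P']_w f (Y w).
Proof.
move=> mf fM; congr fine.
have mfE : measurable_fun setT (EFin \o f) by exact/measurable_EFinP.
have iX : P.-integrable setT ((EFin \o f) \o X).
  by apply: (@bounded_integrable _ _ _ P (f \o X) M); [exact: measurableT_comp|move=> w; exact: fM].
have iY : P'.-integrable setT ((EFin \o f) \o Y).
  by apply: (@bounded_integrable _ _ _ P' (f \o Y) M); [exact: measurableT_comp|move=> w; exact: fM].
rewrite -[LHS](integral_distribution mfE iX) -[RHS](integral_distribution mfE iY).
by apply: eq_measure_integral => D mD _; exact: XY.
Qed.

End Transfer.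

Section Truncation.
Context {R : realType}.
Context d (T : measurableType d) (P : probability T R).

Lemma measurable_clip_comp (X : {RV P >-> R}) : measurable_fun setT (clip \o X).
Proof. by apply: measurableT_comp; [exact: measurable_clip|]. Qed.

Lemma clip_ae (X : {RV P >-> R}) : {ae P, forall w, `|X w| <= 1} ->
  {ae P, forall w, clip (X w) = X w}.
Proof. by apply: filterS => w; exact: clip_id. Qed.

Lemma E_clip (X : {RV P >-> R}) : {ae P, forall w, `|X w| <= 1} ->
  \int[P]_w clip (X w) = fine ('E_P[X])%E.
Proof.
move=> X1; rewrite unlock; apply: E_ae_eq.
- exact: measurable_clip_comp.
- exact: measurable_funPT.
- exact: clip_ae.
Qed.

Lemma measurable_ge_clip (X : {RV P >-> R}) (c : R) :
  measurable [set w | c <= clip (X w)].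
Proof.
rewrite -[X in measurable X]setTI.
have -> : [set w | c <= clip (X w)] = (clip \o X) @^-1` `[c, +oo[.
  by apply/seteqP; split => w /=; rewrite in_itv/= andbT.
exact: measurable_clip_comp.
Qed.

Lemma measurable_gt_RV (X : {RV P >-> R}) (c : R) : measurable [set w | c < X w].
Proof.
rewrite -[X in measurable X]setTI.
have -> : [set w | c < X w] = X @^-1` `]c, +oo[.
  by apply/seteqP; split => w /=; rewrite in_itv/= andbT.
exact: measurable_funPT.
Qed.

(* X' is replaced by its projection onto [X - eps, X + eps], which agrees with X' almost
   surely and satisfies the hypotheses of [ln_mgf_compare] everywhere. *)
Lemma ln_mgf_compare_ae (X X' : T -> R) (eps u : R) :
  measurable_fun setT X -> (forall w, `|X w| <= 1) -> \int[P]_w X w = 0 ->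
  measurable_fun setT X' -> (forall w, `|X' w| <= 1) -> \int[P]_w X' w = 0 ->
  0 <= eps -> {ae P, forall w, `|X w - X' w| <= eps} -> 0 <= u ->
  `|ln (mgf P X u) - ln (mgf P X' u)| <= u * eps /\
  `|ln (mgf P X u) - ln (mgf P X' u)| <= 132 * u ^+ 2 * eps.
Proof.
move=> mX X1 EX mX' X1' EX' eps0 XX' u0.
pose X'' w := Num.max (X w - eps) (Num.min (X w + eps) (X' w)).
have mX'' : measurable_fun setT X''.
  apply: measurable_maxr; first by apply: measurable_funB => //; exact: measurable_cst.
  by apply: measurable_minr => //; apply: measurable_funD => //; exact: measurable_cst.
have X''E : {ae P, forall w, X'' w = X' w}.
  apply: filterS XX' => w; rewrite ler_norml => /andP[h1 h2].
  by rewrite /X'' min_r ?max_r//; lra.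
have X1'' w : `|X'' w| <= 1.
  move: (X1 w) (X1' w); rewrite /X'' !ler_norml => /andP[h1 h2] /andP[h3 h4].
  case: (leP (X w + eps) (X' w)) => ?.
    by rewrite max_r; [apply/andP; split|]; lra.
  by case: (leP (X w - eps) (X' w)) => ?; apply/andP; split; lra.
have XX'' w : `|X w - X'' w| <= eps.
  rewrite /X'' ler_norml; case: (leP (X w + eps) (X' w)) => ?.
    by rewrite max_r; [apply/andP; split|]; lra.
  by case: (leP (X w - eps) (X' w)) => ?; apply/andP; split; lra.
have EX'' : \int[P]_w X'' w = 0 by rewrite (E_ae_eq _ mX' X''E).
have <- : mgf P X'' u = mgf P X' u.
  apply: E_ae_eq; rewrite -/(mgf _ _ _).
  - exact: measurable_expRX.
  - exact: measurable_expRX.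
  - by apply: filterS X''E => w ->.
exact: ln_mgf_compare.
Qed.

End Truncation.

Lemma error_small {R : realType} (c2 delta : R) : 0 < c2 -> 0 < delta ->
  exists n : nat, (0 < n)%N /\ c2 / ln n.+1%:R ^+ 2 <= delta.
Proof.
move=> c20 d0; have r0 : 0 < c2 / delta by rewrite divr_gt0.
pose y := expR (1 + c2 / delta).
have y1 : 1 < y by rewrite /y -[X in X < _]expR0 ltr_expR; lra.
have y0 : 0 <= y by lra.
have /andP[t1 t2] := truncn_itv y0.
exists (Num.truncn y); split.
  by rewrite lt0n; apply/eqP => t0; move: t2; rewrite t0; lra.
have l1 : 1 + c2 / delta <= ln (Num.truncn y).+1%:R.
  by rewrite -[X in X <= _]expRK ler_ln ?posrE ?expR_gt0// ltW.
have lp : 0 < ln (Num.truncn y).+1%:R :> R by lra.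
rewrite ler_pdivrMr ?exprn_gt0// -ler_pdivrMl// mulrC.
move: (ln _) l1 lp => l l1 lp; rewrite expr2; nra.
Qed.

Section Laws.
Context {R : realType}.
Variables (c0 c1 c2 : R).
Hypotheses (c0_gt0 : 0 < c0) (c1_gt0 : 0 < c1) (c2_gt0 : 0 < c2).
Context d (T : measurableType d) (P : probability T R) (Yn : nat -> {RV P >-> R}).
Context d' (T' : measurableType d') (P' : probability T' R) (Y : {RV P' >-> R}).
Hypothesis Yn1 : forall n, {ae P, forall w, `|Yn n w| <= 1} /\ ('E_P[Yn n] = 0)%E.
Hypothesis Yn_tail : forall n (t : R), 1 <= t ->
  ((c1 * expR (- c0 * expR (Num.sqrt t)))%:E <= P [set w | (1 - t^-1 < Yn n w)%R])%E.
Variable Yt : nat -> {RV P >-> R}.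
Hypothesis Yt_law : forall n (D : set R), measurable D ->
  distribution P (Yt n) D = distribution P' Y D.
Hypothesis Yn_Yt : forall n, (0 < n)%N ->
  {ae P, forall w, `|Yn n w - Yt n w| <= c2 / ln n.+1%:R ^+ 2}.

Lemma tail_level (t : R) : 1 <= t -> 1 - 2 / t <= 1 - t^-1 <= 1.
Proof.
move=> t1; have t0 : 0 < t^-1 by rewrite invr_gt0; lra.
by apply/andP; split; lra.
Qed.

Lemma clip_Yn_tail n t : 1 <= t ->
  ((c1 * expR (- c0 * expR (Num.sqrt t)))%:E <=
    P [set w | (1 - 2 / t <= clip (Yn n w))%R])%E.
Proof.
move=> t1; apply: (le_trans (Yn_tail n t1)); have /andP[l1 l2] := tail_level t1.
apply: le_measure; rewrite ?inE; [exact: measurable_gt_RV|exact: measurable_ge_clip|].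
by move=> w /= h; apply: clip_ge; lra.
Qed.

Lemma Yn_cgf n : cgf_bounds (cgf_const c0 c1) (fun u => ln (mgf P (clip \o Yn n) u))
  (fun u => dmgf P (clip \o Yn n) u / mgf P (clip \o Yn n) u).
Proof.
apply: cgf_bounds_of_tail => //.
- exact: measurable_clip_comp.
- by move=> w; exact: clip_le1.
- by rewrite /= (E_clip (Yn1 n).1) (Yn1 n).2.
- exact: clip_Yn_tail.
Qed.

Lemma clip_coupling n : (0 < n)%N ->
  {ae P, forall w, `|clip (Yn n w) - clip (Yt n w)| <= c2 / ln n.+1%:R ^+ 2}.
Proof.
by move=> n0; apply: filterS (Yn_Yt n0) => w; apply: le_trans; exact: clip_lipschitz.
Qed.

(** For fixed t take n so large that the coupling error is at most 1/t; then Y(n) > 1 - 1/t puts the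
    coupled copy of Y above 1 - 2/t. This is why the tail hypothesis on [X] in [CgfBounds] is stated
    with 2/t. *)
Lemma Y_tail t : 1 <= t ->
  ((c1 * expR (- c0 * expR (Num.sqrt t)))%:E <= P' [set w | (1 - 2 / t <= clip (Y w))%R])%E.
Proof.
move=> t1; have t0 : 0 < t^-1 by rewrite invr_gt0; lra.
have [n [n0 nt]] := error_small c2_gt0 t0.
have /andP[l1 l2] := tail_level t1.
apply: (le_trans (Yn_tail n t1)).
have mD : measurable (clip @^-1` `[1 - 2 / t, +oo[ : set R).
  by rewrite -[X in measurable X]setTI; exact: measurable_clip.
have e (z : R) : (clip @^-1` `[1 - 2 / t, +oo[) z = (1 - 2 / t <= clip z).
  by rewrite /= in_itv/= andbT.
have -> : P' [set w | 1 - 2 / t <= clip (Y w)] = P [set w | 1 - 2 / t <= clip (Yt n w)].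
  have := Yt_law n mD; rewrite /distribution /pushforward => /esym.
  by congr (P' _ = P _); apply/seteqP; split => w /=; rewrite in_itv/= andbT.
apply: ae_le_measure; [exact: measurable_gt_RV|exact: measurable_ge_clip|].
apply: filterS (Yn_Yt n0) => w /=; rewrite ler_norml => /andP[_ h1 h2].
by apply: clip_ge; lra.
Qed.

Lemma E_clip_Yt n : \int[P]_w clip (Yt n w) = \int[P']_w clip (Y w).
Proof.
by apply: (E_law (Yt_law n) measurable_clip (M := 1)) => y; exact: clip_le1.
Qed.

(** The law of Y is that of every Y_n, and E Y(n) = 0; hence |E Y| is at most the coupling error for
    arbitrarily large n. *)
Lemma E_clip_Y : \int[P']_w clip (Y w) = 0.
Proof.
apply/eqP; rewrite -normr_le0; apply/ler_addgt0Pr => e e0; rewrite add0r.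
have [n [n0 nt]] := error_small c2_gt0 e0.
rewrite -(E_clip_Yt n).
have iX (X : {RV P >-> R}) : P.-integrable setT (EFin \o (fun w => clip (X w))).
  by apply: (@bounded_integrable _ _ _ P _ 1) => [|w];
    [exact: measurable_clip_comp|exact: clip_le1].
have -> : \int[P]_w clip (Yt n w) = - \int[P]_w (clip (Yn n w) - clip (Yt n w)).
  by rewrite RintegralB// (E_clip (Yn1 n).1) (Yn1 n).2/= sub0r opprK.
have mB : measurable_fun setT (fun w => clip (Yn n w) - clip (Yt n w)).
  by apply: measurable_funB; exact: measurable_clip_comp.
rewrite normrN.
(* Almost surely equal to the difference, but bounded by [e] everywhere, so that expectations can be
   compared pointwise. *)
pose b w := Num.max (- e) (Num.min (clip (Yn n w) - clip (Yt n w)) e).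
have mb : measurable_fun setT b.
  by apply: measurable_maxr => //; apply: measurable_minr.
have b_le w : `|b w| <= e.
  by rewrite ler_norml /b le_max lexx ge_max ge_min lexx orbT andbT; lra.
have -> : \int[P]_w (clip (Yn n w) - clip (Yt n w)) = \int[P]_w b w.
  apply: E_ae_eq => //; apply: filterS (clip_coupling n0) => w h.
  move: (le_trans h nt); rewrite ler_norml => /andP[h1 h2].
  by rewrite /b min_l// max_r.
have ib := bounded_integrable P mb b_le.
rewrite ler_norml -{1}(E_cst P (- e)) -{2}(E_cst P e).
have ic (c : R) : P.-integrable setT (EFin \o (fun _ : T => c)).
  exact: finite_measure_integrable_cst.
by apply/andP; split; apply: E_le => // w; move: (b_le w); rewrite ler_norml => /andP[].
Qed.

Lemma Y_cgf : cgf_bounds (cgf_const c0 c1) (fun u => ln (mgf P' (clip \o Y) u))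
  (fun u => dmgf P' (clip \o Y) u / mgf P' (clip \o Y) u).
Proof.
apply: cgf_bounds_of_tail => //.
- exact: measurable_clip_comp.
- by move=> w; exact: clip_le1.
- exact: E_clip_Y.
- exact: Y_tail.
Qed.

Lemma mgf_Yt n u : mgf P (clip \o Yt n) u = mgf P' (clip \o Y) u.
Proof.
apply: (@E_law _ _ _ _ _ _ _ _ _ (Yt_law n) (fun z => expR (u * clip z)) (expR `|u|)).
  apply: measurableT_comp; first exact: measurable_expR.
  by apply: measurable_funM; [exact: measurable_cst|exact: measurable_clip].
move=> z; rewrite ger0_norm ?expR_ge0// ler_expR.
apply: (le_trans (ler_norm _)); rewrite normrM ler_piMr//; exact: clip_le1.
Qed.

Lemma Yn_Y_cgf n u : (0 < n)%N -> 0 <= u ->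
  `|ln (mgf P (clip \o Yn n) u) - ln (mgf P' (clip \o Y) u)| <=
    u * (c2 / ln n.+1%:R ^+ 2) /\
  `|ln (mgf P (clip \o Yn n) u) - ln (mgf P' (clip \o Y) u)| <=
    132 * u ^+ 2 * (c2 / ln n.+1%:R ^+ 2).
Proof.
move=> n0 u0; rewrite -(mgf_Yt n); apply: ln_mgf_compare_ae => //.
- exact: measurable_clip_comp.
- by move=> w; exact: clip_le1.
- by rewrite /= (E_clip (Yn1 n).1) (Yn1 n).2.
- exact: measurable_clip_comp.
- by move=> w; exact: clip_le1.
- by rewrite /= E_clip_Yt E_clip_Y.
- by rewrite divr_ge0 ?sqr_ge0// ltW.
- exact: clip_coupling.
Qed.

(** Boundedness is assumed for the Y(n) only. Each event |Y| > 1 + 1/(k+1) is null by coupling with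
    a late Y(n), and there are countably many. *)
Lemma Y_le1 : {ae P', forall w, `|Y w| <= 1}.
Proof.
pose F k := Y @^-1` [set z : R | 1 + k.+1%:R^-1 < `|z|].
have mF (b : R) : measurable [set z : R | b < `|z|].
  rewrite -[X in measurable X]setTI.
  have -> : [set z : R | b < `|z|] = (@Num.norm R R) @^-1` `]b, +oo[.
    by apply/seteqP; split => w /=; rewrite in_itv/= andbT.
  by apply: (@normr_measurable R setT) => //; exact: measurable_itv.
suff H k : P'.-negligible (F k).
  have := negligible_bigcup H; apply: negligibleS => w /= /negP; rewrite -ltNge => h.
  have h0 : 0 < `|Y w| - 1 by rewrite subr_gt0.
  have [k _ hk] := near_infty_natSinv_lt (PosNum h0).
  by exists k => //; rewrite /F/= -ltrBrDl; exact: (hk k (leqnn k)).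
apply/negligibleP.
  by rewrite -[X in measurable X]setTI; apply: (measurable_funPT Y) => //; exact: mF.
have k0 : 0 < k.+1%:R^-1 :> R by rewrite invr_gt0.
have [n [n0 nk]] := error_small c2_gt0 k0.
apply: (etrans (esym (Yt_law n (mF (1 + k.+1%:R^-1))))).
change (P (Yt n @^-1` [set z : R | 1 + k.+1%:R^-1 < `|z|]) = 0%E); apply/negligibleP.
  exact: (measurable_funPTI (Yt n) (mF _)).
have [N [mN N0 NS]] := filterI (Yn1 n).1 (Yn_Yt n0).
exists N; split=> // w /= h; apply: NS => -[h1 h2].
have := ler_normB (Yn n w) (Yn n w - Yt n w); rewrite subKr => H.
move: h; rewrite ltNge => /negP; apply; apply: (le_trans H).
exact: (lerD h1 (le_trans h2 nk)).
Qed.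

Lemma etaY_eta_of : etaY Y = eta_of (fun u => ln (mgf P' (clip \o Y) u)).
Proof.
have fE u : fY Y u =
    if u < 1 then ln (mgf P' (clip \o Y) u) else ln (mgf P' (clip \o Y) u) - u.
  have -> : mgf P' (clip \o Y) u = fine ('M_P' Y u)%E.
    rewrite /mmt_gen_fun unlock; apply: E_ae_eq.
    - by apply: measurable_expRX; exact: measurable_clip_comp.
    - apply: measurableT_comp; first exact: measurable_expR.
      by apply: measurable_funM => //; exact: measurable_cst.
    - by apply: filterS (clip_ae Y_le1) => w /= ->; rewrite mulrC.
  by rewrite /fY.
by congr fine; apply: eq_integral => u _; rewrite fE.
Qed.

End Laws.

(** * Size conditions on log Z, a bound for eta, and the sum of the clipped variables *)

Lemma ln_small {R : realType} (delta : R) : 0 < delta ->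
  exists L1, forall L, L1 <= L -> ln L <= delta * L.
Proof.
move=> d0; pose K := `|1 + ln (delta / 2)|.
exists (2 * K / delta + 1) => L hL.
have d2 : 0 < delta / 2 by lra.
have Kn : 0 <= K by exact: normr_ge0.
have K0 : 0 <= 2 * K / delta by apply: divr_ge0; lra.
have L0 : 0 < L by lra.
have h : 2 * K <= delta * L.
  by rewrite [delta * L]mulrC -ler_pdivrMr//; lra.
have := ln_le_linear d2 L0.
have : - (1 + ln (delta / 2)) <= K by rewrite /K -normrN ler_norm.
lra.
Qed.

Lemma expR_powR_ge1 {R : realType} (b : R) :
  exists L1, forall L, L1 <= L -> 1 <= expR L * L `^ b.
Proof.
have d0 : 0 < (`|b| + 1)^-1 by rewrite invr_gt0; have := normr_ge0 b; lra.
have [L1 hL1] := ln_small d0; exists (Num.max L1 1) => L; rewrite ge_max => /andP[h1 h2].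
have L0 : 0 < L by lra.
rewrite /powR gt_eqF// -expRD -[X in X <= _]expR0 ler_expR.
have b0 := normr_ge0 b; have l0 := ln_ge0 h2.
have : (`|b| + 1) * ln L <= L by rewrite -ler_pdivlMl ?hL1//; lra.
have : - (b * ln L) <= `|b| * ln L.
  by rewrite -mulNr ler_wpM2r// -normrN ler_norm.
lra.
Qed.

(** [eta_approx] at b = 1/2 and B = 1: the parts are C/2, C, and an integral in [0, C/2]. A bound
    uniform in the laws is needed because the optimal tilt depends on eta. *)
Lemma norm_eta_le {R : realType} (C : R) (g dg : R -> R) : cgf_bounds C g dg ->
  `|eta_of g| <= 2 * C.
Proof.
move=> gP; have C0 := cgfC_ge0 gP.
have b0 : 0 < (2^-1 : R) by lra. have b1 : (2^-1 : R) < 1 by lra.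
have := eta_approx gP b0 b1 (lexx 1); rewrite ln1 addr0 divr1 subr0 -/(eta_of g).
have cg (y : R) : 2^-1 <= y <= 1 -> {for y, continuous (fun u => g u / u ^+ 2)}.
  move=> /andP[y0 _]; have yn : y ^+ 2 != 0 by rewrite sqrf_eq0 gt_eqF//; lra.
  apply: continuousM; first exact: (cgf_continuous gP).
  by apply: continuous_invf => //; exact: exprn_continuous.
have gle (y : R) : 2^-1 <= y <= 1 -> 0 <= g y / y ^+ 2 <= C.
  move=> /andP[y0 _]; have y00 : 0 <= y by lra.
  have [g0 _ g1] := cgf_ge0_le gP y00.
  have y2 : 0 < y ^+ 2 by rewrite exprn_gt0//; lra.
  by rewrite divr_ge0 ?(ltW y2)//= ler_pdivrMr.
have I1 : lebesgue_measure.-integrable `[2^-1 : R, 1] (EFin \o (fun u => g u / u ^+ 2)).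
  by apply/continuous_integrable_itv/cts_within.
have : \int[lebesgue_measure]_(u in `[2^-1 : R, 1]) (g u / u ^+ 2) <= C / 2.
  apply: (@le_trans _ _ (\int[lebesgue_measure]_(u in `[2^-1 : R, 1]) C)).
    apply: int_le => //.
    - by apply/continuous_integrable_itv/cts_within => t _; exact: cst_continuous.
    - by move=> t /gle/andP[].
  by rewrite int_cst; lra.
have : 0 <= \int[lebesgue_measure]_(u in `[2^-1 : R, 1]) (g u / u ^+ 2).
  by apply: Rintegral_ge0 => u /=; rewrite in_itv/= => /gle /andP[].
move: (eta_of g) (\int[lebesgue_measure]_(u in `[2^-1 : R, 1]) (g u / u ^+ 2)) => e I.
by rewrite !ler_norml => h1 h2 /andP[h3 h4]; apply/andP; split; lra.
Qed.

Section TruncatedSum.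
Context {R : realType}.
Context d (T : measurableType d) (P : probability T R) (Yn : nat -> {RV P >-> R}).
Variables (q : nat -> R) (m : nat).
Hypothesis q_gt0 : forall i, 0 < q i.

Definition clipped_sum (w : T) : R := \sum_(i < m) clip (Yn i w) / q i.

Lemma measurable_clipped_sum : measurable_fun setT clipped_sum.
Proof.
apply: measurable_sum => i; apply: measurable_funM; last exact: measurable_cst.
exact: measurable_clip_comp.
Qed.

Lemma clipped_sum_le w : `|clipped_sum w| <= \sum_(i < m) (q i)^-1.
Proof.
apply: (le_trans (ler_norm_sum _ _ _)); apply: ler_sum => i _.
rewrite normrM [X in _ * X]gtr0_norm ?invr_gt0// ler_piMl ?invr_ge0 ?(ltW (q_gt0 _))//.
exact: clip_le1.
Qed.

Lemma E_exp_clipped_sum (s : R) : mutually_independent P (fun n => Yn n : T -> R) ->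
  \int[P]_w expR (s * clipped_sum w) = \prod_(i < m) mgf P (clip \o Yn i) (s / q i).
Proof.
move=> indY.
rewrite -(@E_prod _ _ _ P _ _ (fun i => Yn i : T -> R) indY
  (fun i => measurable_funPT (Yn i)) m (fun i z => expR (s / q i * clip z))).
  congr fine; apply: eq_integral => w _; congr EFin.
  rewrite -expR_sum /clipped_sum mulr_sumr; congr expR.
  by apply: eq_bigr => i _; ring.
move=> i; split=> [|z|].
- apply: measurableT_comp; first exact: measurable_expR.
  by apply: measurable_funM; [exact: measurable_cst|exact: measurable_clip].
- exact: expR_ge0.
- exists (expR `|s / q i|) => z; rewrite ler_expR.
  by apply: (le_trans (ler_norm _)); rewrite normrM ler_piMr//; exact: clip_le1.
Qed.

Lemma P_clipped_sum (V : R) (S : T -> R) : measurable_fun setT S ->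
  (forall w, S w = \sum_(i < m) Yn i w / q i) ->
  (forall n, {ae P, forall w, `|Yn n w| <= 1}) ->
  P [set w | V < S w] = P [set w | V < clipped_sum w].
Proof.
move=> mS SE Y1.
have : {ae P, forall w, S w = clipped_sum w}.
  have : {ae P, forall w, forall n, clip (Yn n w) = Yn n w}.
    by apply: ae_foralln => n; exact: clip_ae.
  by apply: filterS => w h; rewrite SE; apply: eq_bigr => i _; rewrite h.
have mset (f : T -> R) : measurable_fun setT f -> measurable [set w | V < f w].
  move=> mf; rewrite -[X in measurable X]setTI.
  have -> : [set w | V < f w] = f @^-1` `]V, +oo[.
    by apply/seteqP; split => w /=; rewrite in_itv/= andbT.
  exact: mf.
have mc := measurable_clipped_sum.
move=> h; apply/eqP; rewrite eq_le; apply/andP; split;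
  (apply: ae_le_measure; [exact: mset|exact: mset|]);
  by apply: filterS h => w /= ->.
Qed.

End TruncatedSum.

Lemma ln_prod_ord {R : realType} m (F : nat -> R) : (forall i, 0 < F i) ->
  ln (\prod_(i < m) F i) = \sum_(i < m) ln (F i).
Proof.
move=> F0; elim: m => [|m IH]; first by rewrite !big_ord0 ln1.
by rewrite !big_ord_recr/= lnM ?IH// posrE//; apply: prodr_gt0 => i _.
Qed.

(** * The tail of H *)

Section PerturbedSum.
Context {R : realType}.
Variables (alpha a C0 y0 : R) (x : nat -> R) (k : R -> nat).
Hypotheses (alpha_gt0 : 0 < alpha) (C0_ge0 : 0 <= C0) (y0_ge1 : 1 <= y0).
Hypothesis x_ge0 : forall n, 0 <= x n.
Hypothesis kP : forall n y, (x n <= y) = (n < k y)%N.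
Hypothesis nP : forall y, y0 <= y ->
  `|(k y)%:R * expR (- y) - alpha * y `^ a| <= C0 * y `^ (a - 1).
Notation h y := (\sum_(i < k y) expR (- x i)).
Variables (Ch y1 C c2 Lam : R).
Hypotheses (Lam_ge0 : 0 <= Lam) (c2_ge0 : 0 <= c2).
Hypothesis hP : forall y, y1 <= y -> h y <= Ch * (y ^+ 2 * (y `^ (a - 1) * ln y)).

(** The order of quantifiers is the point: [K] and [Lmin] precede the functions, so the final
    constants are the same for all families of laws. *)
Lemma perturbed_sum_estimate : exists K Lmin, [/\ 1 <= K, 4 <= Lmin &
  forall (gs dgs : nat -> R -> R) (g dg : R -> R) (L X lam : R),
  cgf_bounds C g dg -> (forall i, cgf_bounds C (gs i) (dgs i)) ->
  (forall i u, (0 < i)%N -> 0 <= u ->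
    `|gs i u - g u| <= u * (c2 / ln i.+1%:R ^+ 2) /\
    `|gs i u - g u| <= 132 * u ^+ 2 * (c2 / ln i.+1%:R ^+ 2)) ->
  Lmin <= L -> L + ln X <= X -> L <= X -> `|lam| <= Lam ->
  `|\sum_(i < k X) gs i (expR (L + lam - x i)) - expR (L + lam) * h L -
    alpha * expR (L + lam) * L `^ a * (lam + eta_of g)| <=
  K * (expR L * (L `^ (a - 1) * ln L))].
Proof.
have [y2 hy2] := count_lower alpha_gt0 C0_ge0 y0_ge1 nP.
pose z := Num.max y0 y1.
have z0 : y0 <= z by rewrite /z le_max lexx.
have z1 : y1 <= z by rewrite /z le_max lexx orbT.
have z_ge1 : 1 <= z by exact: le_trans z0.
have nPz y : z <= y -> `|(k y)%:R * expR (- y) - alpha * y `^ a| <= C0 * y `^ (a - 1).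
  by move=> zy; apply: nP; exact: le_trans zy.
have hPz y : z <= y -> h y <= Ch * (y ^+ 2 * (y `^ (a - 1) * ln y)).
  by move=> zy; apply: hP; exact: le_trans zy.
pose L0 := 2 * z + 8 * `|a| + 2 * `|a - 1| + 4 + expR (Lam + 1) + 2 * Lam.
have [K1 hK1] : exists K1, forall (g dg : R -> R) (L X lam : R),
    cgf_bounds C g dg -> L0 <= L -> L + ln X <= X -> L <= X -> `|lam| <= Lam ->
    `|\sum_(i < k X) g (expR (L + lam - x i)) - expR (L + lam) * h L -
      alpha * expR (L + lam) * L `^ a * (lam + eta_of g)| <=
    K1 * (expR L * (L `^ (a - 1) * ln L)).
  eexists => g dg L X lam gP LL LX LX' laml.
  exact: (cgf_sum_estimate alpha_gt0 C0_ge0 z_ge1 x_ge0 kP nPz hPz Lam_ge0 gP LL).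
pose L1 := z + 4 * Lam + 8 * `|a| + 2 * `|a - 1| + 4.
have [K2 hK2] : exists K2, forall (gs dgs : nat -> R -> R) (g dg : R -> R) (L X lam : R),
    cgf_bounds C g dg -> (forall i, cgf_bounds C (gs i) (dgs i)) ->
    (forall i u, (0 < i)%N -> 0 <= u ->
      `|gs i u - g u| <= u * (c2 / ln i.+1%:R ^+ 2) /\
      `|gs i u - g u| <= 132 * u ^+ 2 * (c2 / ln i.+1%:R ^+ 2)) ->
    L1 <= L -> 2 * y2 <= L -> L + ln X <= X -> L <= X -> `|lam| <= Lam ->
    `|\sum_(i < k X) gs i (expR (L + lam - x i)) -
      \sum_(i < k X) g (expR (L + lam - x i))| <=
    K2 * (expR L * (L `^ (a - 1) * ln L)).
  eexists => gs dgs g dg L X lam gP gsP gsg LL L2 LX LX' laml.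
  have kL : expR (L / 4) <= (k (L / 2))%:R.
    have -> : L / 4 = L / 2 / 2 by field.
    by apply: hy2; lra.
  have hL : h L <= Ch * (L ^+ 2 * (L `^ (a - 1) * ln L)).
    apply: hPz; move: LL; rewrite /L1; have := normr_ge0 a; have := normr_ge0 (a - 1).
    have := Lam_ge0; lra.
  exact: (cgf_sum_difference alpha_gt0 C0_ge0 z_ge1 x_ge0 kP nPz Lam_ge0 c2_ge0
    gP gsP gsg LL kL LX LX' laml hL).
exists (Num.max 1 (K1 + K2)), (Num.max (Num.max 4 (2 * y2)) (Num.max L0 L1)).
split; [by rewrite le_max lexx|by rewrite !le_max lexx|].
move=> gs dgs g dg L X lam gP gsP gsg; rewrite !ge_max -!andbA => /and4P[l4 l2 l0 l1].
move=> LX LX' laml.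
have h1 := hK1 g dg L X lam gP l0 LX LX' laml.
have h2 := hK2 gs dgs g dg L X lam gP gsP gsg l1 l2 LX LX' laml.
have T0 : 0 <= expR L * (L `^ (a - 1) * ln L).
  by rewrite !mulr_ge0 ?expR_ge0 ?powR_ge0 ?ln_ge0//; lra.
apply: (@le_trans _ _ ((K1 + K2) * (expR L * (L `^ (a - 1) * ln L)))); last first.
  by rewrite ler_wpM2r// le_max lexx orbT.
rewrite mulrDl.
move: (\sum_(i < k X) gs i _) (\sum_(i < k X) g _) h1 h2 => s1 s2 h1 h2.
have := ler_normD (s1 - s2) (s2 - expR (L + lam) * h L -
  alpha * expR (L + lam) * L `^ a * (lam + eta_of g)).
have -> : s1 - s2 + (s2 - expR (L + lam) * h L -
  alpha * expR (L + lam) * L `^ a * (lam + eta_of g)) =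
  s1 - expR (L + lam) * h L - alpha * expR (L + lam) * L `^ a * (lam + eta_of g) by ring.
by move=> /le_trans; apply; rewrite addrC lerD.
Qed.

End PerturbedSum.

(** Rewrites the absolute error as m eps, where m = alpha e^(L-1-eta) L^a; the factor e^(1+2C)
    compensates for e^(-1-eta) uniformly. *)
Lemma error_scale {R : realType} (alpha a C eta K L : R) : 0 < alpha -> 1 <= K ->
  `|eta| <= 2 * C -> 4 <= L ->
  K * (expR L * (L `^ (a - 1) * ln L)) <=
  alpha * expR (L - 1 - eta) * L `^ a * (K * expR (1 + 2 * C) / alpha * (ln L / L)).
Proof.
move=> al0 K1 eC L4; have L0 : 0 < L by lra.
have l0 : 0 <= ln L by apply: ln_ge0; lra.
have p0 := powR_ge0 L (a - 1).
have -> : alpha * expR (L - 1 - eta) * L `^ a * (K * expR (1 + 2 * C) / alpha * (ln L / L)) =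
  K * (expR (L - 1 - eta) * expR (1 + 2 * C) * (L `^ (a - 1) * ln L)).
  by rewrite (powR_split a L0); field; rewrite !gt_eqF.
rewrite -expRD ler_wpM2l//; first lra.
rewrite ler_wpM2r ?mulr_ge0// ler_expR.
by have := ler_norm eta; lra.
Qed.

Lemma tail_of_log_mgf d (T : measurableType d) {R : realType} (P : probability T R)
    (H : T -> R) (B V alpha a C eta K L : R) :
  measurable_fun setT H -> (forall w, `|H w| <= B) ->
  0 < alpha -> 1 <= K -> `|eta| <= 2 * C -> 4 <= L ->
  64 * (K * expR (1 + 2 * C) / alpha) * ln L <= L -> 1 <= expR L * L `^ (a - 1) ->
  (forall lam, `|lam| <= 2 + 2 * C ->
    `|ln (\int[P]_w expR (expR (L + lam) * H w)) - expR (L + lam) * V -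
      alpha * expR (L + lam) * L `^ a * (lam + eta)| <=
    K * (expR L * (L `^ (a - 1) * ln L))) ->
  exists e, `|e| <= 66 * Num.sqrt (K * expR (1 + 2 * C) / alpha * (ln L / L)) /\
    P [set w | V < H w] =
      (expR (- (alpha * expR (- eta - 1) * expR L * L `^ a * (1 + e))))%:E.
Proof.
move=> mH HB al0 K1 eC L4 Lsmall T1 est; have L0 : 0 < L by lra.
have ln1 := ln_ge1 L4.
pose eps := K * expR (1 + 2 * C) / alpha * (ln L / L).
have scale := error_scale a al0 K1 eC L4; rewrite -/eps in scale.
have K20 : 0 <= K * expR (1 + 2 * C) / alpha.
  by apply: divr_ge0; [apply: mulr_ge0; [lra|exact: expR_ge0]|exact: ltW].
have eps0 : 0 <= eps by apply: mulr_ge0 => //; apply: divr_ge0; lra.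
have eps64 : eps <= 64^-1.
  have h64 : 0 < (64 : R) by [].
  rewrite /eps mulrA ler_pdivrMr// [64^-1 * L]mulrC ler_pdivlMr// mulrC mulrA.
  exact: Lsmall.
have S0 : 0 < expR (L - 1 - eta) by exact: expR_gt0.
have m0 : 0 < alpha * expR (L - 1 - eta) * L `^ a.
  by rewrite mulr_gt0 ?powR_gt0// mulr_gt0.
have meps : 1 <= alpha * expR (L - 1 - eta) * L `^ a * eps.
  apply: (le_trans _ scale).
  have t1 : 1 <= expR L * (L `^ (a - 1) * ln L) by nra.
  by nra.
have s8 : 8 * Num.sqrt eps <= 1.
  have e8 : (8^-1 : R) = Num.sqrt (8^-1 ^+ 2) by rewrite sqrtr_sqr ger0_norm// invr_ge0.
  have : Num.sqrt eps <= 8^-1 by rewrite e8 ler_sqrt// -?exprVn; lra.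
  lra.
have [|e [e66 ->]] := @tail_probability _ _ _ P H B V mH HB _ _ _ S0 m0 eps0 s8 meps.
  move=> u u01.
  have /andP[u0 u1] := u01.
  have Es : expR (L - 1 - eta) * expR u = expR (L + (u - 1 - eta)).
    by rewrite -expRD; congr expR; ring.
  (* The tilts with u in [0, 1] stay in a window fixed by C alone, on which the estimate is
     uniform. *)
  rewrite Es; have laml : `|u - 1 - eta| <= 2 + 2 * C.
    move: eC; rewrite !ler_norml => /andP[h1 h2]; apply/andP; split; lra.
  have := est _ laml.
  have -> : alpha * expR (L + (u - 1 - eta)) * L `^ a * (u - 1 - eta + eta) =
    alpha * expR (L - 1 - eta) * L `^ a * (expR u * (u - 1)) by rewrite -Es; ring.
  by move=> /le_trans; apply.
exists e; split=> //; congr (expR (- _))%:E.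
have -> : expR (L - 1 - eta) = expR (- eta - 1) * expR L.
  by rewrite -expRD; congr expR; ring.
by ring.
Qed.

Lemma log_mgf_sum d (T : measurableType d) {R : realType} (P : probability T R)
    (Yn : nat -> {RV P >-> R}) (q : nat -> R) m (s : R) :
  mutually_independent P (fun n => Yn n : T -> R) ->
  (forall n, {ae P, forall w, `|Yn n w| <= 1} /\ ('E_P[Yn n] = 0)%E) ->
  ln (\int[P]_w expR (s * clipped_sum Yn q m w)) =
  \sum_(i < m) ln (mgf P (clip \o Yn i) (s / q i)).
Proof.
move=> ind Y1; rewrite E_exp_clipped_sum//.
rewrite (@ln_prod_ord _ m (fun i => mgf P (clip \o Yn i) (s / q i)))// => i.
apply: mgf_gt0.
- exact: measurable_clip_comp.
- by move=> w; exact: clip_le1.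
- by rewrite /= (E_clip (Y1 i).1) (Y1 i).2.
Qed.

Unset Implicit Arguments.

Theorem theorem6p1 (R : realType) (alpha beta A B CA c0 c1 c2 : R)
    (q : nat -> R)
    (alpha_gt0 : 0 < alpha) (beta_gt0 : 0 < beta) (A_ge0 : 0 <= A)
    (B_gt : Num.max A 1 < B)
    (q_ge1 : forall n, 1 <= q n) (q_ndecr : nondecreasing_seq q)
    (q_count : counting_hypothesis alpha beta A B q)
    (q_CA : is_CA alpha beta A q CA)
    (c0_gt0 : 0 < c0) (c1_gt0 : 0 < c1) (c2_gt0 : 0 < c2) :
  exists Theta c K Q0 : R, 0 < Theta /\ 1 < c /\
  forall (Q : R), Q0 <= Q ->
  forall (d : measure_display) (T : measurableType d) (P : probability T R)
    (Yn : nat -> {RV P >-> R})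
    (d' : measure_display) (T' : measurableType d') (P' : probability T' R)
    (Y : {RV P' >-> R}),
  CRVH c0 c1 c2 Yn Y ->
  forall V Z : R, c <= V -> V <= Rbound alpha A CA Theta Q ->
  is_smallest [set z | V <= Hsum q z] Z ->
  exists e : R, `|e| <= K * Num.sqrt (Eterm B Z) /\
    PhiQ q Yn Q V =
    (expR (- (alpha * expR (- etaY Y - 1) * Z * ln Z `^ (A - 1) * (1 + e))))%:E.
Proof.
have B1 : 1 < B by apply: le_lt_trans B_gt; rewrite le_max lexx orbT.
have [N NP] := exists_count q_ndecr q_count.
have [C0' [y0 [y01 nP']]] := count_asymptotics alpha_gt0 beta_gt0 B1 q_count NP.
pose a := A - 1; pose C0 := `|C0'|.
have C00 : 0 <= C0 by exact: normr_ge0.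
have nP y : y0 <= y -> `|(N (expR y))%:R * expR (- y) - alpha * y `^ a| <= C0 * y `^ (a - 1).
  move=> yy; apply: (le_trans (nP' y yy)).
  by rewrite ler_wpM2r ?powR_ge0// ler_norm.
have q0 i : 0 < q i by apply: lt_le_trans (q_ge1 i).
have [Ch [y1 hP]] := H_upper alpha_gt0 beta_gt0 A_ge0 q_ge1 NP q_CA.
have [th [X0 [th0 hX]]] := Rbound_le_h alpha_gt0 beta_gt0 C00 y01 q_ge1 NP q_CA nP.
have kP := log_count q_ge1 NP; have x_ge0 := log_ge0 q_ge1.
pose h y := \sum_(i < N (expR y)) expR (- ln (q i)).
have hH y : Hsum q (expR y) = h y by exact: Hsum_log.
pose C := cgf_const c0 c1.
have C0_ge0 : 0 <= C.
  rewrite /C /cgf_const; have := divr_ge0 (ler0n R 32) (ltW c1_gt0).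
  have := normr_ge0 (ln c1); have := sqr_ge0 (3 + 27 * (c0 + 1)); lra.
have Lam0 : 0 <= 2 + 2 * C by lra.
have [K [Lmin [K1 Lmin4 est]]] := perturbed_sum_estimate alpha_gt0 C00 y01 x_ge0 kP nP
  C Lam0 (ltW c2_gt0) hP.
pose cg := alpha + 6 * (C0 * 2 `^ `|a - 1| + alpha * (2 * `|a| * expR `|a|)).
have cg0 : 0 <= cg.
  apply: addr_ge0; first exact: ltW.
  have p0 : 0 <= C0 * 2 `^ `|a - 1| by exact: mulr_ge0 (powR_ge0 _ _).
  have p1 : 0 <= 2 * `|a| * expR `|a| by apply: mulr_ge0 (expR_ge0 _); exact: mulr_ge0.
  by have := mulr_ge0 (ltW alpha_gt0) p1; lra.
(* The second summand pays for replacing H(Z) by V, whose difference is multiplied by e^(L+lam). *)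
pose K' := K + expR (2 + 2 * C) * cg.
have K'1 : 1 <= K' by rewrite /K'; have := mulr_ge0 (expR_ge0 (2 + 2 * C)) cg0; lra.
pose K2 := K' * expR (1 + 2 * C) / alpha.
have K20 : 0 < K2.
  by rewrite divr_gt0// mulr_gt0 ?expR_gt0// (lt_le_trans ltr01 K'1).
have i64 : 0 < (64 * K2)^-1 by rewrite invr_gt0 mulr_gt0.
have [L1 hL1] := ln_small i64.
have [L2 hL2] := expR_powR_ge1 (a - 1).
pose Ls := Num.max (Num.max Lmin (2 * y0)) (Num.max L1 L2).
(* The lower limit on V exceeds H(e^Ls), so Z > e^Ls and log Z passes every threshold collected in
   [Ls]. The constant 66 comes from [tail_rate], and [K2] is the ratio of eps to ln L / L. *)
exists th, (Num.max 1 (h Ls) + 1), (66 * Num.sqrt K2), (expR (Num.max X0 1)).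
split=> //; split.
  by rewrite ltrDr lt_max ltr01.
move=> Q QQ0 d T P Yn d' T' P' Y [indY Y1 Ytail [Yt [_ Yt_law _ Yn_Yt]]] V Z cV VR Zs.
have [VZ Zmin] := is_smallest_Hsum Zs.
have VhLs : h Ls < V.
  by apply: lt_le_trans cV; rewrite ltr_pwDr// le_max lexx orbT.
have Z0 : expR Ls < Z.
  rewrite ltNge; apply/negP => ZL.
  have : Hsum q Z <= Hsum q (expR Ls).
    rewrite !(Hsum_count NP); apply: (@sum_ord_le _ (fun i => (q i)^-1)).
      case: (posnP (N Z)) => [->//|NZ].
      have := leqnn (N Z); rewrite -[X in (X <= _)%N -> _](prednK NZ) -NP => h1.
      by rewrite -(prednK NZ) -NP; exact: le_trans h1 ZL.
    by move=> i; rewrite invr_ge0 ltW.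
  by rewrite hH => /(le_trans VZ); rewrite leNgt VhLs.
have Zp : 0 < Z by apply: lt_trans Z0; exact: expR_gt0.
pose L := ln Z; have ZE : expR L = Z by rewrite lnK.
have LsL : Ls <= L by rewrite -[leLHS]expRK ler_ln ?posrE ?expR_gt0// ltW.
have Qp : 0 < Q by apply: lt_le_trans QQ0; exact: expR_gt0.
pose X := ln Q; have QE : expR X = Q by rewrite lnK.
have XX : Num.max X0 1 <= X by rewrite -[leLHS]expRK ler_ln ?posrE ?expR_gt0.
move: LsL; rewrite !ge_max -!andbA => /and4P[LLmin Ly0 LL1 LL2].
move: XX; rewrite ge_max => /andP[XX0 X1].
have L4 : 4 <= L by exact: le_trans LLmin.
have Rb : Rbound alpha A CA th Q = Umain alpha A X + CA - (alpha * ln X + th) * X `^ a.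
  rewrite /Rbound /Umain -/X /a; case: eqP => [->|//].
  by rewrite sub0r powR_inv1// (le_trans ler01 X1).
(* If Q / log Q were below Z, minimality of Z would give H(Q / log Q) < V <= R, against
   [Rbound_le_h]. *)
have LX : L + ln X <= X.
  rewrite -lerBrDr -ler_expR ZE leNgt; apply/negP => /Zmin; rewrite hH ltNge => /negP; apply.
  by apply: (le_trans VR); rewrite Rb; exact: hX.
have LX' : L <= X by apply: le_trans LX; rewrite lerDl ln_ge0.
(* Minimality of Z again: every point to its left has H < V. *)
have Vl : h (L - L^-1) <= V.
  rewrite -hH; apply/ltW/Zmin; rewrite -[ltRHS]ZE ltr_expR.
  by rewrite ltrBlDr ltrDl invr_gt0; exact: lt_le_trans L4.
have Vr : V <= h L by rewrite -hH ZE.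
have gap : `|h L - V| <= cg * L `^ (a - 1).
  by apply: (h_gap_le alpha_gt0 C00 y01 q_ge1 NP nP) => //; apply: le_trans L4; rewrite ler_nat.
pose g u := ln (mgf P' (clip \o Y) u).
have gP := Y_cgf c0_gt0 c1_gt0 c2_gt0 Y1 Ytail Yt_law Yn_Yt.
have gsP := Yn_cgf c0_gt0 c1_gt0 Y1 Ytail.
have gsg := Yn_Y_cgf c2_gt0 Y1 Yt_law Yn_Yt.
have etaE := etaY_eta_of c2_gt0 Y1 Yt_law Yn_Yt.
have etaC := norm_eta_le gP; rewrite -etaE in etaC.
have HE w : HY q Yn Q w = \sum_(i < N Q) Yn i w / q i by exact: fsum_le.
have mHY : measurable_fun setT (HY q Yn Q).
  rewrite (_ : HY q Yn Q = fun w => \sum_(i < N Q) Yn i w / q i); last exact/funext.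
  by apply: measurable_sum => i; apply: measurable_funM => //; exact: measurable_cst.
rewrite /PhiQ (P_clipped_sum V mHY HE (fun n => (Y1 n).1)).
have sumE lam : ln (\int[P]_w expR (expR (L + lam) * clipped_sum Yn q (N Q) w)) =
    \sum_(i < N (expR X)) ln (mgf P (clip \o Yn i) (expR (L + lam - ln (q i)))).
  rewrite log_mgf_sum// QE; apply: eq_bigr => i _; congr (ln (mgf _ _ _)).
  by rewrite expRB lnK ?posrE.
have K64 : 0 < 64 * K2 by exact: mulr_gt0.
have Lsmall : 64 * K2 * ln L <= L by rewrite -(ler_pdivlMl _ _ K64); exact: hL1.
have [|e [eL ->]] := @tail_of_log_mgf _ _ _ P (clipped_sum Yn q (N Q)) _ V alpha a C
  (etaY Y) K' L (measurable_clipped_sum Yn q (N Q)) (clipped_sum_le Yn (N Q) q0) alpha_gt0 K'1 etaC L4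
  Lsmall (hL2 L LL2).
  move=> lam laml; rewrite sumE.
  have := est _ _ _ _ L X lam gP gsP gsg LLmin LX LX' laml; rewrite -/(h L) -etaE.
  have T0 : 0 <= L `^ (a - 1) by exact: powR_ge0.
  have l1 := ln_ge1 L4.
  have : `|expR (L + lam) * (h L - V)| <=
      expR (2 + 2 * C) * cg * (expR L * (L `^ (a - 1) * ln L)).
    rewrite normrM ger0_norm ?expR_ge0//.
    have -> : expR (2 + 2 * C) * cg * (expR L * (L `^ (a - 1) * ln L)) =
      expR (2 + 2 * C) * expR L * (cg * L `^ (a - 1) * ln L) by ring.
    rewrite ler_pM ?expR_ge0//.
      by rewrite -expRD ler_expR addrC lerD2r; exact: le_trans (ler_norm _) laml.
    by apply: (le_trans gap); rewrite ler_peMr// mulr_ge0.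
  rewrite [K' * _]mulrDl; move: (\sum_(i < _) _) (expR L * _) => s t h1 h2.
  have := ler_normD (s - expR (L + lam) * h L -
    alpha * expR (L + lam) * L `^ a * (lam + etaY Y)) (expR (L + lam) * (h L - V)).
  have -> : s - expR (L + lam) * h L - alpha * expR (L + lam) * L `^ a * (lam + etaY Y) +
    expR (L + lam) * (h L - V) =
    s - expR (L + lam) * V - alpha * expR (L + lam) * L `^ a * (lam + etaY Y) by ring.
  by move=> /le_trans; apply; exact: lerD.
exists e; split; last by rewrite ZE.
apply: (le_trans eL); rewrite -/K2 -[leRHS]mulrA; apply: ler_wpM2l => //.
rewrite sqrtrM ?(ltW K20)//; apply: ler_wpM2l; first exact: sqrtr_ge0.
by apply: ler_wsqrtr; rewrite /Eterm -/L lerDl invr_ge0 powR_ge0.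
Qed.
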